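(* Let $\Gamma$ be a countable (discrete) group with Kazhdan's property (T) and let $A$ be a countable torsion-free abelian group. Assume there is a non-split central extension $$1 \to A \to G \to \Gamma \to 1.$$ Assume further that at least one of the following holds: (a) $\Gamma$ is perfect; (b) $G$ has property (T) and $A = \mathbb{Z}$. If $\Gamma$ is weakly ucp-stable, then $G$ is not hyperlinear.
   Context: For a finite-dimensional Hilbert space $\mathcal{H}$ of dimension $d$ and $x \in B(\mathcal{H})$, $\tau_d(x) = \frac1d \mathrm{Tr}(x)$ and $\|x\|_{2,\tau_d} = \tau_d(x^*x)^{1/2}$ (normalized Hilbert–Schmidt norm). $U(\mathcal{H})$ is the unitary group of $\mathcal{H}$ and $U(d) = U(\mathbb{C}^d)$. Hyperlinear: a group $G$ is hyperlinear if for every $\epsilon>0$ and every finite subset $F \subset G$ there exist $d \in \mathbb{N}$ and a map $\varphi: F \to U(d)$ such that $\|\varphi(g)\varphi(h) - \varphi(gh)\|_{2,\tau_d} < \epsilon$ for all $g,h \in F$ with $gh \in F$, and $\|\varphi(g) - 1\|_{2,\tau_d} > \sqrt{2} - \epsilon$ for all $g \in F \setminus \{1_G\}$. Hyperlinear approximation of a countable group $\Gamma$: a sequence of maps $\varphi_n : \Gamma \to U(\mathcal{H}_n)$, with $\mathcal{H}_n$ finite-dimensional Hilbert spaces of dimension $d_n$, such that $\lim_n \|\varphi_n(g)\varphi_n(h) - \varphi_n(gh)\|_{2,\tau_{d_n}} = 0$ for all $g,h \in \Gamma$ and $\liminf_n \|\varphi_n(g) - 1\|_{2,\tau_{d_n}}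 \ge \sqrt{2}$ for every $1 \ne g \in \Gamma$. Weakly ucp-stable: a countable group $\Gamma$ is weakly ucp-stable if for every hyperlinear approximation $\varphi_n : \Gamma \to U(\mathcal{H}_n)$ there exist (possibly infinite-dimensional) Hilbert spaces $\widehat{\mathcal{H}}_n \supseteq \mathcal{H}_n$ and homomorphisms $\pi_n : \Gamma \to U(\widehat{\mathcal{H}}_n)$ such that $\|\varphi_n(g) - P_n\pi_n(g)P_n\|_{2,\tau_{\dim \mathcal{H}_n}} \to 0$ as $n \to \infty$ for all $g \in \Gamma$, where $P_n$ is the orthogonal projection of $\widehat{\mathcal{H}}_n$ onto $\mathcal{H}_n$ (so $P_n\pi_n(g)P_n$ is regarded as an operator on $\mathcal{H}_n$). A central extension $1 \to A \to G \to \Gamma \to 1$ (image of $A$ central in $G$) is split if the quotient map $G \to \Gamma$ admits a section that is a group homomorphism; non-split otherwise. *)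

(* Defs.v *)
From mathcomp Require Import all_boot all_order all_algebra.
From mathcomp Require Import all_classical all_reals all_analysis.
From mathcomp.real_closed Require Import complex.

Set Implicit Arguments.
Unset Strict Implicit.
Unset Printing Implicit Defensive.

Import Order.TTheory GRing.Theory Num.Theory Num.Def.
Import numFieldNormedType.Exports.

Local Open Scope classical_set_scope.
Local Open Scope complex_scope.
Local Open Scope ring_scope.
Local Open Scope sesquilinear_scope.

(* Inner products are linear in the first variable, as in [{dot _ for _}]. The
   norm and the scalars live in [R[i]], whose order only compares complex
   numbers with the same imaginary part. *)
Record hilbertType (R : realType) := HilbertType {
  hilbert_sort :> completeNormedModType R[i];
  inner : {dot hilbert_sort for conjC};
  inner_norm : forall v : hilbert_sort, inner v v = `|v| ^+ 2
}.

Section HilbertSpace.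
Context {R : realType} {H : hilbertType R}.

Definition unitary_op (u : H -> H) : Prop :=
  [/\ linear u, forall v w, inner H (u v) (u w) = inner H v w & bijective u].

Definition unitary_rep (Gamma : groupType) (rho : Gamma -> H -> H) : Prop :=
  (forall g, unitary_op (rho g)) /\
  (forall g h v, rho (g * h)%g v = rho g (rho h v)).

Definition orthogonal_projection (K : set H) (P : H -> H) : Prop :=
  forall v, K (P v) /\ (forall w, K w -> inner H (v - P v) w = 0).

Definition hilbert_embedding (d : nat) (iota : 'cV[R[i]]_d -> H) : Prop :=
  linear iota /\
  (forall x y, inner H (iota x) (iota y) = dotmx x^T y^T).

End HilbertSpace.

(* Existence of a Kazhdan pair [(Q, eps)]; in a discrete group the compact
   subsets are the finite ones. *)
Definition property_T (R : realType) (Gamma : groupType) : Prop :=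
  exists (Q : seq Gamma) (eps : R), 0 < eps /\
  forall (H : hilbertType R) (rho : Gamma -> H -> H), unitary_rep rho ->
    (exists v : H, v != 0 /\
       {in Q, forall g, `|rho g v - v| < eps%:C * `|v|}) ->
    exists v : H, v != 0 /\ forall g, rho g v = v.

Section NormalizedTrace.
Context {R : realType} {d : nat}.

Definition ntrace (x : 'M[R[i]]_d) : R[i] := \tr x / d%:R.

Definition hs_norm (x : 'M[R[i]]_d) : R :=
  Num.sqrt (complex.Re (ntrace (x^t* *m x))).

End NormalizedTrace.

Definition hyperlinear (R : realType) (G : groupType) : Prop :=
  forall (eps : R) (F : seq G), 0 < eps ->
  exists (d : nat) (phi : G -> 'M[R[i]]_d),
  [/\ (0 < d)%N,
      {in F, forall g, phi g \is unitarymx},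
      {in F &, forall g h, (g * h)%g \in F ->
         hs_norm (phi g *m phi h - phi (g * h)%g) < eps} &
      {in F, forall g, g != 1%g ->
         Num.sqrt 2 - eps < hs_norm (phi g - 1%:M)}].

(* A [d]-dimensional Hilbert space is identified with the space of column
   vectors [C^d] by the choice of an orthonormal basis. *)
Definition hyperlinear_approximation (R : realType) (Gamma : groupType)
    (d : nat -> nat) (phi : forall n, Gamma -> 'M[R[i]]_(d n)) : Prop :=
  [/\ forall n, (0 < d n)%N,
      forall n g, phi n g \is unitarymx,
      forall g h, (fun n => hs_norm (phi n g *m phi n h - phi n (g * h)%g))
                    @ \oo --> (0 : R) &
      forall g, g != 1%g ->
        ((Num.sqrt 2 : R)%:E
           <= limn_einf (fun n => (hs_norm (phi n g - 1%:M))%:E))%E].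

(* The inclusion of [C^(d n)] in [H n] is the isometry [iota n], and [T n g] is
   the matrix of [P n \o rho n g \o P n] as an operator on [C^(d n)]. *)
Definition weakly_ucp_stable (R : realType) (Gamma : groupType) : Prop :=
  forall (d : nat -> nat) (phi : forall n, Gamma -> 'M[R[i]]_(d n)),
  hyperlinear_approximation phi ->
  exists (H : nat -> hilbertType R)
         (iota : forall n, 'cV[R[i]]_(d n) -> H n)
         (P : forall n, H n -> H n)
         (rho : forall n, Gamma -> H n -> H n)
         (T : forall n, Gamma -> 'M[R[i]]_(d n)),
  [/\ forall n, hilbert_embedding (iota n),
      forall n, orthogonal_projection (range (iota n)) (P n),
      forall n, unitary_rep (rho n),
      forall n g x, iota n (T n g *m x) = P n (rho n g (P n (iota n x))) &
      forall g, (fun n => hs_norm (phi n g - T n g)) @ \oo --> (0 : R)].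

Definition torsion_free (A : zmodType) : Prop :=
  forall (a : A) (n : nat), (0 < n)%N -> a *+ n = 0 -> a = 0.

(* The subgroup generated by the commutators is the whole group. *)
Definition perfect (Gamma : groupType) : Prop :=
  forall S : {pred Gamma}, group_closed S ->
  (forall x y, [~ x, y]%g \in S) -> forall x, x \in S.

Record central_extension (A : zmodType) (G Gamma : groupType)
    (i : A -> G) (q : G -> Gamma) : Prop := CentralExtension {
  ext_inclM : {morph i : a b / a + b >-> (a * b)%g};
  ext_quotM : {morph q : x y / (x * y)%g >-> (x * y)%g};
  ext_incl_inj : injective i;
  ext_quot_surj : range q = setT;
  ext_exact : range i = [set x | q x = 1%g];
  ext_central : forall a x, commute (i a) x
}.

Definition split_extension (G Gamma : groupType) (q : G -> Gamma) : Prop :=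
  exists2 s : Gamma -> G,
    {morph s : x y / (x * y)%g >-> (x * y)%g} & cancel s q.

(* Main.v *)
(* Suppose that G is hyperlinear. Write A additively, fix an additive f : A -> R
   with f a0 = 1 for some a0 != 0, and let chi_t a = exp(i t f(a)). An
   approximation of G with vanishing traces, averaged against chi_t over a
   Foelner subset of A, yields an almost central positive matrix; cutting down by
   it gives approximations psi of G that restrict to the scalars chi_t on A and
   have vanishing trace outside of A. For small t these are almost multiplicative
   on a section of G -> Gamma, so weak ucp-stability provides positive definite
   maps T_n of Gamma close to psi_n. The ultralimit of the traces of
   T_n(q g) psi_n(g)^* is a positive definite function on G that is equivariant
   for the conjugate of chi_t on A and close to 1 on a section over a Kazhdan set,
   and the square of its modulus lives on Gamma. By property (T) this modulus is
   close to 1 everywhere, and the cyclic representation of the function then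
   contains an invariant line: the conjugate of chi_t extends to a character b_t
   of G.
   If Gamma is perfect and the extension is not split, some a0 != 0 lies in the
   commutator subgroup of G, so chi_t a0 = 1, which is false for small t > 0. If G
   has property (T), two of the characters b_t are close on a Kazhdan set of G,
   hence equal, which contradicts their values at a0. *)

From HB Require Import structures.
Require Import Defs.
From mathcomp Require Import all_boot all_order all_algebra.
From mathcomp Require Import all_classical all_reals all_analysis.
From mathcomp.real_closed Require Import complex mxtens.
From mathcomp Require Import ring lra.

Set Implicit Arguments.
Unset Strict Implicit.
Unset Printing Implicit Defensive.

Import Order.TTheory GRing.Theory Num.Theory Num.Def.
Import numFieldNormedType.Exports.
Import ComplexField.Normc.

Local Open Scope classical_set_scope.
Local Open Scope ring_scope.
Local Open Scope sesquilinear_scope.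

(** * Complex numbers and ultralimits *)

(** The cutting down is the delicate step. The averaged matrix is positive but not a projection, so
    it has no corner, and its spectral projections need not almost commute with the approximation.
    It is replaced by the region below the graph of its eigenvalues inside a tensor product with a
    second matrix algebra. Compression to this region is almost multiplicative with an error
    controlled by commutators, and turns the weight given by the matrix into an ordinary matrix
    trace. Stability speaks about Gamma, while the twisted approximations are multiplicative on
    Gamma only up to the scalars chi_t of the extension cocycle. This forces t to be small. A
    real-valued f is what gives small characters that are still nontrivial at a0; torsion-freeness
    makes it available. Hyperlinearity only keeps images away from 1, which bounds the real part of
    the trace; small traces come from adding a trivial summand and taking tensor powers. All limits
    are taken along one fixed ultrafilter: in the completion of a kernel space, for the function on
    G, and for the final characters, which are limits of coefficients along almost invariant
    lines. *)

Section ComplexModulus.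
Context {R : realType}.
Local Notation C := R[i].
Implicit Types (z w : C) (x y : R).

Local Notation toC := (real_complex R).
Local Notation Re := (@complex.Re R).
Local Notation Im := (@complex.Im R).

Lemma complex_eq z w : Re z = Re w -> Im z = Im w -> z = w.
Proof. by case: z => a b; case: w => c d /= -> ->. Qed.

Lemma normcE z : toC (normc z) = `|z|.
Proof. by []. Qed.

Lemma normc_ge0 z : 0 <= normc z.
Proof. by case: z => a b /=; rewrite sqrtr_ge0. Qed.

Lemma normc_J z : normc z^* = normc z.
Proof. by have /= := norm_conjC z; rewrite -!normcE => /complexI. Qed.

Lemma normc_real x : normc (toC x) = `|x|.
Proof. by rewrite /= expr0n addr0 sqrtr_sqr. Qed.

Lemma normc_sqr z : normc z ^+ 2 = Re z ^+ 2 + Im z ^+ 2.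
Proof. by case: z => a b /=; rewrite sqr_sqrtr // addr_ge0 ?sqr_ge0. Qed.

Lemma toC_normc_sqr z : toC (normc z ^+ 2) = z * z^*.
Proof. by rewrite normc_sqr; case: z => a b; apply: complex_eq => /=; ring. Qed.

Lemma normc_eq0 z : (normc z == 0) = (z == 0).
Proof. by apply/eqP/eqP => [/eq0_normc //|->]; rewrite normc0. Qed.

Lemma Re_le_normc z : Re z <= normc z.
Proof.
apply: le_trans (ler_norm _) _; rewrite -ler_sqr ?nnegrE ?normc_ge0 ?normr_ge0 //.
by rewrite normc_sqr real_normK ?num_real // lerDl sqr_ge0.
Qed.

Lemma normRe_le z : `|Re z| <= normc z.
Proof.
rewrite -ler_sqr ?nnegrE ?normc_ge0 ?normr_ge0 //.
by rewrite normc_sqr real_normK ?num_real // lerDl sqr_ge0.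
Qed.

Lemma normIm_le z : `|Im z| <= normc z.
Proof.
rewrite -ler_sqr ?nnegrE ?normc_ge0 ?normr_ge0 //.
by rewrite normc_sqr real_normK ?num_real // lerDr sqr_ge0.
Qed.

Lemma normc_le_ReIm z : normc z <= `|Re z| + `|Im z|.
Proof.
rewrite -ler_sqr ?nnegrE ?normc_ge0 ?addr_ge0 ?normr_ge0 //.
by rewrite normc_sqr sqrrD !real_normK ?num_real // -addrA lerD2l lerDr mulrn_wge0 ?mulr_ge0.
Qed.

Lemma ReD z w : Re (z + w) = Re z + Re w. Proof. by case: z; case: w. Qed.
Lemma ImD z w : Im (z + w) = Im z + Im w. Proof. by case: z; case: w. Qed.
Lemma ReN z : Re (- z) = - Re z. Proof. by case: z. Qed.
Lemma ImN z : Im (- z) = - Im z. Proof. by case: z. Qed.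
Lemma ReM z w : Re (z * w) = Re z * Re w - Im z * Im w.
Proof. by case: z; case: w. Qed.
Lemma ImM z w : Im (z * w) = Re z * Im w + Im z * Re w.
Proof. by case: z; case: w. Qed.
Lemma ReJ z : Re z^* = Re z. Proof. by case: z. Qed.
Lemma ImJ z : Im z^* = - Im z. Proof. by case: z. Qed.
Lemma Re_toCM x z : Re (toC x * z) = x * Re z.
Proof. by rewrite ReM /= mul0r subr0. Qed.

Lemma toC_Re_ge0 z : 0 <= z -> toC (Re z) = z.
Proof. by move=> z0; apply: complex_eq; rewrite //= ger0_Im. Qed.

Lemma Re_ge0 z : 0 <= z -> 0 <= Re z.
Proof. by move=> z0; rewrite -ler0c toC_Re_ge0. Qed.

Lemma ge0_ReIm z : 0 <= Re z -> Im z = 0 -> 0 <= z.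
Proof. by case: z => a b /= a0 ->; rewrite ler0c. Qed.

Lemma normcB z w : normc (z - w) = normc (w - z).
Proof. by rewrite -normcN opprB. Qed.

Lemma ler_normc_sum (I : Type) (s : seq I) (P : pred I) (F : I -> C) :
  normc (\sum_(i <- s | P i) F i) <= \sum_(i <- s | P i) normc (F i).
Proof.
apply: (big_ind2 (fun z x => normc z <= x)) => //; first by rewrite normc0.
by move=> z x w y zx wy; apply: le_trans (le_normcD _ _) (lerD zx wy).
Qed.

(** The form is minimised at [l = - b^* / c]; for [c = 0] it is affine in [l] and bounded below only
    if [b = 0]. Every Cauchy-Schwarz inequality below is an instance. *)
Lemma discriminant_le (a c : R) (b : C) : 0 <= c ->
  (forall l : C, 0 <= a + 2 * Re (l * b) + normc l ^+ 2 * c) ->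
  normc b ^+ 2 <= a * c.
Proof.
move=> c0 H; have [c_gt0|] := ltrP 0 c; last first.
  move=> c_le0; have {c0 c_le0} c0 : c = 0 by apply/eqP; rewrite eq_le c_le0 c0.
  rewrite c0 mulr0; have [->|b0] := eqVneq b 0; first by rewrite normc0 expr0n.
  have nb0 : 0 < normc b ^+ 2.
    by rewrite exprn_gt0 // lt_def normc_ge0 normc_eq0 b0.
  (* At this [l] the form takes the value -1. *)
  have := H (toC (- (a + 1) / (2 * normc b ^+ 2)) * b^*).
  rewrite c0 mulr0 addr0 -mulrA [b^* * b]mulrC -toC_normc_sqr Re_toCM /=.
  set t := normc b ^+ 2 in nb0 *.
  have -> : 2 * (- (a + 1) / (2 * t) * t) = - (a + 1) by field; rewrite gt_eqF.
  lra.
have := H (- toC c^-1 * b^*).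
rewrite -mulrA [b^* * b]mulrC -toC_normc_sqr mulNr ReN Re_toCM /=.
rewrite normcM normcN normc_J normc_real exprMn real_normK ?num_real //.
set t := normc b ^+ 2 => h.
rewrite -subr_ge0; have := mulr_ge0 (ltW c_gt0) h.
by congr (0 <= _); field; rewrite gt_eqF.
Qed.

End ComplexModulus.

(** * Limits of bounded sequences along a fixed nonprincipal ultrafilter *)

Section UltraLimit.
Context {R : realType}.
Local Notation C := R[i].

Definition omega : set_system nat :=
  projT1 (cid (ultraFilterLemma (F := \oo) _)).

Lemma omega_ultra : UltraFilter omega.
Proof. by rewrite /omega; case: cid => F []. Qed.

Lemma omega_proper : ProperFilter omega.
Proof. exact: (@ultra_proper _ _ omega_ultra). Qed.

Local Existing Instance omega_proper.

Lemma omega_oo : \oo `<=` omega.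
Proof. by rewrite /omega; case: cid => F []. Qed.

Lemma cvg_omega (u : nat -> R) (l : R) : u @ \oo --> l -> u @ omega --> l.
Proof. by move=> ul A /ul; apply: omega_oo. Qed.

Definition ulim (u : nat -> R) : R := lim (u @ omega).

Definition ubounded (u : nat -> C) := exists M, forall n, normc (u n) <= M.

Definition culim (u : nat -> C) : C :=
  Complex (ulim (@complex.Re R \o u)) (ulim (@complex.Im R \o u)).

Lemma ulim_cvg (u : nat -> R) (M : R) : (forall n, `|u n| <= M) ->
  u @ omega --> ulim u.
Proof.
move=> uM; have := @segment_compact R (- M) M.
rewrite compact_ultra => /(_ (u @ omega)) [].
- have := omega_ultra => oU; split; first exact: fmap_proper_filter.
  move=> G GP sub; apply/seteqP; split=> // A GA.
  have [//|uA] := in_ultra_setVsetC (u @^-1` A) oU.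
  have GnA : G (~` A) by apply: sub.
  by have [x []] := @filter_ex _ G GP _ (filterI GA GnA).
- by apply: omega_oo; near=> n; rewrite /= in_itv /= -ler_norml.
- by move=> l [_ ul]; apply/cvg_ex; exists l.
Unshelve. all: by end_near. Qed.

Lemma ulim_eq (u : nat -> R) (l : R) : u @ omega --> l -> ulim u = l.
Proof. exact: cvg_lim. Qed.

Lemma ubounded_Re (u : nat -> C) : ubounded u ->
  (@complex.Re R \o u) @ omega --> ulim (@complex.Re R \o u).
Proof.
by case=> M uM; apply: (@ulim_cvg _ M) => n; apply: le_trans (normRe_le _) _.
Qed.

Lemma ubounded_Im (u : nat -> C) : ubounded u ->
  (@complex.Im R \o u) @ omega --> ulim (@complex.Im R \o u).
Proof.
by case=> M uM; apply: (@ulim_cvg _ M) => n; apply: le_trans (normIm_le _) _.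
Qed.

Lemma uboundedD u v : ubounded u -> ubounded v -> ubounded (fun n => u n + v n).
Proof.
move=> [M uM] [N vN]; exists (M + N) => n.
by apply: le_trans (le_normcD _ _) _; apply: lerD.
Qed.

Lemma uboundedM u v : ubounded u -> ubounded v -> ubounded (fun n => u n * v n).
Proof.
move=> [M uM] [N vN]; exists (M * N) => n.
by rewrite normcM ler_pM ?normc_ge0.
Qed.

Lemma uboundedJ u : ubounded u -> ubounded (fun n => (u n)^*).
Proof. by move=> [M uM]; exists M => n; rewrite normc_J. Qed.

Lemma ubounded_cst c : ubounded (fun=> c).
Proof. by exists (normc c). Qed.

Lemma culim_cst c : culim (fun=> c) = c.
Proof.
by apply: complex_eq; apply: ulim_eq; apply: cvg_cst.
Qed.

Lemma culimD u v : ubounded u -> ubounded v ->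
  culim (fun n => u n + v n) = culim u + culim v.
Proof.
move=> bu bv; apply: complex_eq; rewrite ?ReD ?ImD /=; apply: ulim_eq.
- rewrite (_ : _ \o _ = (@complex.Re R \o u) \+ (@complex.Re R \o v)).
    by apply: cvgD; apply: ubounded_Re.
  by apply/funext => n /=; rewrite ReD.
- rewrite (_ : _ \o _ = (@complex.Im R \o u) \+ (@complex.Im R \o v)).
    by apply: cvgD; apply: ubounded_Im.
  by apply/funext => n /=; rewrite ImD.
Qed.

Lemma culimM u v : ubounded u -> ubounded v ->
  culim (fun n => u n * v n) = culim u * culim v.
Proof.
move=> bu bv; have [ur ui] := (ubounded_Re bu, ubounded_Im bu).
have [vr vi] := (ubounded_Re bv, ubounded_Im bv).
apply: complex_eq; rewrite ?ReM ?ImM /=; apply: ulim_eq.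
- rewrite (_ : _ \o _ = ((@complex.Re R \o u) \* (@complex.Re R \o v))
      \- ((@complex.Im R \o u) \* (@complex.Im R \o v))).
    by apply: cvgB; apply: cvgM.
  by apply/funext => n /=; rewrite ReM.
- rewrite (_ : _ \o _ = ((@complex.Re R \o u) \* (@complex.Im R \o v))
      \+ ((@complex.Im R \o u) \* (@complex.Re R \o v))).
    by apply: cvgD; apply: cvgM.
  by apply/funext => n /=; rewrite ImM.
Qed.

Lemma culimZ c u : ubounded u -> culim (fun n => c * u n) = c * culim u.
Proof. by move=> bu; rewrite culimM ?culim_cst //; apply: ubounded_cst. Qed.

Lemma culimJ u : ubounded u -> culim (fun n => (u n)^*) = (culim u)^*.
Proof.
move=> bu; apply: complex_eq; rewrite ?ReJ ?ImJ /=.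
- by congr ulim; apply/funext => n /=; rewrite ReJ.
- apply: ulim_eq; rewrite (_ : _ \o _ = \- (@complex.Im R \o u)).
    by apply: cvgN; apply: ubounded_Im.
  by apply/funext => n /=; rewrite ImJ.
Qed.

Lemma culim_sum (I : Type) (s : seq I) (F : I -> nat -> C) :
  (forall i, ubounded (F i)) ->
  ubounded (fun n => \sum_(i <- s) F i n) /\
  culim (fun n => \sum_(i <- s) F i n) = \sum_(i <- s) culim (F i).
Proof.
move=> bF; elim: s => [|i s [bs es]].
  rewrite big_nil; rewrite (_ : (fun n => _) = (fun=> 0)).
    by split; [apply: ubounded_cst | rewrite culim_cst].
  by apply/funext => n; rewrite big_nil.
rewrite big_cons; rewrite (_ : (fun n => _) = fun n => F i n + \sum_(i <- s) F i n).
  by split; [apply: uboundedD | rewrite culimD // es].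
by apply/funext => n; rewrite big_cons.
Qed.

Lemma culim_cvg u c : (fun n => normc (u n - c)) @ \oo --> (0 : R) ->
  culim u = c.
Proof.
move=> uc; apply: complex_eq; apply: ulim_eq; apply: cvg_omega.
- apply/subr_cvg0; apply: norm_cvg0; apply: (@squeeze_cvgr _ _ _ _ (fun=> 0)) uc.
    by near=> n; rewrite normr_ge0 /=; have := normRe_le (u n - c); rewrite ReD ReN.
  exact: cvg_cst.
- apply/subr_cvg0; apply: norm_cvg0; apply: (@squeeze_cvgr _ _ _ _ (fun=> 0)) uc.
    by near=> n; rewrite normr_ge0 /=; have := normIm_le (u n - c); rewrite ImD ImN.
  exact: cvg_cst.
Unshelve. all: by end_near. Qed.

Lemma culim_eq u v : ubounded u -> ubounded v ->
  (fun n => normc (u n - v n)) @ \oo --> (0 : R) -> culim u = culim v.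
Proof.
move=> bu bv uv; have bNv : ubounded (fun n => -1 * v n).
  by apply: uboundedM => //; apply: ubounded_cst.
apply/eqP; rewrite -subr_eq0 -mulN1r -culimZ // -culimD //.
apply/eqP/culim_cvg; rewrite (_ : (fun n => _) = fun n => normc (u n - v n)) //.
by apply/funext => n; rewrite mulN1r subr0.
Qed.

Lemma culim_Re_le u x : ubounded u -> (\forall n \near \oo, complex.Re (u n) <= x) ->
  complex.Re (culim u) <= x.
Proof.
move=> bu /omega_oo ux; apply: limr_le; last exact: ux.
by apply/cvg_ex; exists (ulim (@complex.Re R \o u)); apply: ubounded_Re.
Qed.

Lemma culim_ge0 u : ubounded u -> (forall n, 0 <= u n) -> 0 <= culim u.
Proof.
move=> bu u0; apply: ge0_ReIm => /=.
  apply: limr_ge; last by apply: nearW => n; apply: Re_ge0.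
  by apply/cvg_ex; exists (ulim (@complex.Re R \o u)); apply: ubounded_Re.
apply: ulim_eq; rewrite (_ : _ \o _ = fun=> 0); first exact: cvg_cst.
by apply/funext => n /=; rewrite ger0_Im.
Qed.

(** Multiplying by the conjugate of the limit reduces the bound on the modulus to one on the real
    part. *)
Lemma culim_normc_le u x : ubounded u -> (\forall n \near \oo, normc (u n) <= x) ->
  normc (culim u) <= x.
Proof.
move=> bu ux; set c := culim u.
have [->|c0] := eqVneq c 0.
  have [n un] := filter_ex ux.
  by rewrite normc0; apply: le_trans (normc_ge0 _) un.
have nc0 : 0 < normc c by rewrite lt_def normc_ge0 normc_eq0 c0.
rewrite -(ler_pM2l nc0) -expr2.
suff : complex.Re (culim (fun n => c^* * u n)) <= normc c * x.
  by rewrite culimZ // mulrC -toC_normc_sqr.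
apply: culim_Re_le; first by apply: uboundedM => //; apply: ubounded_cst.
near=> n; apply: le_trans (Re_le_normc _) _.
rewrite normcM normc_J ler_pM2l //; near: n; exact: ux.
Unshelve. all: by end_near. Qed.

End UltraLimit.

(** * Positive definite functions and property (T) *)

(* The completion of the pre-Hilbert space spanned by a positive semidefinite
   kernel is realised inside the functions [X -> C]: a vector is the function
   [x |-> <F, x>] it induces on the generators, so that no quotient is needed. *)
Section KernelHilbertSpace.
Context {R : realType} {X : Type} (K : X -> X -> R[i]).
Local Notation C := R[i].
Local Notation toC := (real_complex R).
Local Notation Re := (@complex.Re R).
Implicit Types (u v w : seq (C * X)) (F : X -> C).

Definition keval F v : C := \sum_(r <- v) r.1^* * F r.2.
Definition kspan u (x : X) : C := \sum_(p <- u) p.1 * K p.2 x.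
Definition kform u v : C := keval (kspan u) v.
Definition kscale (c : C) u := [seq (c * p.1, p.2) | p <- u].

Definition psd_kernel := forall s, 0 <= kform s s.

Lemma keval_cat F u v : keval F (u ++ v) = keval F u + keval F v.
Proof. exact: big_cat. Qed.

Lemma keval_scale F c v : keval F (kscale c v) = c^* * keval F v.
Proof.
rewrite /keval big_map big_distrr /=; apply: eq_bigr => p _.
by rewrite rmorphM /= mulrA.
Qed.

Lemma kevalD F F' v : keval (fun x => F x + F' x) v = keval F v + keval F' v.
Proof. by rewrite /keval -big_split /=; apply: eq_bigr => p _; rewrite mulrDr. Qed.

Lemma kevalZ F c v : keval (fun x => c * F x) v = c * keval F v.
Proof. by rewrite /keval big_distrr /=; apply: eq_bigr => p _; rewrite mulrCA. Qed.

Lemma keval0 v : keval (fun=> 0) v = 0.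
Proof. by rewrite /keval big1 // => p _; rewrite mulr0. Qed.

Lemma keval1 F x : keval F [:: (1, x)] = F x.
Proof. by rewrite /keval big_seq1 /= conjC1 mul1r. Qed.

Lemma kspan_cat u v x : kspan (u ++ v) x = kspan u x + kspan v x.
Proof. exact: big_cat. Qed.

Lemma kspan_scale c u x : kspan (kscale c u) x = c * kspan u x.
Proof.
by rewrite /kspan big_map big_distrr /=; apply: eq_bigr => p _; rewrite mulrA.
Qed.

Lemma kform_catl u v w : kform (u ++ v) w = kform u w + kform v w.
Proof. by rewrite /kform -kevalD; congr keval; apply/funext => x; rewrite kspan_cat. Qed.

Lemma kform_catr u v w : kform u (v ++ w) = kform u v + kform u w.
Proof. exact: keval_cat. Qed.

Lemma kform_scalel c u w : kform (kscale c u) w = c * kform u w.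
Proof. by rewrite /kform -kevalZ; congr keval; apply/funext => x; rewrite kspan_scale. Qed.

Lemma kform_scaler c u w : kform u (kscale c w) = c^* * kform u w.
Proof. exact: keval_scale. Qed.

Lemma kform_sum u v :
  kform u v = \sum_(p <- u) \sum_(r <- v) p.1 * r.1^* * K p.2 r.2.
Proof.
rewrite /kform /keval exchange_big /=; apply: eq_bigr => r _.
rewrite /kspan big_distrr /=; apply: eq_bigr => p _.
by rewrite mulrA [r.1^* * _]mulrC.
Qed.

Context (K_psd : psd_kernel).

Lemma kformC u v : kform u v = (kform v u)^*.
Proof.
have := K_psd (u ++ v); have := K_psd (u ++ kscale 'i%C v).
have := K_psd u; have := K_psd v.
rewrite !kform_catl !kform_catr !kform_scalel !kform_scaler.
move=> /ger0_Im hv /ger0_Im hu /ger0_Im h2 /ger0_Im h1; move: hv hu h1 h2.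
case: (kform u u) (kform v v) (kform u v) (kform v u) => [a b] [c d] [e f] [g h] /=.
by move=> -> -> h1 h2; apply: complex_eq => /=; lra.
Qed.

Definition ksqr u : R := Re (kform u u).

Lemma ksqr_ge0 u : 0 <= ksqr u.
Proof. exact: Re_ge0. Qed.

Lemma kform_CauchySchwarz u v : normc (kform u v) ^+ 2 <= ksqr v * ksqr u.
Proof.
apply: discriminant_le => [|l]; first exact: ksqr_ge0.
have := ksqr_ge0 (v ++ kscale l u); congr (0 <= _).
rewrite /ksqr kform_catl !kform_catr !kform_scalel !kform_scaler !ReD.
rewrite mulrA -toC_normc_sqr Re_toCM [kform v u]kformC -rmorphM ReJ.
by rewrite mulr2n mulrDl mul1r !addrA.
Qed.

Definition knorm u : R := Num.sqrt (ksqr u).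

Lemma knorm_ge0 u : 0 <= knorm u. Proof. exact: sqrtr_ge0. Qed.

Lemma knorm_sqr u : knorm u ^+ 2 = ksqr u.
Proof. by rewrite sqr_sqrtr // ksqr_ge0. Qed.

Lemma normc_kform_le u v : normc (kform u v) <= knorm u * knorm v.
Proof.
rewrite -ler_sqr ?nnegrE ?normc_ge0 ?mulr_ge0 ?knorm_ge0 //.
by rewrite exprMn !knorm_sqr mulrC kform_CauchySchwarz.
Qed.

(** Membership in the closure of the span. The distance is written as a dual norm because a vector
    is only known through its pairings with the span. *)
Definition approximable F := forall e : R, 0 < e ->
  exists u, forall v, normc (keval F v - kform u v) <= e * knorm v.

Lemma approximable0 : approximable (fun=> 0).
Proof.
move=> e e0; exists [::] => v; rewrite keval0 /kform.
rewrite (_ : kspan [::] = fun=> 0) ?keval0 ?subr0 ?normc0 ?mulr_ge0 ?knorm_ge0 ?ltW//.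
by apply/funext => x; rewrite /kspan big_nil.
Qed.

Lemma approximableD F F' : approximable F -> approximable F' ->
  approximable (fun x => F x + F' x).
Proof.
move=> aF aF' e e0; have e20 : 0 < e / 2 by rewrite divr_gt0.
have [u Fu] := aF _ e20; have [u' Fu'] := aF' _ e20.
exists (u ++ u') => v; rewrite kevalD kform_catl opprD addrACA.
apply: le_trans (le_normcD _ _) _; apply: le_trans (lerD (Fu v) (Fu' v)) _.
by rewrite -mulrDl -splitr.
Qed.

Lemma approximableZ F c : approximable F -> approximable (fun x => c * F x).
Proof.
move=> aF e e0; have c1 : 0 < normc c + 1 by rewrite ltr_pwDr ?normc_ge0.
have [u Fu] := aF _ (divr_gt0 e0 c1); exists (kscale c u) => v.
rewrite kevalZ kform_scalel -mulrBr normcM.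
apply: le_trans (ler_wpM2l (normc_ge0 c) (Fu v)) _.
rewrite mulrA ler_wpM2r ?knorm_ge0 // mulrCA ler_piMr ?(ltW e0) //.
by rewrite ler_pdivrMr // mul1r; lra.
Qed.

Lemma approximable_span u : approximable (kspan u).
Proof.
by move=> e e0; exists u => v; rewrite subrr normc0 mulr_ge0 ?knorm_ge0 ?ltW.
Qed.

Lemma approximable_bound F : approximable F ->
  exists2 B, 0 <= B & forall v, normc (keval F v) <= B * knorm v.
Proof.
move=> /(_ 1 ltr01)[u Fu]; exists (1 + knorm u); first by rewrite addr_ge0 ?knorm_ge0.
move=> v; rewrite -[keval F v](subrK (kform u v)).
apply: le_trans (le_normcD _ _) _; rewrite mulrDl lerD //.
exact: normc_kform_le.
Qed.

Record kernel_space := KernelVector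
  { kvec :> X -> C; kvecP : approximable kvec }.

Lemma kernel_space_eq (F G : kernel_space) : (F : X -> C) =1 G -> F = G.
Proof.
case: F G => [F aF] [G aG] /= /funext eFG; case: _ / eFG in aG *.
by congr KernelVector; apply: Prop_irrelevance.
Qed.

HB.instance Definition _ := gen_eqMixin kernel_space.
HB.instance Definition _ := gen_choiceMixin kernel_space.

Definition kadd (F G : kernel_space) := KernelVector (approximableD (kvecP F) (kvecP G)).
Definition kmul c (F : kernel_space) := KernelVector (approximableZ c (kvecP F)).
Definition kzero := KernelVector approximable0.
Definition kopp (F : kernel_space) := kmul (-1) F.

Lemma kaddA : associative kadd.
Proof. by move=> F G L; apply: kernel_space_eq => x /=; rewrite addrA. Qed.
Lemma kaddC : commutative kadd.
Proof. by move=> F G; apply: kernel_space_eq => x /=; rewrite addrC. Qed.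
Lemma kadd0 : left_id kzero kadd.
Proof. by move=> F; apply: kernel_space_eq => x /=; rewrite add0r. Qed.
Lemma kaddN : left_inverse kzero kopp kadd.
Proof. by move=> F; apply: kernel_space_eq => x /=; rewrite mulN1r addNr. Qed.

HB.instance Definition _ := GRing.isZmodule.Build kernel_space kaddA kaddC kadd0 kaddN.

Lemma kmulA c d (F : kernel_space) : kmul c (kmul d F) = kmul (c * d) F.
Proof. by apply: kernel_space_eq => x /=; rewrite mulrA. Qed.
Lemma kmul1 : left_id 1 kmul.
Proof. by move=> F; apply: kernel_space_eq => x /=; rewrite mul1r. Qed.
Lemma kmulDr : right_distributive kmul +%R.
Proof. by move=> c F G; apply: kernel_space_eq => x /=; rewrite mulrDr. Qed.
Lemma kmulDl (F : kernel_space) : {morph kmul^~ F : c d / c + d}.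
Proof. by move=> c d; apply: kernel_space_eq => x /=; rewrite mulrDl. Qed.

HB.instance Definition _ := GRing.Zmodule_isLmodule.Build C kernel_space
  kmulA kmul1 kmulDr kmulDl.

Implicit Types (f g : kernel_space).

Definition kapprox f n : seq (C * X) :=
  projT1 (cid (kvecP f (harmonic_gt0 n))).

Lemma kapproxP f n v :
  normc (keval f v - kform (kapprox f n) v) <= harmonic n * knorm v.
Proof. by rewrite /kapprox; case: cid => u /= ->. Qed.

Lemma knorm_approx_le f (c : R) n : 0 <= c ->
  (forall v, normc (keval f v) <= c * knorm v) ->
  knorm (kapprox f n) <= c + harmonic n.
Proof.
move=> c0 fc; set u := kapprox f n.
have [->|u0] := eqVneq (knorm u) 0; first by rewrite addr_ge0 ?harmonic_ge0.
have u_gt0 : 0 < knorm u by rewrite lt_def u0 knorm_ge0.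
rewrite -(ler_pM2r u_gt0) -expr2 knorm_sqr mulrDl.
apply: le_trans (Re_le_normc _) _.
rewrite -[kform u u](subKr (keval f u)).
apply: le_trans (le_normcD _ _) _; apply: lerD (fc u) _.
by rewrite normcN kapproxP.
Qed.

Lemma approx_bounded f : exists B, forall n, knorm (kapprox f n) <= B.
Proof.
have [B B0 fB] := approximable_bound (kvecP f).
exists (B + 1) => n; apply: le_trans (knorm_approx_le n B0 fB) _.
by rewrite lerD2l invf_le1 ?ler1n.
Qed.

Lemma ubounded_keval f (u : nat -> seq (C * X)) B : (forall n, knorm (u n) <= B) ->
  ubounded (fun n => keval f (u n)).
Proof.
move=> uB; have [D D0 fD] := approximable_bound (kvecP f).
by exists (D * B) => n; apply: le_trans (fD _) _; apply: ler_wpM2l.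
Qed.

(** With an ultralimit the pairings with the approximants need not be shown to converge; [kip_span]
    and [kip_approx] give the independence of the chosen approximants. *)
Definition kip f g : C := culim (fun n => keval f (kapprox g n)).

Lemma kip_ubounded f g : ubounded (fun n => keval f (kapprox g n)).
Proof. by have [B gB] := approx_bounded g; apply: ubounded_keval gB. Qed.

Lemma kipDl f g h : kip (f + g) h = kip f h + kip g h.
Proof.
rewrite /kip -culimD; try exact: kip_ubounded.
by congr culim; apply/funext => n; rewrite -kevalD.
Qed.

Lemma kipZl c f g : kip (c *: f) g = c * kip f g.
Proof.
rewrite /kip -culimZ; try exact: kip_ubounded.
by congr culim; apply/funext => n; rewrite -kevalZ.
Qed.

Lemma kevalB f g v : keval (f - g) v = keval f v - keval g v.
Proof. by rewrite kevalD kevalZ mulN1r. Qed.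

Lemma kform_approx_ubounded f g :
  ubounded (fun n => kform (kapprox f n) (kapprox g n)).
Proof.
have [B fB] := approx_bounded f; have [D gD] := approx_bounded g.
exists (B * D) => n; apply: le_trans (normc_kform_le _ _) _.
by rewrite ler_pM ?knorm_ge0.
Qed.

Lemma cvg_harmonicM (c : R) : (fun n => harmonic n * c) @ \oo --> (0 : R).
Proof. by rewrite -[X in _ --> X](mul0r c); apply: cvgMl; apply: cvg_harmonic. Qed.

Lemma cvg0_le (u v : nat -> R) : (forall n, 0 <= u n <= v n) ->
  v @ \oo --> (0 : R) -> u @ \oo --> (0 : R).
Proof.
move=> uv v0; apply: (@squeeze_cvgr _ _ _ _ (fun=> 0)) v0; last exact: cvg_cst.
exact: nearW.
Qed.

Lemma kipE f g : kip f g = culim (fun n => kform (kapprox f n) (kapprox g n)).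
Proof.
have [B gB] := approx_bounded g; apply: culim_eq.
- exact: kip_ubounded.
- exact: kform_approx_ubounded.
apply: cvg0_le (cvg_harmonicM B) => n; rewrite normc_ge0 /=.
by apply: le_trans (kapproxP _ _ _) _; rewrite ler_wpM2l ?harmonic_ge0.
Qed.

Lemma kipC f g : kip f g = (kip g f)^*.
Proof.
rewrite !kipE -culimJ; last exact: kform_approx_ubounded.
by congr culim; apply/funext => n; rewrite kformC.
Qed.

Lemma kipDr f g h : kip f (g + h) = kip f g + kip f h.
Proof. by rewrite kipC kipDl rmorphD /= -!kipC. Qed.

Lemma kipZr c f g : kip f (c *: g) = c^* * kip f g.
Proof. by rewrite kipC kipZl rmorphM /= -kipC. Qed.

Lemma kip_ge0 f : 0 <= kip f f.
Proof.
by rewrite kipE; apply: culim_ge0 => [|n]; [exact: kform_approx_ubounded | exact: K_psd].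
Qed.

Lemma kip_CauchySchwarz f g :
  normc (kip f g) ^+ 2 <= Re (kip g g) * Re (kip f f).
Proof.
apply: discriminant_le => [|l]; first exact/Re_ge0/kip_ge0.
have := Re_ge0 (kip_ge0 (g + l *: f)); congr (0 <= _).
rewrite kipDl !kipDr !kipZl !kipZr !ReD.
rewrite mulrA -toC_normc_sqr Re_toCM [kip g f]kipC -rmorphM ReJ.
by rewrite mulr2n mulrDl mul1r !addrA.
Qed.

Definition kspanv u : kernel_space := KernelVector (approximable_span u).

Lemma kip_span f u : kip f (kspanv u) = keval f u.
Proof.
have [B B0 fB] := approximable_bound (kvecP f).
apply: culim_cvg; apply: cvg0_le (cvg_harmonicM B) => n; rewrite normc_ge0 /=.
set w := kapprox (kspanv u) n.
have -> : keval f w - keval f u = keval f (w ++ kscale (-1) u).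
  by rewrite keval_cat keval_scale rmorphN1 mulN1r.
apply: le_trans (fB _) _; rewrite mulrC ler_wpM2r //.
set z := w ++ _; have [->|z0] := eqVneq (knorm z) 0; first exact: harmonic_ge0.
have z_gt0 : 0 < knorm z by rewrite lt_def z0 knorm_ge0.
rewrite -(ler_pM2r z_gt0) -expr2 knorm_sqr; apply: le_trans (Re_le_normc _) _.
rewrite {1}/z kform_catl kform_scalel mulN1r -normcN opprB.
exact: (kapproxP (kspanv u) n z).
Qed.

Lemma kip_eq0 f : kip f f = 0 -> f = 0.
Proof.
move=> f0; apply: kernel_space_eq => x /=; have := kip_CauchySchwarz f (kspanv [:: (1, x)]).
rewrite f0 mulr0 kip_span keval1 => h; apply/eqP; rewrite -normc_eq0.
by rewrite -sqrf_eq0 eq_le h sqr_ge0.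
Qed.

Definition kn f : R := Num.sqrt (Re (kip f f)).

Lemma kn_ge0 f : 0 <= kn f. Proof. exact: sqrtr_ge0. Qed.

Lemma kn_sqr f : kn f ^+ 2 = Re (kip f f).
Proof. by rewrite sqr_sqrtr // Re_ge0 ?kip_ge0. Qed.

Lemma normc_kip_le f g : normc (kip f g) <= kn f * kn g.
Proof.
rewrite -ler_sqr ?nnegrE ?normc_ge0 ?mulr_ge0 ?kn_ge0 //.
by rewrite exprMn !kn_sqr mulrC kip_CauchySchwarz.
Qed.

Lemma kn_span u : kn (kspanv u) = knorm u.
Proof. by rewrite /kn kip_span. Qed.

Lemma keval_le f v : normc (keval f v) <= kn f * knorm v.
Proof. by rewrite -kip_span -kn_span normc_kip_le. Qed.

(** The Hilbert norm is the dual norm of [keval f]: the bound is tested on the approximants of [f]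
    itself, whose seminorm is at most [c + harmonic n]. *)
Lemma kn_le f (c : R) : 0 <= c -> (forall v, normc (keval f v) <= c * knorm v) ->
  kn f <= c.
Proof.
move=> c0 fc; rewrite -ler_sqr ?nnegrE ?kn_ge0 // kn_sqr.
apply/ler_addgt0Pr => e e0; apply: culim_Re_le; first exact: kip_ubounded.
near=> n; apply: le_trans (Re_le_normc _) _; apply: le_trans (fc _) _.
apply: le_trans (ler_wpM2l c0 (knorm_approx_le n c0 fc)) _.
rewrite mulrDr -expr2 lerD2l mulrC.
near: n; have /cvgrPdist_lt /(_ _ e0) := cvg_harmonicM c.
apply: filterS => n; rewrite sub0r normrN => /ltW; apply: le_trans; exact: ler_norm.
Unshelve. all: by end_near. Qed.

Lemma kn_triangle f g : kn (f + g) <= kn f + kn g.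
Proof.
apply: kn_le => [|v]; first by rewrite addr_ge0 ?kn_ge0.
rewrite kevalD mulrDl; apply: le_trans (le_normcD _ _) _.
by rewrite lerD ?keval_le.
Qed.

Lemma kn_scale c f : kn (c *: f) = normc c * kn f.
Proof.
rewrite /kn kipZl kipZr mulrA -toC_normc_sqr Re_toCM sqrtrM ?sqr_ge0 //.
by rewrite sqrtr_sqr ger0_norm ?normc_ge0.
Qed.

Definition knC f : C := toC (kn f).

Lemma knC_triangle f g : knC (f + g) <= knC f + knC g.
Proof. by rewrite /knC -rmorphD lecR kn_triangle. Qed.

Lemma knC_scale c f : knC (c *: f) = `|c| * knC f.
Proof. by rewrite /knC kn_scale rmorphM. Qed.

Lemma knC_eq0 f : knC f = 0 -> f = 0.
Proof.
move=> /complexI /eqP; rewrite sqrtr_eq0 => h; apply: kip_eq0.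
by rewrite -[LHS]toC_Re_ge0 ?kip_ge0 //; congr toC; apply/eqP; rewrite eq_le h Re_ge0 ?kip_ge0.
Qed.

HB.instance Definition _ := @Lmodule_isNormed.Build C kernel_space knC
  knC_triangle knC_scale knC_eq0.

Lemma normkE f : `|f| = toC (kn f).
Proof. by []. Qed.

Lemma kball f g (e : R) : ball f (toC e) g = (kn (f - g) < e) :> Prop.
Proof. by rewrite -ball_normE /= normkE ltcR. Qed.

(** The filter is replaced by the centres [f n] of balls of radius [harmonic n] belonging to it; its
    limit is their pointwise ultralimit [g]. *)
Lemma kernel_space_complete (F : set_system kernel_space) :
  ProperFilter F -> cauchy F -> cvg F.
Proof.
move=> FF /cauchyP Fc.
have hC n : 0 < toC (harmonic n) by rewrite ltcR harmonic_gt0.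
have [f fF] := choice (fun n => Fc _ (hC n)).
have fnm n m : kn (f n - f m) <= harmonic n + harmonic m.
  have [g []] := filter_ex (filterI (fF n) (fF m)); rewrite !kball => gn gm.
  rewrite -[f n - f m](subrKA g); apply: le_trans (kn_triangle _ _) _.
  apply: lerD; first exact: ltW.
  by rewrite -opprB -scaleN1r kn_scale normcN normc1 mul1r ltW.
have fb v : ubounded (fun n => keval (f n) v).
  exists ((kn (f 0) + 2) * knorm v) => n; apply: le_trans (keval_le _ _) _.
  rewrite ler_wpM2r ?knorm_ge0 // -[f n](subrK (f 0)) addrC.
  apply: le_trans (kn_triangle _ _) _; rewrite lerD2l.
  apply: le_trans (fnm _ _) _.
  by rewrite [2]mulr2n lerD // invf_le1 ?ler1n.
pose g x := culim (fun n => f n x).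
have fbx x : ubounded (fun n => f n x).
  by have := fb [:: (1, x)]; congr ubounded; apply/funext => n; rewrite keval1.
have gE v : keval g v = culim (fun n => keval (f n) v).
  have bs (r : C * X) : ubounded (fun n => r.1^* * f n r.2).
    by apply: uboundedM => //; apply: ubounded_cst.
  rewrite /keval (culim_sum v bs).2; apply: eq_bigr => r _.
  by rewrite culimZ.
have glim n v : normc (keval g v - keval (f n) v) <= 2 * harmonic n * knorm v.
  rewrite gE -[X in _ - X](culim_cst (R := R)) -[- _]mulN1r -culimZ; last exact: ubounded_cst.
  rewrite -culimD //; last by apply: ubounded_cst.
  apply: culim_normc_le; first by apply: uboundedD => //; apply: ubounded_cst.
  near=> m; rewrite mulN1r.
  rewrite -kevalB; apply: le_trans (keval_le _ _) _; rewrite ler_wpM2r ?knorm_ge0 //.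
  apply: le_trans (fnm _ _) _; rewrite mulr2n mulrDl mul1r lerD2r.
  near: m; have /cvgrPdist_lt /(_ _ (harmonic_gt0 n)) := @cvg_harmonic R.
  by apply: filterS => m; rewrite sub0r normrN => /ltW; apply: le_trans; exact: ler_norm.
have ga : approximable g.
  (* Two thirds pay for the distance from [g] to [f n], one third for the approximant of [f n]. *)
  move=> e e0; have [n hn] : exists n, 3 * harmonic n < e.
    have e3 : 0 < e / 3 by rewrite divr_gt0.
    have /cvgrPdist_lt /(_ _ e3) /filter_ex[n] := @cvg_harmonic R.
    rewrite sub0r normrN ger0_norm ?harmonic_ge0 // => hn; exists n.
    by rewrite mulrC -ltr_pdivlMr.
  exists (kapprox (f n) n) => v.
  rewrite -[keval g v](subrK (keval (f n) v)) -addrA.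
  apply: le_trans (le_normcD _ _) _; apply: le_trans (lerD (glim n v) (kapproxP _ _ _)) _.
  rewrite -mulrDl ler_wpM2r ?knorm_ge0 //; apply: le_trans (ltW hn).
  by rewrite -{2}[harmonic n]mul1r -mulrDl; apply: ler_wpM2r; rewrite ?harmonic_ge0 //; lra.
apply/cvg_ex; exists (KernelVector ga) => A /nbhs_ballP[e /= e0 eA].
have eE : toC (Re e) = e by rewrite toC_Re_ge0 // ltW.
have re0 : 0 < Re e by rewrite -ltcR eE.
have [n hn] : exists n, 3 * harmonic n < Re e.
  have e3 : 0 < Re e / 3 by rewrite divr_gt0.
  have /cvgrPdist_lt /(_ _ e3) /filter_ex[n] := @cvg_harmonic R.
  rewrite sub0r normrN ger0_norm ?harmonic_ge0 // => hn; exists n.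
  by rewrite mulrC -ltr_pdivlMr.
apply: filterS (fF n) => h; rewrite kball => fh; apply: eA; rewrite -eE kball.
apply: le_lt_trans hn; rewrite -[_ - h](subrKA (f n)).
apply: le_trans (kn_triangle _ _) _.
have -> : 3 * harmonic n = 2 * harmonic n + harmonic n :> R by ring.
apply: lerD (ltW fh); apply: kn_le => [|v]; first by rewrite mulr_ge0 ?harmonic_ge0.
by rewrite kevalB.
Unshelve. all: by end_near. Qed.

HB.instance Definition _ := Uniform_isComplete.Build kernel_space kernel_space_complete.

Lemma kip_bilinear : bilinear_for *%R (conjC \; *%R) kip.
Proof.
split=> [g c f h|f c g h] /=; first by rewrite kipDl kipZl.
by rewrite kipDr kipZr.
Qed.

HB.instance Definition _ := bilinear_isBilinear.Build C kernel_space kernel_space C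
  *%R (conjC \; *%R) kip kip_bilinear.

Lemma kip_hermitian f g : kip f g = (-1) ^+ false * conjC (kip g f).
Proof. by rewrite expr0 mul1r kipC. Qed.

HB.instance Definition _ := isHermitianSesquilinear.Build C kernel_space false conjC kip
  kip_hermitian.

Lemma kip_gt0 f : f != 0 -> 0 < kip f f.
Proof.
move=> f0; rewrite lt_def kip_ge0 andbT; apply: contraNneq f0 => h.
by apply/eqP; apply: kip_eq0.
Qed.

HB.instance Definition _ := isDotProduct.Build C kernel_space kip kip_gt0.

Lemma kip_norm (f : kernel_space) : kip f f = `|f| ^+ 2.
Proof.
by rewrite normkE -rmorphXn /= kn_sqr toC_Re_ge0 // kip_ge0.
Qed.

Definition kernel_hilbert : hilbertType R :=
  @HilbertType R kernel_space kip kip_norm.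

End KernelHilbertSpace.

(** * Inner products and unitary representations *)

Section HilbertFacts.
Context {R : realType} {H : hilbertType R}.
Local Notation C := R[i].
Local Notation toC := (real_complex R).
Local Notation Re := (@complex.Re R).
Local Notation ip := (inner H).
Implicit Types u v w : H.

Lemma ipDl u v w : ip (u + v) w = ip u w + ip v w. Proof. exact: linearDl. Qed.
Lemma ipDr u v w : ip w (u + v) = ip w u + ip w v. Proof. exact: linearDr. Qed.
Lemma ipZl (c : C) u w : ip (c *: u) w = c * ip u w. Proof. exact: linearZl_LR. Qed.
Lemma ipZr (c : C) u w : ip w (c *: u) = c^* * ip w u. Proof. exact: linearZr_LR. Qed.
Lemma ipC u v : ip u v = (ip v u)^*.
Proof. by rewrite hermC expr0 mul1r. Qed.
Lemma ipBl u v w : ip (u - v) w = ip u w - ip v w. Proof. exact: linearBl. Qed.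
Lemma ipBr u v w : ip w (u - v) = ip w u - ip w v. Proof. exact: linearBr. Qed.
Lemma ip_suml (I : Type) (s : seq I) (F : I -> H) w :
  ip (\sum_(i <- s) F i) w = \sum_(i <- s) ip (F i) w.
Proof. exact: linear_sumlz. Qed.
Lemma ip_sumr (I : Type) (s : seq I) (F : I -> H) w :
  ip w (\sum_(i <- s) F i) = \sum_(i <- s) ip w (F i).
Proof. exact: linear_sumr. Qed.

Lemma ip_ge0 u : 0 <= ip u u.
Proof. exact: dnorm_ge0. Qed.

Definition ip2 u : R := Re (ip u u).

Lemma ip2E u : ip u u = toC (ip2 u).
Proof. by rewrite toC_Re_ge0 // ip_ge0. Qed.

Lemma ip2_ge0 u : 0 <= ip2 u. Proof. exact/Re_ge0/ip_ge0. Qed.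

Lemma ip2_eq0 u : (ip2 u == 0) = (u == 0).
Proof.
rewrite -(dnorm_eq0 (inner H)) ip2E; apply/eqP/eqP => [-> //|].
by move=> /complexI.
Qed.

Lemma ip2_gt0 u : (0 < ip2 u) = (u != 0).
Proof. by rewrite lt_def ip2_eq0 ip2_ge0 andbT. Qed.

Lemma ip2D u v : ip2 (u + v) = ip2 u + ip2 v + 2 * Re (ip u v).
Proof.
rewrite /ip2 ipDl !ipDr !ReD [ip v u]ipC ReJ; ring.
Qed.

Lemma ip2Z (c : C) u : ip2 (c *: u) = normc c ^+ 2 * ip2 u.
Proof. by rewrite /ip2 ipZl ipZr mulrA -toC_normc_sqr Re_toCM. Qed.

Lemma ip2N u : ip2 (- u) = ip2 u.
Proof. by rewrite -scaleN1r ip2Z normcN normc1 expr1n mul1r. Qed.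

Lemma ip2B u v : ip2 (u - v) = ip2 u + ip2 v - 2 * Re (ip u v).
Proof. by rewrite ip2D ip2N -scaleN1r ipZr rmorphN1 mulN1r ReN mulrN. Qed.

Lemma ip_CauchySchwarz u v : normc (ip u v) ^+ 2 <= ip2 v * ip2 u.
Proof.
apply: discriminant_le => [|l]; first exact: ip2_ge0.
have := ip2_ge0 (v + l *: u); congr (0 <= _).
by rewrite ip2D ip2Z ipZr [ip v u]ipC -rmorphM ReJ; ring.
Qed.

Lemma ip2_norm u : `|u| = toC (Num.sqrt (ip2 u)).
Proof.
have h : toC (ip2 u) = `|u| ^+ 2 by rewrite -ip2E inner_norm.
apply/eqP; rewrite -(@eqrXn2 _ 2%N) //; last by rewrite ler0c sqrtr_ge0.
by rewrite -h -rmorphXn /= sqr_sqrtr // ip2_ge0.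
Qed.

Context {G : groupType} (rho : G -> H -> H) (rep : unitary_rep rho).

Lemma repM g h v : rho (g * h)%g v = rho g (rho h v). Proof. exact: rep.2. Qed.
Lemma rep_ip g u v : ip (rho g u) (rho g v) = ip u v.
Proof. by have [_ ->] := rep.1 g. Qed.
Lemma rep_linear g : linear (rho g). Proof. by have [] := rep.1 g. Qed.
Lemma repD g u v : rho g (u + v) = rho g u + rho g v.
Proof. by have := rep_linear g 1 u v; rewrite !scale1r. Qed.
Lemma rep0 g : rho g 0 = 0.
Proof. by have := rep_linear g (-1) 0 0; rewrite scaler0 addr0 scaleN1r addNr. Qed.
Lemma repZ g c u : rho g (c *: u) = c *: rho g u.
Proof. by have := rep_linear g c u 0; rewrite rep0 !addr0. Qed.
Lemma repB g u v : rho g (u - v) = rho g u - rho g v.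
Proof. by rewrite repD -scaleN1r repZ scaleN1r. Qed.

Lemma rep1 v : rho 1%g v = v.
Proof.
have [_ _ /bij_inj inj1] := rep.1 1%g.
by apply: inj1; rewrite -repM mulg1.
Qed.

Lemma rep_adj g u v : ip (rho g u) v = ip u (rho g^-1%g v).
Proof. by rewrite -(rep_ip g u) -repM mulgV rep1. Qed.

Lemma rep_ip2 g u : ip2 (rho g u) = ip2 u. Proof. by rewrite /ip2 rep_ip. Qed.

Lemma kform_rep (xi : H) s :
  kform (fun x y => ip (rho (y^-1 * x)%g xi) xi) s s =
  toC (ip2 (\sum_(p <- s) p.1 *: rho p.2 xi)).
Proof.
rewrite -ip2E kform_sum ip_suml; apply: eq_bigr => p _.
rewrite ip_sumr; apply: eq_bigr => r _.
by rewrite ipZl ipZr mulrA repM [in LHS]rep_adj invgK.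
Qed.

End HilbertFacts.

Definition posdef {R : realType} {G : groupType} (f : G -> R[i]) :=
  psd_kernel (fun x y => f (y^-1 * x)%g).

(** * The cyclic representation of a positive definite function *)

Section GelfandNaimarkSegal.
Context {R : realType} {G : groupType} (f : G -> R[i]) (f_pd : posdef f).
Local Notation C := R[i].
Local Notation K := (fun x y : G => f (y^-1 * x)%g).
Local Notation H := (kernel_space K).

Definition gshift (g : G) (u : seq (C * G)) := [seq (p.1, (g * p.2)%g) | p <- u].

Lemma keval_shift (F : G -> C) g v :
  keval (fun x => F (g^-1 * x)%g) (gshift g v) = keval F v.
Proof. by rewrite /keval big_map; apply: eq_bigr => p _; rewrite /= mulKg. Qed.

Lemma kspan_shift g u x : kspan K (gshift g u) x = kspan K u (g^-1 * x)%g.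
Proof.
by rewrite /kspan big_map; apply: eq_bigr => p _; rewrite /= invgM invgK mulgA.
Qed.

Lemma kform_shift g u v : kform K (gshift g u) (gshift g v) = kform K u v.
Proof.
rewrite /kform -(keval_shift (kspan K u) g); congr keval.
by apply/funext => x; rewrite kspan_shift.
Qed.

Lemma knorm_shift g u : knorm K (gshift g u) = knorm K u.
Proof. by rewrite /knorm /ksqr kform_shift. Qed.

Lemma gshiftK g v : gshift g (gshift g^-1%g v) = v.
Proof. by rewrite /gshift -map_comp map_id_in // => -[c x] _ /=; rewrite mulVKg. Qed.

Lemma approximable_shift F g : approximable K F ->
  approximable K (fun x => F (g^-1 * x)%g).
Proof.
move=> aF e e0; have [u Fu] := aF e e0; exists (gshift g u) => v.
rewrite -(gshiftK g v) keval_shift kform_shift; by rewrite knorm_shift; exact: Fu.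
Qed.

Definition gns_rep g (F : H) : H :=
  KernelVector (approximable_shift g (@kvecP _ _ _ F)).

(** Any approximants of [F'] with the same rate compute the inner product. Translated approximants
    are of this kind, whence the unitarity of translations. *)
Lemma kip_approx (F F' : H) (u : nat -> seq (C * G)) :
  (forall n v, normc (keval F' v - kform K (u n) v) <= harmonic n * knorm K v) ->
  kip F F' = culim (fun n => keval F (u n)).
Proof.
move=> Fu; have [B B0 FB] := approximable_bound f_pd (@kvecP _ _ _ F).
have close n : knorm K (kapprox F' n ++ kscale (-1) (u n)) <= 2 * harmonic n.
  set z := _ ++ _; have [->|z0] := eqVneq (knorm K z) 0.
    by rewrite mulr_ge0 ?harmonic_ge0.
  have z_gt0 : 0 < knorm K z by rewrite lt_def z0 knorm_ge0.
  rewrite -(ler_pM2r z_gt0) -expr2 (knorm_sqr f_pd); apply: le_trans (Re_le_normc _) _.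
  rewrite {1}/z kform_catl kform_scalel mulN1r.
  rewrite -[X in normc X](subrKA (keval F' z)) [2]mulr2n !mulrDl !mul1r.
  apply: le_trans (le_normcD _ _) _; apply: lerD; last exact: Fu.
  by rewrite normcB; exact: kapproxP.
apply: culim_eq.
- exact: kip_ubounded.
- have [E FE] := approx_bounded f_pd F'.
  exists (B * (E + 2)) => n.
  have -> : keval F (u n) = keval F (kapprox F' n) - keval F (kapprox F' n ++ kscale (-1) (u n)).
    by rewrite keval_cat keval_scale rmorphN1 mulN1r subKr.
  apply: le_trans (le_normcD _ _) _; rewrite normcN mulrDr; apply: lerD.
    by apply: le_trans (FB _) _; apply: ler_wpM2l.
  apply: le_trans (FB _) _; apply: ler_wpM2l => //; apply: le_trans (close n) _.
  by rewrite ler_piMr // invf_le1 ?ler1n.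
apply: cvg0_le (cvg_harmonicM (2 * B)) => n; rewrite normc_ge0 /=.
have -> : keval F (kapprox F' n) - keval F (u n) = keval F (kapprox F' n ++ kscale (-1) (u n)).
  by rewrite keval_cat keval_scale rmorphN1 mulN1r.
apply: le_trans (FB _) _; rewrite mulrCA mulrA mulrC.
by apply: ler_wpM2r => //; exact: close.
Qed.

Lemma gns_rep_unitary : unitary_rep (gns_rep : G -> kernel_hilbert f_pd -> kernel_hilbert f_pd).
Proof.
split=> [g|g h v]; last first.
  by apply: kernel_space_eq => x /=; rewrite invgM mulgA.
split.
- by move=> c u v; apply: kernel_space_eq.
- move=> u v /=; rewrite (@kip_approx _ _ (fun n => gshift g (kapprox v n))).
    by congr culim; apply/funext => n; rewrite keval_shift.
  move=> n w; rewrite -(gshiftK g w) keval_shift kform_shift.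
  by rewrite knorm_shift; exact: kapproxP.
- exists (gns_rep g^-1%g) => v; apply: kernel_space_eq => x /=; rewrite ?invgK.
    by rewrite mulKg.
  by rewrite mulVKg.
Qed.

Definition gns_vec : H := kspanv K [:: (1, 1%g)].

Lemma gns_repE g : gns_rep g gns_vec = kspanv K [:: (1, g)].
Proof.
by apply: kernel_space_eq => x; rewrite /= /kspan !big_seq1 /= invgM invgK mulg1.
Qed.

Lemma kip_gns (F : H) g : kip F (gns_rep g gns_vec) = F g.
Proof. by rewrite gns_repE (kip_span f_pd); exact: keval1. Qed.

End GelfandNaimarkSegal.

(** Cyclicity is stated as triviality of the orthogonal complement of the orbit. In the function
    model it is immediate, since the pairing of [w] with the translate by [g] is the value of [w] at
    [g]. *)
Theorem gns {R : realType} {G : groupType} (f : G -> R[i]) : posdef f ->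
  exists (H : hilbertType R) (rho : G -> H -> H) (xi : H),
  [/\ unitary_rep rho, forall g, inner H (rho g xi) xi = f g &
      forall w, (forall g, inner H w (rho g xi) = 0) -> w = 0].
Proof.
move=> f_pd; exists (kernel_hilbert f_pd), (@gns_rep _ _ f), (gns_vec f).
split=> [|g|w w0].
- exact: gns_rep_unitary.
- rewrite /= (kip_span f_pd) /keval big_seq1 /= conjC1 mul1r.
  by rewrite /kspan big_seq1 /= mul1r !mulg1 invgK.
- by apply: kernel_space_eq => g; have := w0 g; rewrite /= (kip_gns f_pd).
Qed.

(** * Property (T) in terms of positive definite functions *)

Section KazhdanPosdef.
Context {R : realType} {G : groupType}.
Local Notation C := R[i].
Local Notation toC := (real_complex R).
Local Notation Re := (@complex.Re R).

Lemma kform_shiftc (f : G -> C) (c : C) s :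
  kform (fun x y => f (y^-1 * x)%g - c) s s =
  kform (fun x y => f (y^-1 * x)%g) s s - c * toC (normc (\sum_(p <- s) p.1) ^+ 2).
Proof.
rewrite !kform_sum toC_normc_sqr rmorph_sum /= big_distrl big_distrr -sumrB /=.
apply: eq_bigr => p _; rewrite big_distrr big_distrr -sumrB /=.
by apply: eq_bigr => r _; rewrite mulrBr; congr (_ - _); rewrite mulrC.
Qed.

(* In the representation generated by [f - c], with [c] the largest constant
   that can be removed from [f], an invariant vector would allow to remove
   more; so property (T) bounds its displacement from below on [Q]. *)
Lemma property_T_posdef : property_T R G ->
  exists (Q : seq G) (eps : R), 0 < eps /\
  forall (f : G -> C) (k : R), posdef f -> f 1%g = 1 -> 0 <= k ->
    {in Q, forall g, 1 - Re (f g) <= k} ->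
    exists2 c : R, 1 - 2 * k / eps ^+ 2 <= c <= 1 & posdef (fun g => f g - toC c).
Proof.
move=> [Q [eps [eps0 kazhdan]]]; exists Q, eps; split=> // f k f_pd f1 k0 fQ.
pose S : set R := [set c | posdef (fun g => f g - toC c)].
have S0 : S 0.
  by rewrite /S /=; congr posdef: f_pd; apply/funext => g; rewrite subr0.
have S1 c : S c -> c <= 1.
  move=> /(_ [:: (1, 1%g)]) /Re_ge0; rewrite kform_shiftc big_seq1 normc1 expr1n mulr1.
  rewrite kform_sum !big_seq1 /= conjC1 !mul1r mulVg f1 ReD ReN /=; lra.
have supS : has_sup S by split; [exists 0 | exists 1 => c /S1].
pose M := sup S; have M_le1 : M <= 1 by apply: ge_sup => //; exists 0.
(* For fixed coefficients the condition on the constant is a closed linear inequality, so the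
   supremum satisfies it. *)
have SM : S M.
  move=> s; rewrite kform_shiftc; set t := normc _ ^+ 2.
  have fs := f_pd s; rewrite -(toC_Re_ge0 fs) -rmorphM -rmorphB ler0c subr_ge0 /=.
  have [->|t0] := eqVneq t 0; first by rewrite mulr0 Re_ge0.
  have t_gt0 : 0 < t by rewrite lt_def t0 sqr_ge0.
  rewrite -ler_pdivlMr //; apply: ge_sup; first by exists 0.
  move=> c /(_ s); rewrite kform_shiftc -/t -(toC_Re_ge0 fs) -rmorphM -rmorphB ler0c.
  by rewrite subr_ge0 ler_pdivlMr.
exists M => //; rewrite M_le1 andbT leNgt; apply/negP => M_lt.
have [H [rho [xi [rep xiE cyc]]]] := gns SM.
have xi2 : ip2 xi = 1 - M by rewrite /ip2 -{1}(rep1 rep xi) xiE f1 ReD ReN.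
have e2 : 0 < eps ^+ 2 by rewrite exprn_gt0.
have M_lt1 : 2 * k < eps ^+ 2 * (1 - M).
  by rewrite [ltRHS]mulrC -ltr_pdivrMr //; lra.
have xi_gt0 : 0 < ip2 xi.
  rewrite xi2; have := le_lt_trans (mulr_ge0 (ler0n _ 2) k0) M_lt1.
  by rewrite pmulr_rgt0.
(* The squared displacement of [xi] is [2 * (1 - Re (f g)) <= 2 * k], below [eps ^+ 2] times its
   squared norm [1 - M]. *)
have [|w [w0 winv]] := kazhdan H rho rep.
  exists xi; split=> [|g gQ]; first by rewrite -ip2_gt0.
  rewrite !ip2_norm -rmorphM ltcR /=.
  rewrite -ltr_sqr ?nnegrE ?mulr_ge0 ?sqrtr_ge0 ?(ltW eps0) //.
  rewrite exprMn !sqr_sqrtr ?ip2_ge0 // ip2B rep_ip2 // xiE xi2 ReD ReN.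
  apply: le_lt_trans M_lt1; have := fQ g gQ; rewrite /=; lra.
pose c0 := inner H w xi.
have wxi g : inner H w (rho g xi) = c0 by rewrite -{1}(winv g) rep_ip.
have c0_neq0 : c0 != 0.
  by apply: contraNneq w0 => c00; apply/eqP/cyc => g; rewrite wxi.
have w2 : 0 < ip2 w by rewrite ip2_gt0.
(* The squared length of the projection of [xi] to the invariant line of [w]. All translates of [xi]
   share this projection, so [d] can be removed on top of [M]. *)
pose d := normc c0 ^+ 2 / ip2 w.
have d0 : 0 < d by rewrite divr_gt0 // exprn_gt0 // lt_def normc_ge0 normc_eq0 c0_neq0.
have : S (M + d).
  move=> s; rewrite kform_shiftc rmorphD mulrDl opprD addrA -kform_shiftc.
  have -> : kform (fun x y => f (y^-1 * x)%g - toC M) s s =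
      kform (fun x y => inner H (rho (y^-1 * x)%g xi) xi) s s.
    by rewrite !kform_sum; do 2!apply: eq_bigr => ? _; rewrite xiE.
  rewrite kform_rep // -rmorphM -rmorphB ler0c subr_ge0 /d mulrAC ler_pdivrMr //=.
  set v := \sum_(p <- s) (p.1 *: _); have := ip_CauchySchwarz v w.
  have -> : inner H v w = (\sum_(p <- s) p.1) * c0^*.
    rewrite /v ip_suml big_distrl; apply: eq_bigr => p _ /=.
    by rewrite ipZl ipC wxi.
  by rewrite normcM normc_J exprMn mulrC [ip2 w * _]mulrC.
move=> /(ub_le_sup supS.2); rewrite -/M; lra.
Qed.

End KazhdanPosdef.

(** * Almost invariant lines near an orbit that stays close to one line *)

Section InvariantLine.
Context {R : realType} {H : hilbertType R}.
Context {G : groupType} (rho : G -> H -> H) (rep : unitary_rep rho).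
Local Notation C := R[i].
Local Notation toC := (real_complex R).
Local Notation ip := (inner H).

Lemma conjC_toC (x : R) : (toC x)^* = toC x.
Proof. exact: conjc_real. Qed.

Lemma conjCM (z w : C) : (z * w)^* = z^* * w^*.
Proof. exact: rmorphM. Qed.

Lemma normc_parallelogram (a b : C) :
  normc (a + b) ^+ 2 + normc (a - b) ^+ 2 = 2 * normc a ^+ 2 + 2 * normc b ^+ 2.
Proof. rewrite !normc_sqr !ReD !ImD ReN ImN; ring. Qed.

Lemma ip_residual (u v x : H) : ip2 x = 1 ->
  ip (u - ip u x *: x) (v - ip v x *: x) = ip u v - ip u x * ip x v.
Proof.
move=> x1; rewrite !(ipBl, ipBr, ipZl, ipZr) ip2E x1 [ip v x]ipC conjCK; ring.
Qed.

Lemma ip2_residual (u x : H) : ip2 x = 1 ->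
  ip2 (u - ip u x *: x) = ip2 u - normc (ip u x) ^+ 2.
Proof.
move=> x1; rewrite {1}/ip2 ip_residual // [ip x u]ipC -toC_normc_sqr ReD ReN.
by [].
Qed.

Lemma ler_mul_sqrt (a b x : R) : 0 <= a -> 0 <= b -> 0 <= x ->
  x <= a ^+ 2 -> x <= b ^+ 2 -> x <= a * b.
Proof.
move=> a0 b0 x0 xa xb; rewrite -ler_sqr ?nnegrE ?mulr_ge0 // exprMn expr2.
exact: ler_pM.
Qed.

(* The midpoint of two almost optimal unit vectors would do better than the
   optimum unless the two vectors span almost the same line. *)
Lemma midpoint_estimate (xi v w : H) (M d r : R) :
  ip2 xi = 1 -> ip2 v = 1 -> ip2 w = 1 -> 0 <= d -> 19 / 20 <= M -> d <= 1 / 20 -> M <= 1 ->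
  (forall u, ip2 u = 1 -> forall c, (forall g, c <= normc (ip u (rho g xi)) ^+ 2) -> c <= M) ->
  (forall g, M - d <= normc (ip v (rho g xi)) ^+ 2) ->
  (forall g, M - d <= normc (ip w (rho g xi)) ^+ 2) ->
  ip v w = toC r -> 0 <= r -> 1 - 4 * d <= r.
Proof.
move=> xi1 v1 w1 d0 M0 d1 M1 opt Mv Mw vw r0.
set k := 1 - M + d; have k0 : 0 <= k by rewrite /k; lra.
have k1 : k <= 1 / 10 by rewrite /k; lra.
have r_le1 : r <= 1.
  have := ip_CauchySchwarz v w; rewrite v1 w1 vw normc_real ger0_norm // mul1r => h.
  by rewrite -ler_sqr ?nnegrE // expr1n.
(* A crude first bound through [xi]: the product of the two overlaps is at least [1 - k], and the
   residuals orthogonal to [xi] contribute at most [k]. *)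
have r_ge : 1 - 2 * k <= r.
  have hv : normc (ip v xi) ^+ 2 >= 1 - k by have := Mv 1%g; rewrite rep1 // /k; lra.
  have hw : normc (ip xi w) ^+ 2 >= 1 - k.
    by have := Mw 1%g; rewrite rep1 // ipC normc_J /k; lra.
  have hvw : normc (ip v xi) * normc (ip xi w) >= 1 - k.
    by apply: ler_mul_sqrt => //; rewrite ?normc_ge0 //; lra.
  have res : normc (ip v w - ip v xi * ip xi w) <= k.
    rewrite -ler_sqr ?nnegrE ?normc_ge0 // -ip_residual //.
    apply: le_trans (ip_CauchySchwarz _ _) _; rewrite !ip2_residual // v1 w1 expr2.
    have hw' : normc (ip w xi) ^+ 2 >= 1 - k by rewrite ipC normc_J.
    have bw : normc (ip w xi) ^+ 2 <= 1 by have := ip_CauchySchwarz w xi; rewrite xi1 w1 mulr1.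
    have bv : normc (ip v xi) ^+ 2 <= 1 by have := ip_CauchySchwarz v xi; rewrite xi1 v1 mulr1.
    by apply: ler_pM; lra.
  have := le_normcD (ip v w) (ip v xi * ip xi w - ip v w).
  rewrite addrC subrK normcM normcB vw normc_real ger0_norm // -vw; lra.
set s := 2 - 2 * r; have s0 : 0 <= s by rewrite /s; lra.
have sk : s <= 4 * k by rewrite /s; lra.
have s2 : ip2 (v - w) = s by rewrite ip2B v1 w1 vw /s /=; ring.
(* The orbit point is split along [v]: its component pairs with [v - w] to at most [s / 2], and its
   residual has squared norm at most [k]. *)
have diff g : normc (ip (v - w) (rho g xi)) ^+ 2 <= 4 * s * k.
  set eta := rho g xi; have eta1 : ip2 eta = 1 by rewrite rep_ip2.
  pose e := eta - ip eta v *: v.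
  have e2 : ip2 e <= k.
    rewrite ip2_residual // eta1 ipC normc_J; have := Mv g; rewrite -/eta /k; lra.
  have vwv : ip (v - w) v = toC (s / 2).
    rewrite ipBl [ip w v]ipC vw ip2E v1 /s conjC_toC -rmorphB /=; congr toC; lra.
  have -> : ip (v - w) eta = (ip eta v)^* * toC (s / 2) + ip (v - w) e.
    by rewrite /e ipBr ipZr vwv subrKC.
  have h1 : normc ((ip eta v)^* * toC (s / 2)) ^+ 2 <= s ^+ 2 / 4.
    rewrite normcM normc_J exprMn normc_real real_normK ?num_real //.
    have b1 : normc (ip eta v) ^+ 2 <= 1.
      by have := ip_CauchySchwarz eta v; rewrite v1 eta1 mulr1.
    have -> : (s / 2) ^+ 2 = s ^+ 2 / 4 by field.
    by rewrite ler_piMl // divr_ge0 ?sqr_ge0.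
  have h2 : normc (ip (v - w) e) ^+ 2 <= k * s.
    by apply: le_trans (ip_CauchySchwarz _ _) _; rewrite s2; apply: ler_wpM2r.
  have := normc_parallelogram ((ip eta v)^* * toC (s / 2)) (ip (v - w) e).
  have := sqr_ge0 (normc ((ip eta v)^* * toC (s / 2) - ip (v - w) e)).
  have : s ^+ 2 <= 4 * k * s by rewrite expr2; apply: ler_wpM2r.
  lra.
have u2 : ip2 (v + w) = 4 - s by rewrite ip2D v1 w1 vw /s /=; ring.
have u_gt0 : 0 < 4 - s by lra.
(* What the normalized midpoint achieves, by the parallelogram identity. The inequality [c <= M]
   rearranges to [s * (M - 4 * k) <= 4 * d], and [M >= 19 / 20], [k <= 1 / 10] keep the bracket
   above 1/2. *)
pose c := ((4 * (M - d) - 4 * s * k) / (4 - s)).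
have : c <= M.
  pose a := (Num.sqrt (4 - s))^-1; have a2 : a ^+ 2 = (4 - s)^-1.
    by rewrite exprVn sqr_sqrtr // ltW.
  apply: (opt (toC a *: (v + w))) => [|g].
    by rewrite ip2Z normc_real real_normK ?num_real // a2 u2 mulVf ?gt_eqF.
  rewrite ipZl normcM exprMn normc_real real_normK ?num_real // a2 /c mulrC.
  rewrite ler_wpM2l ?invr_ge0 ?(ltW u_gt0) // ipDl.
  have := normc_parallelogram (ip v (rho g xi)) (ip w (rho g xi)).
  rewrite -ipBl; have := diff g; have := Mv g; have := Mw g; lra.
rewrite /c ler_pdivrMr // => h.
have : s * (M - 4 * k) <= 4 * d by lra.
have : s * (1 / 2) <= s * (M - 4 * k) by apply: ler_wpM2l => //; rewrite /k; lra.
by rewrite /s; lra.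
Qed.

(** The quantity maximised over unit vectors [u] is the infimum over [g] of [|<u, rho g xi>|^2]. It
    does not change when [u] is translated or multiplied by a phase, so an almost maximal [v] and
    its translate [l *: rho g v] are both almost maximal and [midpoint_estimate] applies. *)
Lemma almost_invariant_line (xi : H) : ip2 xi = 1 ->
  (forall g, 19 / 20 <= normc (ip (rho g xi) xi) ^+ 2) ->
  forall e : R, 0 < e ->
  exists2 v : H, ip2 v = 1 & forall g, 1 - e <= normc (ip (rho g v) v).
Proof.
move=> xi1 xig e e0.
pose S : set R := [set c | exists2 u : H, ip2 u = 1 &
  forall g, c <= normc (ip u (rho g xi)) ^+ 2].
have Sxi : S (19 / 20) by exists xi => // g; rewrite ipC normc_J.
have S1 c : S c -> c <= 1.
  move=> [u u1 /(_ 1%g)] /le_trans; apply.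
  by apply: le_trans (ip_CauchySchwarz _ _) _; rewrite rep_ip2 // u1 xi1 mulr1.
have supS : has_sup S by split; [exists (19 / 20) | exists 1 => c /S1].
set M := sup S.
have M0 : 19 / 20 <= M by apply: ub_le_sup => //; exact: supS.2.
have M1 : M <= 1 by apply: ge_sup => //; exists (19 / 20).
pose d := Num.min (1 / 20) (e / 4).
have d0 : 0 < d by rewrite lt_min !divr_gt0.
have d1 : d <= 1 / 20 by rewrite ge_min lexx.
have de : d <= e / 4 by rewrite ge_min lexx orbT.
have [c [v v1 cv] cM] := sup_adherent d0 supS.
have Mv g : M - d <= normc (ip v (rho g xi)) ^+ 2 by apply: le_trans (ltW cM) (cv g).
exists v => // g; set r := normc (ip (rho g v) v).
have r0 : 0 <= r by exact: normc_ge0.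
(* The phase that makes the inner product of [v] with the translate real and nonnegative; any phase
   serves when it vanishes. *)
pose l : C := if r == 0 then 1 else toC r^-1 * ip v (rho g v).
have r_def : normc (ip v (rho g v)) = r by rewrite ipC normc_J.
have l1 : normc l = 1.
  rewrite /l; case: eqP => [_|/eqP r_neq0]; first exact: normc1.
  by rewrite normcM normc_real ger0_norm ?invr_ge0 // r_def mulVf.
have vl : ip v (l *: rho g v) = toC r.
  rewrite ipZr /l; case: eqP => [r_eq0|/eqP r_neq0].
    by move: r_def; rewrite r_eq0 => /eq0_normc ->; rewrite mulr0.
  rewrite conjCM conjC_toC -mulrA [_^* * _]mulrC -toC_normc_sqr r_def -rmorphM /=.
  by congr toC; rewrite expr2 mulKf.
have : 1 - 4 * d <= r; last by lra.
apply: (midpoint_estimate xi1 v1 _ (ltW d0) M0 d1 M1 _ Mv _ vl r0).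
- by rewrite ip2Z l1 expr1n mul1r rep_ip2.
- move=> u u1 b bu; apply: ub_le_sup; first exact: supS.2.
  by exists u.
- by move=> h; rewrite ipZl normcM l1 mul1r rep_adj // -repM // Mv.
Qed.

End InvariantLine.

(** * Matrices with the normalized Hilbert-Schmidt norm *)

Section HilbertSchmidt.
Context {R : realType}.
Local Notation C := R[i].
Local Notation toC := (real_complex R).
Local Notation Re := (@complex.Re R).

Lemma toCM (x y : R) : toC (x * y) = toC x * toC y. Proof. exact: rmorphM. Qed.
Lemma toCB (x y : R) : toC (x - y) = toC x - toC y. Proof. exact: rmorphB. Qed.

Lemma toC_inj (x y : R) : toC x = toC y -> x = y. Proof. exact: complexI. Qed.

Lemma tcM m n p (A : 'M[C]_(m, n)) (B : 'M[C]_(n, p)) :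
  (A *m B)^t* = B^t* *m A^t*.
Proof. by rewrite trmx_mul map_mxM. Qed.

Lemma tcD m n (A B : 'M[C]_(m, n)) : (A + B)^t* = A^t* + B^t*.
Proof. by rewrite raddfD /= map_mxD. Qed.

Lemma tcN m n (A : 'M[C]_(m, n)) : (- A)^t* = - A^t*.
Proof. by rewrite raddfN /= map_mxN. Qed.

Lemma tcB m n (A B : 'M[C]_(m, n)) : (A - B)^t* = A^t* - B^t*.
Proof. by rewrite tcD tcN. Qed.

Lemma tcZ m n (c : C) (A : 'M[C]_(m, n)) : (c *: A)^t* = c^* *: A^t*.
Proof. by rewrite linearZ /= map_mxZ. Qed.

Lemma tc1 n : (1%:M : 'M[C]_n)^t* = 1%:M.
Proof. by rewrite trmx1 map_mx1. Qed.

Lemma tc_sum m n (I : Type) (s : seq I) (F : I -> 'M[C]_(m, n)) :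
  (\sum_(i <- s) F i)^t* = \sum_(i <- s) (F i)^t*.
Proof. by rewrite raddf_sum /= raddf_sum. Qed.

Lemma unitary_adjK n (U : 'M[C]_n) : U \is unitarymx -> U^t* *m U = 1%:M.
Proof. by rewrite -trmxC_unitary => /unitarymxP; rewrite trmxCK. Qed.

Lemma unitaryK n (U : 'M[C]_n) : U \is unitarymx -> U *m U^t* = 1%:M.
Proof. by move=> /unitarymxP. Qed.

Definition fro m n (X : 'M[C]_(m, n)) : R := \sum_i \sum_j normc (X i j) ^+ 2.

Lemma fro_ge0 m n (X : 'M[C]_(m, n)) : 0 <= fro X.
Proof. by do 2!(apply: sumr_ge0 => ? _); rewrite sqr_ge0. Qed.

Lemma tr_adj_mul m n (X Y : 'M[C]_(m, n)) :
  \tr (X^t* *m Y) = \sum_i \sum_j (X i j)^* * Y i j.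
Proof.
rewrite /mxtrace exchange_big /=; apply: eq_bigr => j _; rewrite mxE.
by apply: eq_bigr => i _; rewrite !mxE.
Qed.

Lemma tr_fro m n (X : 'M[C]_(m, n)) : \tr (X^t* *m X) = toC (fro X).
Proof.
rewrite tr_adj_mul rmorph_sum; apply: eq_bigr => i _ /=.
rewrite rmorph_sum; apply: eq_bigr => j _ /=.
by rewrite mulrC -toC_normc_sqr.
Qed.

Lemma fro_adj m n (X : 'M[C]_(m, n)) : fro (X^t*) = fro X.
Proof.
rewrite /fro exchange_big; do 2!(apply: eq_bigr => ? _).
by rewrite !mxE normc_J.
Qed.

Lemma fro_unitaryl m n (U : 'M[C]_m) (X : 'M[C]_(m, n)) : U \is unitarymx ->
  fro (U *m X) = fro X.
Proof.
move=> Uu; apply: toC_inj; rewrite -!tr_fro tcM -mulmxA [U^t* *m _]mulmxA.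
by rewrite unitary_adjK // mul1mx.
Qed.

Lemma fro_unitaryr m n (U : 'M[C]_n) (X : 'M[C]_(m, n)) : U \is unitarymx ->
  fro (X *m U) = fro X.
Proof.
by move=> Uu; rewrite -fro_adj tcM fro_unitaryl ?trmxC_unitary // fro_adj.
Qed.

Lemma mxtrace_conj n (X : 'M[C]_n) : \tr (X^t*) = (\tr X)^*.
Proof. by rewrite /mxtrace rmorph_sum; apply: eq_bigr => i _; rewrite !mxE. Qed.

Variable d : nat.
Implicit Types X Y Z U V : 'M[C]_d.

Lemma ntraceE X : ntrace X = toC (d%:R^-1) * \tr X.
Proof. by rewrite /ntrace mulrC fmorphV rmorph_nat. Qed.

Lemma ntraceD X Y : ntrace (X + Y) = ntrace X + ntrace Y.
Proof. by rewrite !ntraceE raddfD mulrDr. Qed.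

Lemma ntraceZ (c : C) X : ntrace (c *: X) = c * ntrace X.
Proof. by rewrite !ntraceE linearZ mulrCA. Qed.

Lemma ntraceB X Y : ntrace (X - Y) = ntrace X - ntrace Y.
Proof. by rewrite ntraceD -scaleN1r ntraceZ mulN1r. Qed.

Lemma ntrace_sum (I : Type) (s : seq I) (F : I -> 'M[C]_d) :
  ntrace (\sum_(i <- s) F i) = \sum_(i <- s) ntrace (F i).
Proof. by rewrite ntraceE raddf_sum big_distrr; apply: eq_bigr => i _; rewrite ntraceE. Qed.

Lemma ntraceC X Y : ntrace (X *m Y) = ntrace (Y *m X).
Proof. by rewrite !ntraceE mxtrace_mulC. Qed.

Lemma ntraceJ X : ntrace (X^t*) = (ntrace X)^*.
Proof. by rewrite !ntraceE mxtrace_conj conjCM conjC_toC. Qed.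

Definition hs2 X : R := fro X / d%:R.

Lemma hs2_ge0 X : 0 <= hs2 X. Proof. by rewrite divr_ge0 ?fro_ge0. Qed.

Lemma ntrace_adj_mul X : ntrace (X^t* *m X) = toC (hs2 X).
Proof. by rewrite ntraceE tr_fro -rmorphM /= mulrC. Qed.

Lemma hs_normE X : hs_norm X = Num.sqrt (hs2 X).
Proof. by rewrite /hs_norm ntrace_adj_mul. Qed.

Lemma hs_ge0 X : 0 <= hs_norm X. Proof. exact: sqrtr_ge0. Qed.

Lemma hs_sqr X : hs_norm X ^+ 2 = hs2 X.
Proof. by rewrite hs_normE sqr_sqrtr // hs2_ge0. Qed.

Lemma ntrace_CauchySchwarz X Y :
  normc (ntrace (X^t* *m Y)) <= hs_norm X * hs_norm Y.
Proof.
rewrite -ler_sqr ?nnegrE ?normc_ge0 ?mulr_ge0 ?hs_ge0 // exprMn !hs_sqr.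
apply: discriminant_le => [|l]; first exact: hs2_ge0.
have := hs2_ge0 (X + (l *: Y)); congr (0 <= _).
apply: toC_inj; rewrite -ntrace_adj_mul tcD tcZ mulmxDl !mulmxDr.
rewrite -!scalemxAl -!scalemxAr !ntraceD !ntraceZ !ntrace_adj_mul.
have -> : ntrace (Y^t* *m X) = (ntrace (X^t* *m Y))^*.
  by rewrite -ntraceJ tcM trmxCK.
rewrite -conjCM mulrA [l^* * l]mulrC -toC_normc_sqr.
by case: (l * _) => a b; apply: complex_eq => /=; ring.
Qed.

Lemma hs_triangle X Y : hs_norm (X + Y) <= hs_norm X + hs_norm Y.
Proof.
rewrite -ler_sqr ?nnegrE ?addr_ge0 ?hs_ge0 // hs_sqr sqrrD !hs_sqr.
have -> : hs2 (X + Y) = hs2 X + 2 * Re (ntrace (X^t* *m Y)) + hs2 Y.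
  apply: toC_inj; rewrite -ntrace_adj_mul tcD mulmxDl !mulmxDr !ntraceD !ntrace_adj_mul.
  have -> : ntrace (Y^t* *m X) = (ntrace (X^t* *m Y))^*.
    by rewrite -ntraceJ tcM trmxCK.
  by case: (ntrace _) => a b; apply: complex_eq => /=; ring.
have := le_trans (Re_le_normc _) (ntrace_CauchySchwarz X Y); rewrite mulr2n; lra.
Qed.

Lemma hsZ (c : C) X : hs_norm (c *: X) = normc c * hs_norm X.
Proof.
rewrite !hs_normE; have -> : hs2 (c *: X) = normc c ^+ 2 * hs2 X.
  apply: toC_inj; rewrite [RHS]toCM toC_normc_sqr -!ntrace_adj_mul.
  by rewrite tcZ -scalemxAl -scalemxAr !ntraceZ mulrCA mulrA.
by rewrite sqrtrM ?sqr_ge0 // sqrtr_sqr ger0_norm ?normc_ge0.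
Qed.

Lemma hsN X : hs_norm (- X) = hs_norm X.
Proof. by rewrite -scaleN1r hsZ normcN normc1 mul1r. Qed.

Lemma hsB X Y : hs_norm (X - Y) = hs_norm (Y - X).
Proof. by rewrite -hsN opprB. Qed.

Lemma hs_trans Y X Z : hs_norm (X - Z) <= hs_norm (X - Y) + hs_norm (Y - Z).
Proof. by rewrite -[X - Z](subrKA Y) hs_triangle. Qed.

Lemma hs0 : hs_norm (0 : 'M[C]_d) = 0.
Proof. by rewrite -(scale0r (0 : 'M[C]_d)) hsZ normc0 mul0r. Qed.

Lemma hs_sum (I : Type) (s : seq I) (F : I -> 'M[C]_d) :
  hs_norm (\sum_(i <- s) F i) <= \sum_(i <- s) hs_norm (F i).
Proof.
elim: s => [|i s IH]; first by rewrite !big_nil hs0.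
by rewrite !big_cons; apply: le_trans (hs_triangle _ _) _; rewrite lerD2l.
Qed.

Lemma hs_unitaryl U X : U \is unitarymx -> hs_norm (U *m X) = hs_norm X.
Proof. by move=> Uu; rewrite !hs_normE /hs2 fro_unitaryl. Qed.

Lemma hs_unitaryr U X : U \is unitarymx -> hs_norm (X *m U) = hs_norm X.
Proof. by move=> Uu; rewrite !hs_normE /hs2 fro_unitaryr. Qed.

Lemma hs_adj X : hs_norm (X^t*) = hs_norm X.
Proof. by rewrite !hs_normE /hs2 fro_adj. Qed.

Lemma ntrace1 : (0 < d)%N -> ntrace (1%:M : 'M[C]_d) = 1.
Proof.
by move=> d0; rewrite /ntrace mxtrace1 divff // pnatr_eq0 -lt0n.
Qed.

Lemma hs1 : (0 < d)%N -> hs_norm (1%:M : 'M[C]_d) = 1.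
Proof.
move=> d0; rewrite hs_normE.
have -> : hs2 1%:M = 1.
  by apply: toC_inj; rewrite -ntrace_adj_mul tc1 mul1mx ntrace1.
exact: sqrtr1.
Qed.

Lemma hs_unitary U : (0 < d)%N -> U \is unitarymx -> hs_norm U = 1.
Proof. by move=> d0 Uu; rewrite -[U]mulmx1 hs_unitaryl ?hs1. Qed.

Lemma ntrace_le X : (0 < d)%N -> normc (ntrace X) <= hs_norm X.
Proof.
move=> d0; have := ntrace_CauchySchwarz 1%:M X.
by rewrite tc1 mul1mx hs1 // mul1r.
Qed.

Lemma hs_sub1_sqr U : (0 < d)%N -> U \is unitarymx ->
  hs_norm (U - 1%:M) ^+ 2 = 2 - 2 * Re (ntrace U).
Proof.
move=> d0 Uu; rewrite hs_sqr; apply: toC_inj.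
rewrite -ntrace_adj_mul tcB tc1 mulmxBl !mulmxBr unitary_adjK // !mul1mx mulmx1.
rewrite !ntraceB ntrace1 // ntraceJ; apply: complex_eq.
  rewrite !(ReD, ReN, ReJ) /=; ring.
rewrite !(ImD, ImN, ImJ) /=; ring.
Qed.

End HilbertSchmidt.

(** * Spectral form of positive matrices and the Schur product *)

Section PositiveMatrices.
Context {R : realType}.
Local Notation C := R[i].
Local Notation toC := (real_complex R).

Lemma psd_spectral n (A : 'M[C]_n) : A^t* = A ->
  (forall u : 'rV[C]_n, 0 <= (u *m A *m u^t*) 0 0) ->
  exists (P : 'M[C]_n) (d : 'I_n -> R), [/\ P \is unitarymx, forall k, 0 <= d k &
    A = P^t* *m diag_mx (\row_k toC (d k)) *m P].
Proof.
move=> Ah Apos; have Anormal : A \is normalmx by apply/normalmxP; rewrite Ah.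
have := orthomx_spectralP Anormal; have Pu := spectral_unitarymx A.
rewrite invmx_unitary //; set P := spectralmx A in Pu *; set D := spectral_diag A => AE.
have D0 k : 0 <= D 0 k.
  have := Apos (row k P); rewrite AE !mulmxA -row_mul unitaryK //.
  have -> : row k (1%:M : 'M[C]_n) *m diag_mx D *m P *m (row k P)^t* =
      row k 1%:M *m diag_mx D *m (P *m P^t*) *m (row k 1%:M)^t*.
    have -> : row k P = row k 1%:M *m P by rewrite -row_mul mul1mx.
    by rewrite tcM !mulmxA.
  by rewrite unitaryK // mulmx1 -row_mul mul1mx !mxE (bigD1 k) //= big1 =>
    [|i /negPf ik]; rewrite !mxE ?eqxx ?conjC1 ?mulr1 ?addr0 // [k == i]eq_sym ik conjC0 mulr0.
exists P, (fun k => complex.Re (D 0 k)); split=> // [k|]; first exact: Re_ge0.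
suff -> : \row_k toC (complex.Re (D 0 k)) = D by exact: AE.
by apply/rowP => k; rewrite mxE toC_Re_ge0.
Qed.

(** Schur product theorem: diagonalising the finite matrix of [K] writes the form of the product as
    a nonnegative combination of forms of [L] with rescaled coefficients. *)
Lemma psd_kernel_mul (X : Type) (K L : X -> X -> C) :
  psd_kernel K -> psd_kernel L -> psd_kernel (fun x y => K x y * L x y).
Proof.
move=> Kp Lp s; rewrite kform_sum.
case: s => [|p0 s']; first by rewrite big_nil.
set s := p0 :: s'; pose n := size s; pose x (i : 'I_n) := nth p0 s i.
have sum_s (F : C * X -> C) : \sum_(p <- s) F p = \sum_(i < n) F (x i).
  by rewrite (big_nth p0) big_mkord.
rewrite sum_s; under eq_bigr do rewrite sum_s.
pose A : 'M[C]_n := \matrix_(i, j) K (x i).2 (x j).2.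
have kf1 (M : X -> X -> C) (y z : X) : M y z = kform M [:: (1, y)] [:: (1, z)].
  by rewrite kform_sum !big_seq1 /= conjC1 !mul1r.
have Ah : A^t* = A.
  by apply/matrixP => i j; rewrite !mxE [K _ _]kf1 -(kformC Kp) -kf1.
have Apos (u : 'rV[C]_n) : 0 <= (u *m A *m u^t*) 0 0.
  have := Kp [seq (u 0 i, (x i).2) | i <- index_enum 'I_n].
  rewrite kform_sum big_map; congr (0 <= _); rewrite mxE exchange_big /=.
  rewrite big_map; apply: eq_bigr => j _; rewrite !mxE big_distrl /=.
  by apply: eq_bigr => i _; rewrite !mxE mulrAC.
have [P [d [Pu d0 AE]]] := psd_spectral Ah Apos.
have KE i j : K (x i).2 (x j).2 = \sum_k toC (d k) * ((P k i)^* * P k j).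
  transitivity (A i j); first by rewrite mxE.
  rewrite AE mxE; apply: eq_bigr => k _; rewrite mul_mx_diag !mxE.
  by rewrite mulrAC mulrC.
have -> : \sum_(i < n) \sum_(j < n) (x i).1 * (x j).1^* *
     (K (x i).2 (x j).2 * L (x i).2 (x j).2) =
   \sum_k toC (d k) * kform L [seq ((P k i)^* * (x i).1, (x i).2) | i <- index_enum 'I_n]
     [seq ((P k i)^* * (x i).1, (x i).2) | i <- index_enum 'I_n].
  under [RHS]eq_bigr => k _.
    rewrite kform_sum big_map big_distrr /=.
    under eq_bigr do rewrite big_map big_distrr /=.
    over.
  rewrite [RHS]exchange_big; apply: eq_bigr => i _ /=.
  rewrite [RHS]exchange_big; apply: eq_bigr => j _ /=.
  rewrite KE big_distrl big_distrr; apply: eq_bigr => k _ /=.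
  rewrite conjCM conjCK; ring.
by apply: sumr_ge0 => k _; rewrite mulr_ge0 ?ler0c.
Qed.

End PositiveMatrices.

Lemma countable_exhaustion (T : eqType) (x0 : T) : countable [set: T] ->
  exists F : nat -> seq T, forall x, \forall n \near \oo, x \in F n.
Proof.
move=> /countable_injP[f f_inj].
have finv n : exists y, forall x, f x = n -> y = x.
  have [[x fx]|nx] := pselect (exists x, f x = n).
    by exists x => y fy; apply: f_inj; rewrite ?inE // fx fy.
  by exists x0 => x fx; case: nx; exists x.
have [u uf] := choice finv.
exists (fun n => [seq u i | i <- iota 0 n]) => x; exists (f x).+1 => //= n /= fxn.
by apply/mapP; exists (f x); rewrite ?mem_iota // (uf _ x).
Qed.

Lemma limn_einf_ge (R : realType) (u : nat -> R) (l : R) :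
  (forall e : R, 0 < e -> \forall n \near \oo, l - e <= u n) ->
  (l%:E <= limn_einf (fun n => (u n)%:E))%E.
Proof.
move=> ul; apply/lee_subgt0Pr => e e0; rewrite limn_einf_lim.
apply: lime_ge; first exact: is_cvg_einfs.
have [N _ uN] := ul e e0; exists N => // n /= Nn.
apply: le_ereal_inf_tmp => _ [k /= nk <-]; rewrite -EFinB lee_fin.
by apply: uN => /=; apply: leq_trans Nn nk.
Qed.

Lemma cvg0_eventually (R : realType) (u : nat -> R) :
  (forall n, 0 <= u n) -> (forall e : R, 0 < e -> \forall n \near \oo, u n <= e) ->
  u @ \oo --> (0 : R).
Proof.
move=> u0 ue; apply/cvgrPdist_le => e e0; apply: filterS (ue e e0) => n.
by rewrite sub0r normrN ger0_norm.
Qed.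

Lemma near_harmonic_le (R : realType) (e : R) : 0 < e ->
  \forall n \near \oo, (harmonic n : R) <= e.
Proof.
move=> e0; have /cvgrPdist_le /(_ _ e0) := @cvg_harmonic R.
by apply: filterS => n; rewrite sub0r normrN ger0_norm ?harmonic_ge0.
Qed.

(** * Characters of G from twisted approximations *)

Section CompletelyPositive.
Context {R : realType} {Gamma : groupType}.
Local Notation C := R[i].
Local Notation toC := (real_complex R).

(** Complete positivity is expressed on vectors, the shape in which a dilation yields it. The last
    clause keeps of contractivity only what the trace estimates use. *)
Definition ucp_map d (T : Gamma -> 'M[C]_d) : Prop :=
  [/\ T 1%g = 1%:M,
      forall s : seq (Gamma * 'cV[C]_d), 0 <= \sum_(p <- s) \sum_(r <- s)
        ((r.2)^t* *m (T (r.1^-1 * p.1)%g *m p.2)) 0 0 &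
      forall g, hs_norm (T g) <= 1].

(** The double sum is the squared norm of the sum of the vectors [rho p.1 (iota p.2)], and each
    column of [T g] is the contracted image of a unit vector. *)
Lemma compression_ucp d (H : hilbertType R) (iota : 'cV[C]_d -> H) (P : H -> H)
    (rho : Gamma -> H -> H) (T : Gamma -> 'M[C]_d) :
  hilbert_embedding iota -> orthogonal_projection (range iota) P ->
  unitary_rep rho ->
  (forall g x, iota (T g *m x) = P (rho g (P (iota x)))) -> ucp_map T.
Proof.
move=> [iota_lin iota_ip] Pproj rep TE.
have iotaB x y : iota (x - y) = iota x - iota y.
  by have := iota_lin (-1) y x; rewrite !scaleN1r => h; rewrite addrC h addrC.
have ipE x y : ((y^t*) *m x) 0 0 = inner H (iota x) (iota y).
  rewrite iota_ip dotmxE !mxE; apply: eq_bigr => k _.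
  by rewrite !mxE mulrC.
have Porth v x : inner H (P v) (iota x) = inner H v (iota x).
  have [_ /(_ (iota x))] := Pproj v; rewrite ipBl => h; apply/esym/subr0_eq/h.
  by exists x.
have Pid x : P (iota x) = iota x.
  have [[y _ yE] orth] := Pproj (iota x).
  have := orth (iota x - P (iota x)); rewrite -yE -iotaB => h.
  apply/esym/eqP; rewrite -subr_eq0 -iotaB -ip2_eq0 /ip2 h //.
have T1E g x y : ((y^t*) *m (T g *m x)) 0 0 = inner H (rho g (iota x)) (iota y).
  by rewrite ipE TE Pid Porth.
have iota_inj : injective iota.
  move=> y z /eqP; rewrite -subr_eq0 -iotaB -(dnorm_eq0 (inner H)) iota_ip dnorm_eq0.
  by rewrite trmx_eq0 subr_eq0 => /eqP.
split.
- have T1 (x : 'cV[C]_d) : T 1%g *m x = x by apply: iota_inj; rewrite TE Pid rep1 // Pid.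
  apply/matrixP => i j; have := T1 (delta_mx j 0); rewrite -colE => /colP /(_ i).
  by rewrite !mxE eqxx andbT eq_sym.
- move=> s; have -> : \sum_(p <- s) \sum_(r <- s)
       ((r.2)^t* *m (T (r.1^-1 * p.1)%g *m p.2)) 0 0 =
     toC (ip2 (\sum_(p <- s) rho p.1 (iota p.2))).
    rewrite -ip2E ip_suml; apply: eq_bigr => p _; rewrite ip_sumr.
    by apply: eq_bigr => r _; rewrite T1E repM // [in LHS]rep_adj // invgK.
  by rewrite ler0c ip2_ge0.
- move=> g; have Pcontract v : ip2 (P v) <= ip2 v.
    have [PvK orth] := Pproj v.
    by rewrite -{2}[v](subrK (P v)) ip2D {3}/ip2 orth // mulr0 addr0 lerDr ip2_ge0.
  have fro_le : fro (T g) <= d%:R.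
    have -> : fro (T g) = \sum_(j < d) ip2 (iota (T g *m delta_mx j 0)).
      apply: toC_inj; rewrite -tr_fro rmorph_sum; apply: eq_bigr => j _ /=.
      rewrite -ip2E -ipE [LHS]mxE [RHS]mxE; apply: eq_bigr => k _.
      by rewrite -colE !mxE.
    rewrite -[d in leRHS]card_ord -sum1_card natr_sum; apply: ler_sum => j _.
    rewrite TE Pid; apply: le_trans (Pcontract _) _; rewrite rep_ip2 //.
    rewrite -lecR -ip2E -ipE mxE (bigD1 j) //= big1 => [|k /negPf kj].
      by rewrite !mxE !eqxx conjC1 mulr1 addr0.
    by rewrite !mxE kj mulr0.
  rewrite hs_normE /hs2; case: (d) (fro _) fro_le => [|d'] x x_le.
    by rewrite invr0 mulr0 sqrtr0.
  by rewrite -[leRHS]sqrtr1 ler_wsqrtr // ler_pdivrMr ?ltr0n // mul1r.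
Qed.

Definition almost_hom d (F : seq Gamma) (e : R) (theta : Gamma -> 'M[C]_d) : Prop :=
  [/\ (0 < d)%N, forall g, theta g \is unitarymx,
      {in F &, forall g h, hs_norm (theta g *m theta h - theta (g * h)%g) <= e} &
      {in F, forall g, g != 1%g -> Num.sqrt 2 - e <= hs_norm (theta g - 1%:M)}].

(** Passage from sequences to a tolerance uniform in the dimension: counterexamples for an
    exhaustion of [Gamma] and tolerances [harmonic n] would form a hyperlinear approximation
    violating stability. *)
Lemma weakly_ucp_stable_finite : countable [set: Gamma] ->
  weakly_ucp_stable R Gamma ->
  forall (Q : seq Gamma) (e : R), 0 < e ->
  exists (F : seq Gamma) (dl : R), 0 < dl /\
  forall d (theta : Gamma -> 'M[C]_d), almost_hom F dl theta ->
  exists T : Gamma -> 'M[C]_d, ucp_map T /\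
    {in Q, forall g, hs_norm (theta g - T g) <= e}.
Proof.
move=> Gcount stable Q e e0; apply: contrapT => no.
have [F FE] := countable_exhaustion (1%g : Gamma) Gcount.
have bad n : exists dt : {d : nat & Gamma -> 'M[C]_d},
    almost_hom (F n) (harmonic n) (projT2 dt) /\
    forall T, ucp_map T -> ~ {in Q, forall g, hs_norm (projT2 dt g - T g) <= e}.
  apply: contrapT => none; apply: no; exists (F n), (harmonic n).
  split=> [|d theta ah]; first exact: harmonic_gt0.
  apply: contrapT => noT; apply: none; exists (existT _ d theta); split=> // T uT QT.
  by apply: noT; exists T.
have [dt dtP] := choice bad.
pose d n := projT1 (dt n); pose theta n : Gamma -> 'M[C]_(d n) := projT2 (dt n).
have hyp : hyperlinear_approximation theta.
  split.
  - by move=> n; have [[]] := dtP n.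
  - by move=> n; have [[]] := dtP n.
  - move=> g h; apply: cvg0_eventually => [n|e' e'0]; first exact: hs_ge0.
    near=> n; have [[_ _ /(_ g h) mul _] _] := dtP n.
    apply: le_trans (mul _ _) _; near: n; [exact: FE|exact: FE|].
    exact: near_harmonic_le.
  - move=> g g1; apply: limn_einf_ge => e' e'0.
    near=> n; have [[_ _ _ /(_ g) far] _] := dtP n.
    apply: le_trans (far _ g1); last by near: n; exact: FE.
    by rewrite lerD2l lerN2; near: n; exact: near_harmonic_le.
have [H [iota [P [rho [T [emb proj rep TE lim]]]]]] := stable _ _ hyp.
have : \forall n \near \oo, {in Q, forall g, hs_norm (theta n g - T n g) <= e}.
  elim: (Q) => [|g Q' IH]; first by apply: nearW => n g.
  have /cvgrPdist_le /(_ _ e0) limg := lim g.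
  near=> n => h; rewrite inE => /orP[/eqP ->|].
    have : `|0 - hs_norm (theta n g - T n g)| <= e by near: n.
    by rewrite sub0r normrN ger0_norm ?hs_ge0.
  by move: h; near: n.
case/filter_ex => n Qn; have [_ /(_ (T n))] := dtP n; apply; last exact: Qn.
exact: compression_ucp (emb n) (proj n) (rep n) (TE n).
Unshelve. all: by end_near. Qed.

End CompletelyPositive.

(** Expanding the trace over the standard basis gives a sum of complete positivity forms at the
    vectors [(psi x)^t* *m delta_mx j 0]. *)
Lemma ucp_trace_psd (R : realType) (Gamma : groupType) (X : Type) (q : X -> Gamma)
    (d : nat) (T : Gamma -> 'M[R[i]]_d) (psi : X -> 'M[R[i]]_d) : ucp_map T ->
  psd_kernel (fun x y =>
    ntrace (T ((q y)^-1 * q x)%g *m ((psi y)^t* *m psi x)^t*)).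
Proof.
move=> [_ Tpos _] s; rewrite kform_sum.
pose v j (p : R[i] * X) : 'cV[R[i]]_d := p.1 *: ((psi p.2)^t* *m delta_mx j 0).
suff -> : \sum_(p <- s) \sum_(r <- s) p.1 * r.1^* *
    ntrace (T ((q r.2)^-1 * q p.2)%g *m ((psi r.2)^t* *m psi p.2)^t*) =
  real_complex R d%:R^-1 * \sum_(j < d)
    \sum_(p <- [seq (q p.2, v j p) | p <- s])
    \sum_(r <- [seq (q p.2, v j p) | p <- s])
      ((r.2)^t* *m (T (r.1^-1 * p.1)%g *m p.2)) 0 0.
  by rewrite mulr_ge0 ?ler0c ?invr_ge0 // sumr_ge0.
under [in RHS]eq_bigr do rewrite big_map.
rewrite [X in _ * X]exchange_big big_distrr /=; apply: eq_bigr => p _ /=.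
under [in RHS]eq_bigr do rewrite big_map.
rewrite [X in _ * X]exchange_big big_distrr /=; apply: eq_bigr => r _ /=.
rewrite tcM trmxCK mulmxA ntraceC mulmxA ntraceE mulrCA; congr (_ * _).
rewrite /mxtrace big_distrr; apply: eq_bigr => j _ /=.
rewrite /v tcZ tcM trmxCK -!scalemxAl -!scalemxAr scalerA [RHS]mxE [p.1 * _]mulrC; congr (_ * _).
have entry (B : 'M[R[i]]_d) :
    ((delta_mx j 0 : 'cV[R[i]]_d)^t* *m (B *m (delta_mx j 0 : 'cV[R[i]]_d))) 0 0 = B j j.
  rewrite -colE mxE (bigD1 j) //= big1 => [|k /negPf kj].
    by rewrite !mxE !eqxx conjC1 mul1r addr0.
  by rewrite !mxE kj conjC0 mul0r.
by rewrite -entry !mulmxA.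
Qed.

Lemma three_steps_le (R : realType) (dl e : R) : 0 < dl -> 6 * e <= dl ->
  e + (e + (e + dl / 2)) <= dl.
Proof. lra. Qed.

Lemma sqrt2_gap (R : realType) (dl e t w : R) : 0 < dl -> 6 * e <= dl -> t <= e ->
  0 <= w -> w ^+ 2 = 2 - 2 * t -> Num.sqrt 2 - dl <= w.
Proof.
move=> dl0 e_dl te w0 sqr.
set r := Num.sqrt (2 : R); have r2 : r ^+ 2 = 2 by rewrite sqr_sqrtr.
have r0 : 0 <= r := sqrtr_ge0 _.
have r1 : 1 <= r by rewrite -ler_sqr ?nnegrE // r2 expr1n; lra.
have [rd|dr] := leP r dl; first by lra.
rewrite -ler_sqr ?nnegrE ?subr_ge0 ?(ltW dr) // sqr sqrrB r2.
have : 1 * dl <= (2 * r - dl) * dl by apply: ler_wpM2r; lra.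
rewrite expr2 mulr2n; lra.
Qed.

(** * From a twisted approximation to a character extending the conjugate of chi *)

Section TwistedCharacter.
Context {R : realType} {Gamma G : groupType} {A : zmodType}.
Context {i : A -> G} {q : G -> Gamma} (ext : central_extension i q).
Local Notation C := R[i].
Local Notation toC := (real_complex R).
Local Notation Re := (@complex.Re R).

Definition unitary_char (chi : A -> C) : Prop :=
  (forall a b, chi (a + b) = chi a * chi b) /\ (forall a, normc (chi a) = 1).

(* When [chi] is close to 1 on a finite set, the trace condition makes the
   composite of [psi] with a section of [q] a hyperlinear approximation of
   [Gamma]. *)
Definition twisted_approx (chi : A -> C) : Prop :=
  forall (F : seq G) (FA : seq A) (e : R), 0 < e ->
  exists (m : nat) (psi : G -> 'M[C]_m), [/\ (0 < m)%N,
    forall g, psi g \is unitarymx,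
    {in F &, forall g h, hs_norm (psi g *m psi h - psi (g * h)%g) <= e},
    {in FA, forall a, hs_norm (psi (i a) - (chi a)%:M) <= e} &
    {in F, forall g, q g != 1%g -> normc (ntrace (psi g)) <= e}].

Lemma ext_q1 : q 1%g = 1%g.
Proof. by apply: (mulgI (q 1%g)); rewrite -(ext_quotM ext) !mulg1. Qed.

Lemma ext_qV g : q g^-1%g = (q g)^-1%g.
Proof. by apply: (mulgI (q g)); rewrite -(ext_quotM ext) !mulgV ext_q1. Qed.

Lemma ext_i0 : i 0 = 1%g.
Proof. by apply: (mulgI (i 0)); rewrite -(ext_inclM ext) addr0 mulg1. Qed.

Lemma ext_iN a : i (- a) = (i a)^-1%g.
Proof. by apply: (mulgI (i a)); rewrite -(ext_inclM ext) subrr mulgV ext_i0. Qed.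

Lemma ext_qi a : q (i a) = 1%g.
Proof. by have : range i (i a); [exists a | rewrite (ext_exact ext)]. Qed.

Lemma ext_ker g : q g = 1%g -> exists a, g = i a.
Proof.
by move=> qg; have : [set x | q x = 1%g] g by []; rewrite -(ext_exact ext) => -[a _ <-]; exists a.
Qed.

Lemma ext_section : exists s : Gamma -> G, cancel s q.
Proof.
have sx x : exists g, q g = x.
  have : [set: Gamma] x by []; rewrite -(ext_quot_surj ext) => -[g _ <-].
  by exists g.
by have [s sE] := choice sx; exists s.
Qed.

Lemma ext_fiber g h : q g = q h -> exists a, g = (i a * h)%g.
Proof.
move=> qgh; have [|a aE] := @ext_ker (g * h^-1)%g.
  by rewrite (ext_quotM ext) ext_qV qgh mulgV.
by exists a; rewrite -aE mulgVK.
Qed.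

Lemma unitary_char0 chi : unitary_char chi -> chi 0 = 1.
Proof.
move=> [chiD chi1]; have c0 : chi 0 != 0 by rewrite -normc_eq0 chi1 oner_neq0.
by apply: (mulfI c0); rewrite -chiD addr0 mulr1.
Qed.

Lemma unitary_charN chi a : unitary_char chi -> chi (- a) = (chi a)^*.
Proof.
move=> uc; have [chiD chi1] := uc.
have ca : chi a != 0 by rewrite -normc_eq0 chi1 oner_neq0.
by apply: (mulfI ca); rewrite -chiD subrr unitary_char0 // -toC_normc_sqr chi1 expr1n.
Qed.

Context (s : Gamma -> G) (sK : cancel s q).
Context (c : Gamma -> Gamma -> A)
  (cE : forall x y, (s x * s y)%g = (i (c x y) * s (x * y))%g).

(** Here [c] is the cocycle of the section [s]. Replacing [s x * s y] by [s (x * y)] costs three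
    errors [e] and the distance of [chi (c x y)] from 1; the factor 6 makes the former at most
    [dl / 2]. *)
Lemma almost_hom_section (F : seq Gamma) (dl e : R) (chi : A -> C) m
    (psi : G -> 'M[C]_m) (FG : seq G) (FA : seq A) :
  0 < dl -> 6 * e <= dl -> unitary_char chi -> (0 < m)%N ->
  (forall g, psi g \is unitarymx) ->
  {in FG &, forall g h, hs_norm (psi g *m psi h - psi (g * h)%g) <= e} ->
  {in FA, forall a, hs_norm (psi (i a) - (chi a)%:M) <= e} ->
  {in FG, forall g, q g != 1%g -> normc (ntrace (psi g)) <= e} ->
  {in F, forall x, s x \in FG} ->
  {in F &, forall x y, [/\ s (x * y)%g \in FG, i (c x y) \in FG, c x y \in FA &
     normc (chi (c x y) - 1) <= dl / 2]} ->
  almost_hom F dl (psi \o s).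
Proof.
move=> dl0 e_dl uchi m0 psiU psiM psiA psiT sF cF.
split=> //= [x y xF yF|x xF x1].
- have [sxy ic cA chi1] := cF x y xF yF.
  set cc := c x y in ic cA chi1 *.
  have h1 : hs_norm (psi (s x) *m psi (s y) - psi (i cc * s (x * y))%g) <= e.
    by rewrite -cE; apply: psiM; exact: sF.
  have h2 : hs_norm (psi (i cc * s (x * y))%g - psi (i cc) *m psi (s (x * y)%g)) <= e.
    by rewrite hsB; apply: psiM.
  have h3 : hs_norm (psi (i cc) *m psi (s (x * y)%g) - (chi cc)%:M *m psi (s (x * y)%g)) <= e.
    by rewrite -mulmxBl (hs_unitaryr _ (psiU _)); exact: psiA.
  have h4 : hs_norm ((chi cc)%:M *m psi (s (x * y)%g) - psi (s (x * y)%g)) <= dl / 2.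
    rewrite mul_scalar_mx -{2}[psi _]scale1r -scalerBl hsZ hs_unitary ?psiU // mulr1.
    exact: chi1.
  have t3 := le_trans (hs_trans _ _ _) (lerD h3 h4).
  have t2 := le_trans (hs_trans _ _ _) (lerD h2 t3).
  apply: le_trans (hs_trans _ _ _) _; apply: le_trans (lerD h1 t2) _.
  exact: three_steps_le.
- have sx1 : q (s x) != 1%g by rewrite sK.
  have h := le_trans (Re_le_normc _) (psiT _ (sF _ xF) sx1).
  exact: sqrt2_gap dl0 e_dl h (hs_ge0 _) (hs_sub1_sqr m0 (psiU _)).
Qed.

(* [f g] is the ultralimit of the normalized traces of the product of [T_n (q g)]
   and the adjoint of [psi_n g], with [T_n] the maps provided by weak
   ucp-stability. *)
Lemma twisted_limit (F Q : seq Gamma) (dl e : R) (chi : A -> C) :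
  countable [set: G] -> 0 < dl ->
  (forall d (theta : Gamma -> 'M[C]_d), almost_hom F dl theta ->
    exists T : Gamma -> 'M[C]_d, ucp_map T /\
      {in Q, forall g, hs_norm (theta g - T g) <= e}) ->
  unitary_char chi -> twisted_approx chi ->
  {in F &, forall x y, normc (chi (c x y) - 1) <= dl / 2} ->
  exists f : G -> C, [/\ posdef f, f 1%g = 1,
    forall a g, f (i a * g)%g = (chi a)^* * f g &
    {in Q, forall x, normc (f (s x) - 1) <= e}].
Proof.
move=> Gcount dl0 stable uchi tw chiF.
have [E EE] := countable_exhaustion (1%g : G) Gcount.
pose FG0 := [seq s x | x <- F] ++ [seq s (x * y)%g | x <- F, y <- F] ++
  [seq i (c x y) | x <- F, y <- F].
pose FA0 := [seq c x y | x <- F, y <- F].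
have [EA EAE] : exists EA : nat -> seq A, forall a, \forall n \near \oo, a \in EA n.
  have /countable_injP[gn gn_inj] := Gcount.
  apply: (countable_exhaustion 0); apply/countable_injP; exists (gn \o i) => a b _ _ /= h.
  by apply: (ext_incl_inj ext); apply: gn_inj; rewrite ?inE.
(* Errors must tend to 0, and already at every single [n] be small enough for stability to apply. *)
pose ep n : R := Num.min (harmonic n) (dl / 6).
have ep0 n : 0 < ep n by rewrite lt_min harmonic_gt0 divr_gt0.
have ep_h n : ep n <= harmonic n by rewrite ge_min lexx.
have ep_d n : 6 * ep n <= dl.
  have : ep n <= dl / 6 by rewrite ge_min lexx orbT.
  lra.
have ex n : exists mp : {m : nat & ((G -> 'M[C]_m) * (Gamma -> 'M[C]_m))%type},
    let psi := (projT2 mp).1 in let T := (projT2 mp).2 in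
    [/\ (0 < projT1 mp)%N, forall g, psi g \is unitarymx,
      {in E n &, forall g h, hs_norm (psi g *m psi h - psi (g * h)%g) <= harmonic n},
      {in EA n, forall a, hs_norm (psi (i a) - (chi a)%:M) <= harmonic n} &
      ucp_map T /\ {in Q, forall x, hs_norm (psi (s x) - T x) <= e}].
  have [m [psi [m0 psiU psiM psiA psiT]]] := tw (E n ++ FG0) (EA n ++ FA0) (ep n) (ep0 n).
  have [|T [Tu TQ]] := stable m (psi \o s).
    apply: (almost_hom_section dl0 (ep_d n) uchi m0 psiU psiM psiA psiT).
      by move=> x xF; rewrite !mem_cat map_f ?orbT.
    move=> x y xF yF; rewrite !mem_cat; split; last exact: chiF.
    - by rewrite (allpairs_f (fun x y => s (x * y)%g)) ?orbT.
    - by rewrite (allpairs_f (fun x y => i (c x y))) ?orbT.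
    - by rewrite (allpairs_f c) ?orbT.
  exists (existT _ m (psi, T)) => /=; split=> // [g h gE hE|a aE].
    by apply: le_trans (ep_h n); apply: psiM; rewrite mem_cat ?gE ?hE.
  by apply: le_trans (ep_h n); apply: psiA; rewrite mem_cat aE.
have [mp mpP] := choice ex.
pose m n := projT1 (mp n); pose psi n : G -> 'M[C]_(m n) := (projT2 (mp n)).1.
pose T n : Gamma -> 'M[C]_(m n) := (projT2 (mp n)).2.
have m0 n : (0 < m n)%N by have [] := mpP n.
have psiU n g : psi n g \is unitarymx by have [_ /(_ g)] := mpP n.
have Tu n : ucp_map (T n) by have [_ _ _ _ []] := mpP n.
have TQ n x : x \in Q -> hs_norm (psi n (s x) - T n x) <= e.
  by have [_ _ _ _ [_ h]] := mpP n; apply: h.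
have mul_lim g h : (fun n => hs_norm (psi n g *m psi n h - psi n (g * h)%g)) @ \oo --> (0 : R).
  apply: cvg0_eventually => [n|e' e'0]; first exact: hs_ge0.
  near=> n; have [_ _ psiM _ _] := mpP n.
  apply: le_trans (psiM _ _ _ _) _; near: n; [exact: EE|exact: EE|exact: near_harmonic_le].
have chi_lim a : (fun n => hs_norm (psi n (i a) - (chi a)%:M)) @ \oo --> (0 : R).
  apply: cvg0_eventually => [n|e' e'0]; first exact: hs_ge0.
  near=> n; have [_ _ _ psiA _] := mpP n.
  apply: le_trans (psiA _ _) _; near: n; [exact: EAE|exact: near_harmonic_le].
have Tle n x (X : 'M[C]_(m n)) : normc (ntrace (T n x *m X)) <= hs_norm X.
  have [_ _ T1] := Tu n; rewrite -[T n x]trmxCK.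
  apply: le_trans (ntrace_CauchySchwarz _ _) _.
  by rewrite hs_adj ler_piMl ?hs_ge0.
pose u g n := ntrace (T n (q g) *m (psi n g)^t*).
have ub g : ubounded (u g).
  by exists 1 => n; apply: le_trans (Tle _ _ _) _; rewrite hs_adj hs_unitary.
have u_near g (X : forall n, 'M[C]_(m n)) (cc : nat -> C) :
    (forall n, cc n = ntrace (T n (q g) *m (X n)^t*)) ->
    (fun n => hs_norm (psi n g - X n)) @ \oo --> (0 : R) ->
    (fun n => normc (u g n - cc n)) @ \oo --> (0 : R).
  move=> ccE; apply: cvg0_le => n; rewrite normc_ge0 ccE /u -ntraceB -mulmxBr -tcB.
  by apply: le_trans (Tle _ _ _) _; rewrite hs_adj.
pose f g := culim (u g); exists f; split.
- move=> l; rewrite kform_sum.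
  (* The value at [r^-1 * p] is first rewritten with the product of the two matrices, for which
     positivity holds exactly at each [n]. *)
  pose v (r p : C * G) n : C := ntrace (T n ((q r.2)^-1 * q p.2)%g *m
    ((psi n r.2)^t* *m psi n p.2)^t*).
  have vb r p : ubounded (v r p).
    exists 1 => n; apply: le_trans (Tle _ _ _) _; rewrite hs_adj hs_unitaryl.
      by rewrite hs_unitary.
    by rewrite trmxC_unitary.
  have lim (r p : C * G) : (fun n => hs_norm (psi n (r.2^-1 * p.2)%g -
      (psi n r.2)^t* *m psi n p.2)) @ \oo --> (0 : R).
    apply: cvg0_le (mul_lim r.2 (r.2^-1 * p.2)%g) => n; rewrite hs_ge0 /= mulVKg.
    rewrite -[leLHS](hs_unitaryl _ (psiU n r.2)) mulmxBr.
    by rewrite [psi n r.2 *m (_ *m psi n p.2)]mulmxA unitaryK ?mul1mx.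
  have fv r p : f (r.2^-1 * p.2)%g = culim (v r p).
    apply: culim_eq (ub _) (vb r p) _; apply: u_near (lim r p) => n.
    by rewrite (ext_quotM ext) ext_qV.
  have wb (p r : C * G) : ubounded (fun n => p.1 * r.1^* * v r p n).
    by apply: uboundedM (vb r p); apply: ubounded_cst.
  have -> : \sum_(p <- l) \sum_(r <- l) p.1 * r.1^* * f (r.2^-1 * p.2)%g =
      culim (fun n => \sum_(p <- l) \sum_(r <- l) p.1 * r.1^* * v r p n).
    rewrite (culim_sum l (fun p => (culim_sum l (wb p)).1)).2.
    apply: eq_bigr => p _; rewrite (culim_sum l (wb p)).2; apply: eq_bigr => r _.
    by rewrite fv culimZ.
  apply: culim_ge0 => [|n].
    exact: (culim_sum l (fun p => (culim_sum l (wb p)).1)).1.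
  by have := ucp_trace_psd q (psi n) (Tu n) l; rewrite kform_sum.
- apply: culim_cvg; have := chi_lim 0.
  rewrite (unitary_char0 uchi) ext_i0 => lim1.
  apply: u_near lim1 => n; have [T1 _ _] := Tu n.
  by rewrite ext_q1 T1 mul1mx tc1 ntrace1.
- move=> a g; rewrite /f -culimZ //; apply: culim_eq (ub _) _ _.
    by apply: uboundedM (ub g); apply: ubounded_cst.
  have qag : q (i a * g)%g = q g by rewrite (ext_quotM ext) ext_qi mul1g.
  apply: (@u_near _ (fun n => chi a *: psi n g)) => [n|].
    by rewrite qag tcZ -scalemxAr ntraceZ.
  have sum_lim : (fun n => hs_norm (psi n (i a) *m psi n g - psi n (i a * g)%g) +
      hs_norm (psi n (i a) - (chi a)%:M)) @ \oo --> (0 : R).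
    by rewrite -[X in _ --> X](addr0 (0 : R)); exact: cvgD (mul_lim (i a) g) (chi_lim a).
  apply: cvg0_le sum_lim => n; rewrite hs_ge0 /=.
  apply: le_trans (hs_trans (psi n (i a) *m psi n g) _ _) _; rewrite hsB lerD2l.
  by rewrite -mul_scalar_mx -mulmxBl hs_unitaryr.
- move=> x xQ; rewrite -[X in _ - X](culim_cst (R := R)) -[- _]mulN1r.
  rewrite -culimZ; last exact: ubounded_cst.
  rewrite -culimD //; last by apply: ubounded_cst.
  apply: culim_normc_le; first by apply: uboundedD => //; apply: ubounded_cst.
  apply: nearW => n; rewrite mulN1r /u sK.
  have <- : ntrace (psi n (s x) *m (psi n (s x))^t*) = 1.
    by rewrite unitaryK ?ntrace1.
  rewrite -ntraceB -mulmxBl ntraceC; apply: le_trans (ntrace_CauchySchwarz _ _) _.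
  by rewrite hs_unitary // mul1r hsB TQ.
Unshelve. all: by end_near. Qed.

Lemma normc_twist (f : G -> C) chi a g : unitary_char chi ->
  (forall a g, f (i a * g)%g = (chi a)^* * f g) -> normc (f (i a * g)%g) = normc (f g).
Proof. by move=> [_ chi1] ->; rewrite normcM normc_J chi1 mul1r. Qed.

(** The twist has modulus 1, so the modulus of [f] is constant on the fibres of [q]; its square is
    the Schur product of [f] with its conjugate, both pulled back along the section. *)
Lemma posdef_normsq (f : G -> C) chi : unitary_char chi ->
  (forall a g, f (i a * g)%g = (chi a)^* * f g) -> posdef f ->
  posdef (fun x : Gamma => toC (normc (f (s x)) ^+ 2)).
Proof.
move=> uchi fa fpd.
have Kp : psd_kernel (fun x y : Gamma => f ((s y)^-1 * s x)%g).
  move=> l; have := fpd [seq (p.1, s p.2) | p <- l]; rewrite !kform_sum big_map.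
  by congr (0 <= _); apply: eq_bigr => p _; rewrite big_map.
have KJp : psd_kernel (fun x y : Gamma => (f ((s y)^-1 * s x)%g)^*).
  move=> l; have := Kp [seq (p.1^*, p.2) | p <- l]; rewrite !kform_sum big_map -conj_ge0.
  congr (0 <= _); rewrite rmorph_sum; apply: eq_bigr => p _ /=.
  rewrite big_map rmorph_sum; apply: eq_bigr => r _ /=.
  by rewrite -[LHS]/((_ * _)^*) !conjCM !conjCK.
move=> l; have := psd_kernel_mul Kp KJp l; congr (0 <= _); congr kform.
apply/funext => x; apply/funext => y; rewrite -toC_normc_sqr; congr (toC (_ ^+ 2)).
have [|a ->] := @ext_fiber ((s y)^-1 * s x)%g (s (y^-1 * x)%g).
  by rewrite sK (ext_quotM ext) ext_qV !sK.
exact: (normc_twist a _ uchi fa).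
Qed.

(* In the cyclic representation of [f], some vector is moved by every element of
   [G] almost only within its own line; maximising this property gives a
   one-dimensional invariant subspace. *)
Lemma posdef_character (f : G -> C) chi : unitary_char chi ->
  (forall a g, f (i a * g)%g = (chi a)^* * f g) -> posdef f -> f 1%g = 1 ->
  (forall g, 19 / 20 <= normc (f g) ^+ 2) ->
  exists b : G -> C, [/\ forall g h, b (g * h)%g = b g * b h,
    forall g, normc (b g) = 1 & forall a, b (i a) = (chi a)^*].
Proof.
move=> uchi fa fpd f1 fbig.
have [H [rho [xi [rep xiE cyc]]]] := gns fpd.
have xi1 : ip2 xi = 1 by rewrite /ip2 -{1}(rep1 rep xi) xiE f1.
have orbE x h : inner H (rho x xi) (rho h xi) = f (h^-1 * x)%g.
  by rewrite -xiE repM // [RHS]rep_adj // invgK.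
(* Centrality moves [i a] past the test element, so [i a] acts by a scalar on the orbit and, by
   cyclicity, on the whole space. *)
have rho_orb a g : rho (i a) (rho g xi) = (chi a)^* *: rho g xi.
  apply/eqP; rewrite -subr_eq0; apply/eqP/cyc => h.
  rewrite ipBl ipZl -repM // !orbE mulgA -(ext_central ext a h^-1%g) -mulgA fa.
  exact: subrr.
have rho_scal a v : rho (i a) v = (chi a)^* *: v.
  apply/eqP; rewrite -subr_eq0; apply/eqP/cyc => g.
  rewrite ipBl ipZl rep_adj // -ext_iN rho_orb ipZr conjCK.
  by rewrite (unitary_charN _ uchi) subrr.
(* With this error the part of [rho h (v n)] orthogonal to [v n] has norm at most [harmonic n]. *)
have [v v1 vb] : exists2 v : nat -> H, forall n, ip2 (v n) = 1 &
    forall n g, 1 - harmonic n ^+ 2 / 2 <= normc (inner H (rho g (v n)) (v n)).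
  have e0 n : 0 < (harmonic n : R) ^+ 2 / 2 by rewrite divr_gt0 ?exprn_gt0 ?harmonic_gt0.
  have big g : 19 / 20 <= normc (inner H (rho g xi) xi) ^+ 2 by rewrite xiE.
  have ex n : exists v : H, ip2 v = 1 /\
      forall g, 1 - harmonic n ^+ 2 / 2 <= normc (inner H (rho g v) v).
    by have [w w1 wb] := almost_invariant_line rep xi1 big (e0 n); exists w.
  by have [v vP] := choice ex; exists v => n; have [] := vP n.
pose u g n := inner H (rho g (v n)) (v n).
have u1 g n : normc (u g n) <= 1.
  rewrite -ler_sqr ?nnegrE ?normc_ge0 // expr1n.
  by apply: le_trans (ip_CauchySchwarz _ _) _; rewrite rep_ip2 // !v1 mulr1.
have ub g : ubounded (u g) by exists 1.
have h1 n : (harmonic n : R) <= 1 by rewrite invf_le1 ?ler1n.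
have h2 n : (harmonic n : R) ^+ 2 <= harmonic n.
  by rewrite expr2 ler_piMl ?harmonic_ge0.
(* Attainment of the maximum is avoided: coefficients along almost invariant lines are almost
   multiplicative, and their ultralimit is the character. *)
exists (fun g => culim (u g)); split.
- move=> g h; rewrite -culimM //; apply: culim_eq (ub _) _ _.
    exact: uboundedM.
  apply: cvg0_le (@cvg_harmonic R) => n; rewrite normc_ge0 /=.
  pose e := rho h (v n) - inner H (rho h (v n)) (v n) *: v n.
  have -> : u (g * h)%g n - u g n * u h n = inner H (rho g e) (v n).
    by rewrite /e repB // repZ // ipBl ipZl -repM // [u g n * _]mulrC.
  rewrite -ler_sqr ?nnegrE ?normc_ge0 ?harmonic_ge0 //.
  apply: le_trans (ip_CauchySchwarz _ _) _; rewrite rep_ip2 // v1 mul1r.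
  rewrite ip2_residual // rep_ip2 // v1.
  have := vb n h; have := u1 h n; rewrite -/(u h n).
  set t := normc _; set k := harmonic n ^+ 2 => t1 kt.
  have : (1 - k / 2) ^+ 2 <= t ^+ 2.
    by rewrite ler_sqr ?nnegrE //; have := h2 n; have := h1 n; rewrite -/k; lra.
  have : 0 <= k ^+ 2 by exact: sqr_ge0.
  lra.
- move=> g; apply/eqP; rewrite -(@eqrXn2 _ 2%N) ?normc_ge0 // expr1n; apply/eqP.
  apply: toC_inj; rewrite toC_normc_sqr -culimJ // -culimM //; last exact: uboundedJ.
  apply: culim_cvg; apply: cvg0_le (@cvg_harmonic R) => n; rewrite normc_ge0 /=.
  rewrite -toC_normc_sqr -[X in _ - X]/(toC 1) -toCB normc_real.
  have := vb n g; have := u1 g n; rewrite -/(u g n).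
  set t := normc _; set k := harmonic n ^+ 2 => t1 kt.
  have k1 : k <= 1 by apply: le_trans (h2 n) (h1 n).
  have : (1 - k / 2) ^+ 2 <= t ^+ 2 by rewrite ler_sqr ?nnegrE //; lra.
  have t2 : t ^+ 2 <= 1 by rewrite expr_le1 // normc_ge0.
  have : 0 <= k ^+ 2 by exact: sqr_ge0.
  have hk : k <= n.+1%:R^-1 := h2 n.
  move=> k2 kt2; apply: le_trans hk; rewrite ler_norml; apply/andP; split; lra.
- move=> a; rewrite -[RHS](culim_cst (R := R)); congr culim; apply/funext => n.
  by rewrite /u rho_scal ipZl ip2E v1 mulr1.
Qed.

Lemma twisted_character_step : countable [set: G] -> countable [set: Gamma] ->
  property_T R Gamma -> weakly_ucp_stable R Gamma ->
  exists (SA : seq A) (dl : R), 0 < dl /\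
  forall chi, unitary_char chi -> twisted_approx chi ->
    {in SA, forall a, normc (chi a - 1) <= dl} ->
  exists b : G -> C, [/\ forall g h, b (g * h)%g = b g * b h,
    forall g, normc (b g) = 1 & forall a, b (i a) = (chi a)^*].
Proof.
move=> Gcount Gammacount GammaT stable.
have [Q [eps [eps0 QP]]] := property_T_posdef GammaT.
(* Property (T) then leaves a constant [c0 >= 1 - 2 * k / eps ^+ 2 = 39 / 40], and the squared
   modulus is at least [2 * c0 - 1 >= 19 / 20], the threshold of [almost_invariant_line]. Stability
   is used at [k / 2] because moduli get squared. *)
pose k : R := eps ^+ 2 / 80; have e20 : 0 < eps ^+ 2 by rewrite exprn_gt0.
have k0 : 0 < k by rewrite divr_gt0.
have [F [dl [dl0 FP]]] := weakly_ucp_stable_finite Gammacount stable Q (divr_gt0 k0 (ltr0n R 2)).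
exists [seq c x y | x <- F, y <- F], (dl / 2); split=> [|chi uchi tw chi1].
  by rewrite divr_gt0.
have [|f [fpd f1 fa fQ]] := twisted_limit Gcount dl0 FP uchi tw.
  by move=> x y xF yF; apply: chi1; apply: allpairs_f.
have phi1 : toC (normc (f (s 1%g)) ^+ 2) = 1.
  have [|a ->] := @ext_fiber (s 1%g) 1%g; first by rewrite sK ext_q1.
  by rewrite (normc_twist a _ uchi fa) f1 normc1 expr1n.
have phiQ : {in Q, forall x, 1 - Re (toC (normc (f (s x)) ^+ 2)) <= k}.
  move=> x xQ /=; have h := fQ x xQ.
  have : normc (1 : C) <= normc (f (s x)) + k / 2.
    rewrite -[X in normc X](subrK (f (s x))) addrC.
    by apply: le_trans (le_normcD _ _) _; rewrite lerD2l normcB.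
  rewrite normc1; set t := normc _ => t1.
  have [k2|k2] := leP 1 (k / 2); first by have := sqr_ge0 t; lra.
  have : (1 - k / 2) ^+ 2 <= t ^+ 2.
    by rewrite ler_sqr ?nnegrE ?normc_ge0 //; lra.
  have : 0 <= k ^+ 2 by exact: sqr_ge0.
  lra.
apply: (posdef_character uchi fa fpd f1) => g.
have [c0 /andP[c0k c01] c0pd] := QP _ k (posdef_normsq uchi fa fpd) phi1 (ltW k0) phiQ.
have c0_big : 39 / 40 <= c0.
  apply: le_trans c0k; rewrite /k.
  have -> : 2 * (eps ^+ 2 / 80) / eps ^+ 2 = 1 / 40 by field; rewrite gt_eqF.
  lra.
have [|a ->] := @ext_fiber g (s (q g)); first by rewrite sK.
rewrite (normc_twist a _ uchi fa); set x := q g; set t := normc _ ^+ 2.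
have [H [rho [xi [rep xiE _]]]] := gns c0pd.
have xi2 : ip2 xi = 1 - c0 by rewrite /ip2 -{1}(rep1 rep xi) xiE phi1 ReD ReN.
(* A positive definite function is bounded by its value at 1; for the squared modulus minus [c0]
   this reads [|t - c0| <= 1 - c0]. *)
have := ip_CauchySchwarz (rho x xi) xi.
rewrite rep_ip2 // xiE -/t -toCB normc_real xi2 -expr2.
rewrite ler_sqr ?nnegrE ?normr_ge0 ?subr_ge0 // ler_norml => /andP[h _].
lra.
Qed.

End TwistedCharacter.

Theorem twisted_character (R : realType) (Gamma G : groupType) (A : zmodType)
    (i : A -> G) (q : G -> Gamma) : central_extension i q ->
  countable [set: G] -> countable [set: Gamma] ->
  property_T R Gamma -> weakly_ucp_stable R Gamma ->
  exists (SA : seq A) (dl : R), 0 < dl /\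
  forall chi : A -> R[i], unitary_char chi -> twisted_approx (i := i) (q := q) chi ->
    {in SA, forall a, normc (chi a - 1) <= dl} ->
  exists b : G -> R[i], [/\ forall g h, b (g * h)%g = b g * b h,
    forall g, normc (b g) = 1 & forall a, b (i a) = (chi a)^*].
Proof.
move=> ext; have [s sK] := ext_section ext.
have cex (xy : Gamma * Gamma) : exists a, (s xy.1 * s xy.2)%g = (i a * s (xy.1 * xy.2))%g.
  by apply: (ext_fiber ext); rewrite (ext_quotM ext) !sK.
have [c cE] := choice cex.
apply: (@twisted_character_step _ _ _ _ _ _ ext s sK (fun x y => c (x, y))) => x y.
exact: (cE (x, y)).
Qed.

(** * Twisted approximations from hyperlinearity *)

Section Amplification.
Context {R : realType}.
Local Notation C := R[i].
Local Notation toC := (real_complex R).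
Local Notation Re := (@complex.Re R).

Lemma sum_tens (S : nmodType) m n (F : 'I_(m * n) -> S) :
  \sum_k F k = \sum_i \sum_j F (mxtens_index (i, j)).
Proof.
rewrite pair_big /= (reindex (@mxtens_index m n)) /=; last first.
  by exists (@mxtens_unindex m n) => k _; rewrite (mxtens_indexK, mxtens_unindexK).
by apply: eq_bigr => -[i j].
Qed.

Lemma tc_tens m n p q (X : 'M[C]_(m, n)) (Y : 'M[C]_(p, q)) :
  (X *t Y)^t* = X^t* *t Y^t*.
Proof. by rewrite trmx_tens map_mxT. Qed.

Lemma tens11 m n : (1%:M : 'M[C]_m) *t (1%:M : 'M[C]_n) = 1%:M.
Proof.
apply/matrixP => a b; case: (mxtens_indexP a) => i j; case: (mxtens_indexP b) => k l.
rewrite tensmxE !mxE (inj_eq (can_inj (@mxtens_indexK m n))) xpair_eqE.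
by case: (i == k); case: (j == l); rewrite ?mulr1 ?mulr0.
Qed.

Lemma tens_unitary m n (X : 'M[C]_m) (Y : 'M[C]_n) :
  X \is unitarymx -> Y \is unitarymx -> X *t Y \is unitarymx.
Proof.
move=> /unitarymxP Xu /unitarymxP Yu; apply/unitarymxP.
by rewrite tc_tens tensmx_mul Xu Yu tens11.
Qed.

Lemma mxtrace_tens m n (X : 'M[C]_m) (Y : 'M[C]_n) : \tr (X *t Y) = \tr X * \tr Y.
Proof.
rewrite /mxtrace sum_tens big_distrl; apply: eq_bigr => i _ /=.
by rewrite big_distrr; apply: eq_bigr => j _; rewrite tensmxE.
Qed.

Lemma ntrace_tens m n (X : 'M[C]_m) (Y : 'M[C]_n) :
  ntrace (X *t Y) = ntrace X * ntrace Y.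
Proof. by rewrite /ntrace mxtrace_tens natrM invfM mulrACA. Qed.

Lemma hs_tens m n (X : 'M[C]_m) (Y : 'M[C]_n) :
  hs_norm (X *t Y) = hs_norm X * hs_norm Y.
Proof.
rewrite !hs_normE -sqrtrM ?hs2_ge0 //; congr Num.sqrt; apply: toC_inj.
by rewrite [RHS]toCM -!ntrace_adj_mul tc_tens tensmx_mul ntrace_tens.
Qed.

Lemma tensB m n p q (X X' : 'M[C]_(m, n)) (Y Y' : 'M[C]_(p, q)) :
  X *t Y - X' *t Y' = (X - X') *t Y + X' *t (Y - Y').
Proof. by apply/matrixP => i j; rewrite !mxE; ring. Qed.

Lemma hs_tensB m n (X X' : 'M[C]_m) (Y Y' : 'M[C]_n) : (0 < m)%N -> (0 < n)%N ->
  X' \is unitarymx -> Y \is unitarymx ->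
  hs_norm (X *t Y - X' *t Y') <= hs_norm (X - X') + hs_norm (Y - Y').
Proof.
move=> m0 n0 X'u Yu; rewrite tensB; apply: le_trans (hs_triangle _ _) _.
by rewrite !hs_tens (hs_unitary n0 Yu) (hs_unitary m0 X'u) mulr1 mul1r.
Qed.

Lemma fro_block m (X : 'M[C]_m) : fro (block_mx X 0 0 (0 : 'M[C]_m)) = fro X.
Proof.
rewrite /fro big_split_ord /= [X in _ + X]big1 => [|i _]; last first.
  by rewrite big_split_ord /= !big1 ?addr0 // => j _;
    rewrite ?block_mxEdl ?block_mxEdr mxE normc0 expr0n.
rewrite addr0; apply: eq_bigr => i _; rewrite big_split_ord /= [X in _ + X]big1 => [|j _].
  by rewrite addr0; apply: eq_bigr => j _; rewrite block_mxEul.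
by rewrite block_mxEur mxE normc0 expr0n.
Qed.

Lemma hs_block_le m (X : 'M[C]_m) :
  hs_norm (block_mx X 0 0 (0 : 'M[C]_m)) <= hs_norm X.
Proof.
rewrite !hs_normE ler_wsqrtr // /hs2 fro_block.
case: m X => [|m] X; first by rewrite addn0.
rewrite ler_wpM2l ?fro_ge0 // lef_pV2 ?posrE ?ltr0n // ler_nat; exact: leq_addr.
Qed.

Lemma block_unitary m (X : 'M[C]_m) : X \is unitarymx ->
  block_mx X 0 0 (1%:M : 'M[C]_m) \is unitarymx.
Proof.
move=> /unitarymxP Xu; apply/unitarymxP.
rewrite tr_block_mx map_block_mx !trmx0 !(map_mx0 conjC) tc1 mulmx_block.
by rewrite Xu !mulmx0 !mul0mx !addr0 add0r mulmx1 -scalar_mx_block.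
Qed.

Context {G : groupType}.

(** Distance almost [sqrt 2] from 1 bounds only the real part of the trace from above, so the trace
    could be near -1. A trivial summand of equal dimension replaces [z] by [(z + 1) / 2]. *)
Lemma hyperlinear_trace_lt1 : hyperlinear R G ->
  forall (F : seq G) (e : R), 0 < e ->
  exists (d : nat) (phi : G -> 'M[C]_d), [/\ (0 < d)%N,
    forall g, phi g \is unitarymx,
    {in F &, forall g h, hs_norm (phi g *m phi h - phi (g * h)%g) <= e} &
    {in F, forall g, g != 1%g -> normc (ntrace (phi g)) <= 3 / 4}].
Proof.
move=> hyp F e e0; pose F' := F ++ [seq (g * h)%g | g <- F, h <- F].
(* The real part of the trace is then at most 1/8, and [|z + 1|^2 / 4 <= (1 + 1/4 + 1) / 4 =
   (3/4)^2]. *)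
pose e' := Num.min e (1 / 16); have e'0 : 0 < e' by rewrite lt_min e0 divr_gt0.
have e'e : e' <= e by rewrite ge_min lexx.
have e'16 : e' <= 1 / 16 by rewrite ge_min lexx orbT.
have [d [phi0 [d0 phiU phiM phi1]]] := hyp e' F' e'0.
pose phi g := if g \in F' then phi0 g else 1%:M.
have phiE g : g \in F' -> phi g = phi0 g by rewrite /phi => ->.
have phiUn g : phi g \is unitarymx.
  rewrite /phi; case: ifP => [gF|_]; first exact: phiU.
  by apply/unitarymxP; rewrite tc1 mulmx1.
have FF' g : g \in F -> g \in F' by rewrite mem_cat => ->.
have FM g h : g \in F -> h \in F -> (g * h)%g \in F'.
  by move=> gF hF; rewrite mem_cat (allpairs_f (fun g h => (g * h)%g)) ?orbT.
exists (d + d)%N, (fun g => block_mx (phi g) 0 0 1%:M); split.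
- by rewrite addn_gt0 d0.
- by move=> g; apply: block_unitary.
- move=> g h gF hF; rewrite mulmx_block !mulmx0 !mul0mx !addr0 add0r mulmx1.
  rewrite opp_block_mx add_block_mx !oppr0 !addr0 subrr.
  apply: le_trans (hs_block_le _) _; rewrite !phiE ?FM ?FF' //.
  by apply: le_trans e'e; apply: ltW; apply: (phiM g h (FF' g gF) (FF' h hF)); apply: FM.
- move=> g gF g1; have [gF' gU] := (FF' g gF, phiUn g).
  have -> : ntrace (block_mx (phi g) 0 0 (1%:M : 'M[C]_d)) = toC (1 / 2) * (ntrace (phi g) + 1).
    rewrite -[in RHS](ntrace1 (R := R) d0) !ntraceE mxtrace_block -mulrDr mulrA -toCM.
    congr (toC _ * _); rewrite natrD; field.
    by rewrite -natrD !pnatr_eq0 -!lt0n addn_gt0 d0.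
  have := phi1 g gF' g1; rewrite -phiE //.
  have := hs_sub1_sqr d0 gU; set w := hs_norm _ => w2 wbig.
  have w0 : 0 <= w := hs_ge0 _.
  set z := ntrace (phi g) in w2 *.
  have z1 : normc z <= 1 by rewrite -(hs_unitary d0 gU) ntrace_le.
  have Rez : Re z <= 2 * e'.
    have r2 : Num.sqrt (2 : R) ^+ 2 = 2 by rewrite sqr_sqrtr.
    set r := Num.sqrt 2 in r2 wbig; have r0 : 0 <= r := sqrtr_ge0 _.
    have r1 : 1 <= r by rewrite -ler_sqr ?nnegrE // r2 expr1n; lra.
    have r3 : r <= 2 by rewrite -ler_sqr ?nnegrE // r2 expr2; lra.
    have : (r - e') ^+ 2 <= w ^+ 2 by rewrite ler_sqr ?nnegrE //; lra.
    rewrite w2 sqrrB r2 mulr2n => h.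
    have : r * e' <= 2 * e' by rewrite ler_wpM2r // ltW.
    have : 0 <= e' ^+ 2 := sqr_ge0 _.
    lra.
  rewrite normcM normc_real ger0_norm ?divr_ge0 //.
  rewrite -ler_sqr ?nnegrE ?mulr_ge0 ?divr_ge0 ?normc_ge0 //.
  rewrite exprMn normc_sqr ReD ImD /= addr0.
  have : normc z ^+ 2 <= 1 by rewrite expr_le1 ?normc_ge0.
  rewrite normc_sqr sqrrD; lra.
Qed.

(** Tensor products multiply normalized traces and add multiplicative defects, so each induction
    step halves the tolerance. *)
Lemma hyperlinear_trace_pow : hyperlinear R G ->
  forall (n : nat) (F : seq G) (e : R), 0 < e ->
  exists (d : nat) (phi : G -> 'M[C]_d), [/\ (0 < d)%N,
    forall g, phi g \is unitarymx,
    {in F &, forall g h, hs_norm (phi g *m phi h - phi (g * h)%g) <= e} &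
    {in F, forall g, g != 1%g -> normc (ntrace (phi g)) <= (3 / 4) ^+ n}].
Proof.
move=> hyp; elim=> [|n IH] F e e0.
  exists 1%N, (fun=> 1%:M); split=> // [g|g h _ _|g _ _].
  - by apply/unitarymxP; rewrite tc1 mulmx1.
  - by rewrite mulmx1 subrr hs0 ltW.
  - by rewrite ntrace1 // normc1 expr0.
have e20 : 0 < e / 2 by rewrite divr_gt0.
have [d [phi [d0 phiU phiM phiT]]] := hyperlinear_trace_lt1 hyp F e20.
have [d' [phi' [d'0 phi'U phi'M phi'T]]] := IH F _ e20.
exists (d * d')%N, (fun g => phi g *t phi' g); split.
- by rewrite muln_gt0 d0.
- by move=> g; apply: tens_unitary.
- move=> g h gF hF; rewrite tensmx_mul.
  apply: le_trans (hs_tensB _ _ d0 d'0 (phiU _) _) _.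
    exact: mul_unitarymx.
  by rewrite [e]splitr; apply: lerD; [exact: phiM|exact: phi'M].
- move=> g gF g1; rewrite ntrace_tens normcM exprS.
  by apply: ler_pM; rewrite ?normc_ge0 //; [exact: phiT|exact: phi'T].
Qed.

Lemma hyperlinear_trace : hyperlinear R G ->
  forall (F : seq G) (e : R), 0 < e ->
  exists (d : nat) (phi : G -> 'M[C]_d), [/\ (0 < d)%N,
    forall g, phi g \is unitarymx,
    {in F &, forall g h, hs_norm (phi g *m phi h - phi (g * h)%g) <= e} &
    {in F, forall g, g != 1%g -> normc (ntrace (phi g)) <= e}].
Proof.
move=> hyp F e e0; have [n ne] : exists n, (3 / 4 : R) ^+ n <= e.
  have q1 : `|3 / 4 : R| < 1 by rewrite ger0_norm ?divr_ge0 //; lra.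
  have /cvgrPdist_le /(_ _ e0) /filter_ex[n] := cvg_expr q1.
  rewrite sub0r normrN => h; exists n; exact: le_trans (ler_norm _) h.
have [d [phi [d0 phiU phiM phiT]]] := hyperlinear_trace_pow hyp n F e0.
by exists d, phi; split=> // g gF g1; apply: le_trans (phiT g gF g1) ne.
Qed.

End Amplification.

(** * Foelner sets in abelian groups *)

Section FoelnerBoxes.
Context {R : realType} {A : zmodType} (S : seq A).
Local Notation r := (size S).

Definition box n : seq A :=
  undup [seq \sum_(i < r) S`_i *+ f i | f : {ffun 'I_r -> 'I_n.+1}].

Lemma boxP n a : reflect
  (exists2 g : 'I_r -> nat, forall i, (g i <= n)%N & a = \sum_(i < r) S`_i *+ g i)
  (a \in box n).
Proof.
rewrite mem_undup; apply: (iffP mapP) => [[f _ ->]|[g gn ->]].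
  by exists (fun i => f i : nat) => // i; rewrite -ltnS.
exists [ffun i => inord (g i)]; first by rewrite mem_enum.
by apply: eq_bigr => i _; rewrite ffunE inordK // ltnS.
Qed.

Lemma size_box n : (size (box n) <= n.+1 ^ r)%N.
Proof.
apply: leq_trans (size_undup _) _.
by rewrite size_map -cardE card_ffun !card_ord.
Qed.

Lemma box0 n : 0 \in box n.
Proof.
by apply/boxP; exists (fun=> 0%N) => //; rewrite big1 // => i _; rewrite mulr0n.
Qed.

Lemma boxS n a : a \in box n -> a \in box n.+1.
Proof. by move=> /boxP[g gn ->]; apply/boxP; exists g => // i; apply: leqW. Qed.

Lemma box_step n s a : s \in S -> a \in box n -> s + a \in box n.+1.
Proof.
move=> sS /boxP[g gn ->]; pose j : 'I_r := Ordinal (etrans (index_mem s S) sS).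
apply/boxP; exists (fun i => (i == j) + g i)%N => [i|].
  by case: (i == j); [rewrite add1n ltnS|rewrite add0n leqW]; rewrite ?gn.
rewrite -[in LHS](nth_index 0 sS) (bigD1 j) //= [in RHS](bigD1 j) //= eqxx mulrS addrA.
congr (_ + _); apply: eq_bigr => i /negPf ij; by rewrite ij.
Qed.

(** For [eta <= 1] and [n = (m + 1) * k], the Bernoulli inequality bounds the right side below by
    [(eta * (k + 1)) ^+ (m + 1)], of degree [m + 1] in [k] against degree [m] on the left. *)
Lemma power_beats_polynomial (m : nat) (eta : R) : 0 < eta ->
  exists n, (n.+1 ^ m)%:R < (1 + eta) ^+ n.
Proof.
move=> eta0; wlog eta1 : eta eta0 / eta <= 1 => [H|].
  have [|lt1] := leP eta 1; first exact: H.
  have [n hn] := H 1 ltr01 (lexx _); exists n; apply: lt_le_trans hn _.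
  by rewrite lerXn2r ?nnegrE ?addr_ge0 ?(ltW eta0) // lerD2l ltW.
have [k hk] : exists k : nat, (m.+1 ^ m)%:R / eta ^+ m.+1 < k.+1%:R.
  have := Num.Theory.archi_boundP (x := (m.+1 ^ m)%:R / eta ^+ m.+1).
  rewrite divr_ge0 ?exprn_ge0 ?(ltW eta0) // => /(_ isT).
  set b := Num.bound _ => hb; exists b; apply: lt_trans hb _.
  by rewrite ltr_nat.
exists (m.+1 * k)%N.
have step1 : (1 + eta) ^+ (m.+1 * k) >= (eta * k.+1%:R) ^+ m.+1.
  rewrite mulnC exprM lerXn2r ?nnegrE ?mulr_ge0 ?exprn_ge0 ?addr_ge0 ?(ltW eta0) //.
  apply: le_trans (_ : 1 + eta * k%:R <= _).
    by rewrite -[k.+1]add1n natrD mulrDr mulr1 lerD2r.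
  elim: (k) => [|j IH]; first by rewrite mulr0 addr0 expr0.
  rewrite exprSr -[j.+1]addn1 natrD mulrDr mulr1 addrA.
  apply: le_trans (ler_wpM2r _ IH); last by rewrite addr_ge0 ?(ltW eta0).
  rewrite mulrDr mulr1 lerD2l ler_peMl ?(ltW eta0) // lerDl mulr_ge0 ?(ltW eta0) //.
apply: lt_le_trans step1.
apply: le_lt_trans (_ : (m.+1 ^ m * k.+1 ^ m)%:R < _).
  rewrite ler_nat -expnMn; case: (m) => // m'; rewrite leq_exp2r //.
  by rewrite ltn_pmul2l.
rewrite ltr_pdivrMr ?exprn_gt0 // in hk.
rewrite natrM exprMn [X in _ < _ * X]exprS mulrA natrX [in X in _ * X < _]natrX.
by rewrite ltr_pM2r ?exprn_gt0 // mulrC -natrX.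
Qed.

(** Box sizes grow polynomially, so some step enlarges the box by a factor at most [1 + eta];
    elements that [s] pushes out of that box land in the difference of two consecutive boxes. *)
Lemma foelner (eta : R) : 0 < eta ->
  exists B : seq A, [/\ uniq B, B != [::] &
    {in S, forall s, (size [seq b <- B | s + b \notin B])%:R <= eta * (size B)%:R}].
Proof.
move=> eta0; have [n small] : exists n,
    (size (box n.+1))%:R <= (1 + eta) * (size (box n))%:R.
  apply: contrapT => no; have [n] := power_beats_polynomial r eta0.
  rewrite ltNge => /negP; apply.
  apply: le_trans (_ : (size (box n))%:R <= _); last by rewrite ler_nat size_box.
  elim: n => [|n IH].
    by rewrite expr0 ler1n lt0n size_eq0; apply/eqP => b0; have := box0 0; rewrite b0.
  rewrite exprS; apply: le_trans (ler_wpM2l _ IH) _; first by rewrite addr_ge0 ?ltW.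
  by rewrite leNgt; apply/negP => h; apply: no; exists n; apply: ltW.
exists (box n); split.
- exact: undup_uniq.
- by apply/eqP => b0; have := box0 n; rewrite b0.
move=> s sS /=; set L := [seq b <- box n | s + b \notin box n].
have : (size L + size (box n) <= size (box n.+1))%N.
  rewrite -(size_map (+%R s)) -size_cat; apply: uniq_leq_size.
    rewrite cat_uniq undup_uniq andbT (map_inj_uniq (@addrI _ s)) filter_uniq ?undup_uniq //=.
    apply/hasPn => b bB; apply/mapP => -[a].
    by rewrite mem_filter => /andP[/negP + _] ba; rewrite -ba.
  move=> a; rewrite mem_cat => /orP[/mapP[b]|]; last exact: boxS.
  by rewrite mem_filter => /andP[_ bB] ->; apply: box_step.
rewrite -(ler_nat R) natrD => h; have := le_trans h small; rewrite mulrDl mul1r; lra.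
Qed.

End FoelnerBoxes.

(** * Unitaries close to almost unitary matrices *)

Section Polar.
Context {R : realType}.
Local Notation C := R[i].
Local Notation toC := (real_complex R).

Lemma sandwich_mul m (P X Y : 'M[C]_m) : P \is unitarymx ->
  (P^t* *m X *m P) *m (P^t* *m Y *m P) = P^t* *m (X *m Y) *m P.
Proof.
move=> Pu; rewrite -(mulmxA (P^t*) Y P) (mulmxA (P^t* *m X *m P) (P^t*) (Y *m P)).
rewrite -(mulmxA (P^t* *m X) P (P^t*)) (unitaryK Pu) mulmx1.
by rewrite (mulmxA (P^t* *m X) Y P) -(mulmxA (P^t*) X Y).
Qed.

Lemma diag_real_mul m (f g : 'I_m -> R) :
  diag_mx (\row_k toC (f k)) *m diag_mx (\row_k toC (g k)) =
  diag_mx (\row_k toC (f k * g k)).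
Proof.
rewrite mulmx_diag; congr diag_mx; apply/rowP => k.
by rewrite !mxE toCM.
Qed.

Definition spectral_fun m (P : 'M[C]_m) (f : 'I_m -> R) : 'M[C]_m :=
  P^t* *m diag_mx (\row_k toC (f k)) *m P.

Section SpectralFunctions.
Variables (m : nat) (P : 'M[C]_m).
Hypothesis Pu : P \is unitarymx.
Implicit Types f g : 'I_m -> R.

Lemma spectral_funM f g :
  spectral_fun P f *m spectral_fun P g = spectral_fun P (fun k => f k * g k).
Proof. by rewrite /spectral_fun (sandwich_mul _ _ Pu) diag_real_mul. Qed.

Lemma spectral_fun1 : spectral_fun P (fun=> 1) = 1%:M.
Proof.
rewrite /spectral_fun (_ : diag_mx _ = 1%:M) ?mulmx1 ?unitary_adjK //.
by apply/matrixP => i j; rewrite !mxE.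
Qed.

Lemma spectral_fun_adj f : (spectral_fun P f)^t* = spectral_fun P f.
Proof.
rewrite /spectral_fun !tcM trmxCK mulmxA; congr (_ *m _ *m _).
apply/matrixP => i j; rewrite !mxE [j == i]eq_sym.
by case: eqP => [->|_]; rewrite ?mulr1n ?mulr0n ?conjC0 //; exact: conjC_toC.
Qed.

Lemma spectral_funB f g :
  spectral_fun P f - spectral_fun P g = spectral_fun P (fun k => f k - g k).
Proof.
rewrite /spectral_fun; have <- : diag_mx (\row_k toC (f k)) - diag_mx (\row_k toC (g k)) =
    diag_mx (\row_k toC (f k - g k)).
  apply/matrixP => i j; rewrite !mxE toCB.
  by case: eqP => _; rewrite ?mulr1n // !mulr0n subr0.
by rewrite (mulmxBr (P^t*)) (mulmxBl _ _ P).
Qed.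

Lemma fro_spectral_fun f : fro (spectral_fun P f) = \sum_k f k ^+ 2.
Proof.
have Pa : P^t* \is unitarymx by rewrite trmxC_unitary.
rewrite /spectral_fun (fro_unitaryr _ Pu) (fro_unitaryl _ Pa); apply: eq_bigr => k _.
rewrite (bigD1 k) //= big1 => [|j /negPf jk]; rewrite !mxE ?eqxx.
  by rewrite mulr1n normc_real real_normK ?num_real // addr0.
by rewrite [k == j]eq_sym jk mulr0n normc0 expr0n.
Qed.

Lemma hs_sub_spectral_fun f :
  hs_norm (1%:M - spectral_fun P f) = Num.sqrt ((\sum_k (1 - f k) ^+ 2) / m%:R).
Proof.
by rewrite -spectral_fun1 spectral_funB hs_normE /hs2 fro_spectral_fun.
Qed.

End SpectralFunctions.

(** [V] is the unitary part of the polar decomposition. In terms of the singular values [s] the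
    claim is [|1 - s| <= |1 - s^2|], valid for [s >= 0]. *)
Lemma polar_unitmx m (X : 'M[C]_m) : X \in unitmx ->
  exists2 V : 'M[C]_m, V \is unitarymx &
    hs_norm (V - X) <= hs_norm (1%:M - X^t* *m X).
Proof.
move=> Xu; set A := X^t* *m X.
have Ah : A^t* = A by rewrite tcM trmxCK.
have Apos (u : 'rV[C]_m) : 0 <= (u *m A *m u^t*) 0 0.
  have -> : u *m A *m u^t* = (X *m u^t*)^t* *m (X *m u^t*).
    by rewrite tcM trmxCK !mulmxA.
  rewrite mxE; apply: sumr_ge0 => k _.
  by rewrite [(_ ^ _) _ _]mxE [(_^T) _ _]mxE mulrC -toC_normc_sqr ler0c sqr_ge0.
have [P [d [Pu d0 AE]]] := psd_spectral Ah Apos.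
have Au : A \in unitmx by rewrite unitmx_mul Xu andbT map_unitmx unitmx_tr.
have d_neq0 k : d k != 0.
  apply/eqP => dk; move: Au; rewrite unitmxE AE !det_mulmx det_diag unitfE.
  by rewrite (bigD1 k) //= mxE dk mul0r mulr0 mul0r eqxx.
have d_gt0 k : 0 < d k by rewrite lt_def d_neq0 d0.
pose s (k : 'I_m) : R := Num.sqrt (d k).
have sq : (fun k => s k ^+ 2) = d by apply/funext => k; rewrite sqr_sqrtr.
have s_neq0 k : s k != 0 by rewrite gt_eqF // sqrtr_gt0.
have {}AE : A = spectral_fun P (fun k => s k ^+ 2) by rewrite sq.
have sV : (fun k => (s k)^-1 * s k) = (fun=> 1) by apply/funext => k; rewrite mulVf.
pose V := X *m spectral_fun P (fun k => (s k)^-1).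
have XV : X = V *m spectral_fun P s.
  by rewrite /V -mulmxA (spectral_funM Pu) sV (spectral_fun1 Pu) mulmx1.
have Vu : V \is unitarymx.
  rewrite -trmxC_unitary; apply/unitarymxP.
  rewrite trmxCK tcM spectral_fun_adj -mulmxA [X^t* *m _]mulmxA.
  rewrite -/A AE !(spectral_funM Pu) -(spectral_fun1 Pu); congr (spectral_fun P _).
  by apply/funext => k /=; rewrite expr2 mulfK // mulVf.
exists V; first exact: Vu.
have -> : hs_norm (V - X) = Num.sqrt ((\sum_k (1 - s k) ^+ 2) / m%:R).
  rewrite -(hs_sub_spectral_fun Pu) -[RHS](hs_unitaryl _ Vu).
  by rewrite mulmxBr mulmx1 -XV.
rewrite AE (hs_sub_spectral_fun Pu _).
apply: ler_wsqrtr; apply: ler_wpM2r; first by rewrite invr_ge0.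
apply: ler_sum => k _.
have s0 : 0 <= s k := sqrtr_ge0 _.
have -> : 1 - s k ^+ 2 = (1 - s k) * (1 + s k) by ring.
rewrite exprMn ler_peMr ?sqr_ge0 //; have := sqr_ge0 (s k); rewrite sqrrD; lra.
Qed.

(** The characteristic polynomial has at most [m] roots, so one of [m + 1] distinct small shifts is
    invertible. *)
Lemma shift_unitmx m (X : 'M[C]_m) (e : R) : 0 < e ->
  exists s : R, [/\ 0 < s, s <= e & X + (toC s)%:M \in unitmx].
Proof.
move=> e0; apply: contrapT => no.
pose s k : R := e * harmonic k.
have s0 k : 0 < s k by rewrite mulr_gt0 ?harmonic_gt0.
have s_le k : s k <= e by rewrite ler_piMr ?(ltW e0) // invf_le1 ?ler1n.
pose rs := [seq - toC (s k) | k <- iota 0 m.+1].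
have p0 : char_poly X != 0 by rewrite monic_neq0 ?char_poly_monic.
have allr : all (root (char_poly X)) rs.
  apply/allP => _ /mapP[k _ ->]; rewrite -eigenvalue_root_char /eigenvalue /eigenspace.
  rewrite kermx_eq0 row_free_unit raddfN opprK; apply/negP => h.
  by apply: no; exists (s k).
have urs : uniq rs.
  rewrite map_inj_uniq ?iota_uniq // => k l /oppr_inj /toC_inj /mulfI.
  move=> /(_ (lt0r_neq0 e0)) /invr_inj /eqP; rewrite eqr_nat => /eqP [].
  by [].
have := max_poly_roots p0 allr urs.
by rewrite size_map size_iota size_char_poly ltnn.
Qed.

(* Perturb [X] to an invertible matrix and take the unitary part of its polar
   decomposition. *)
Lemma near_unitary m (X : 'M[C]_m) (e : R) : (0 < m)%N -> 0 < e ->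
  exists2 V : 'M[C]_m, V \is unitarymx &
    hs_norm (V - X) <= hs_norm (1%:M - X^t* *m X) + e.
Proof.
have arith1 (u v : R) : 0 <= u -> u <= 1 -> u * v + u * v + u * u <= u * (2 * v + 1).
  by move=> u0 u1; have uu : u * u <= u; [by rewrite ler_piMl|lra].
have arith2 (u v y t : R) : y <= t + u * (2 * v + 1) -> u * (2 * v + 2) <= e ->
  y + u <= t + e by lra.
move=> m0 e0; set x := hs_norm X; have x0 : 0 <= x := hs_ge0 _.
pose dl := Num.min 1 (e / (2 * x + 2)).
have den : 0 < 2 * x + 2 by lra.
have dl0 : 0 < dl by rewrite lt_min ltr01 divr_gt0.
have [s [s0 s_le su]] := shift_unitmx X dl0.
have s1 : s <= 1 by apply: le_trans s_le _; rewrite ge_min lexx.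
have se : s * (2 * x + 2) <= e.
  by rewrite -ler_pdivlMr //; apply: le_trans s_le _; rewrite ge_min lexx orbT.
have [V Vu VX] := polar_unitmx su; exists V => //.
set Y := X + _ in su VX.
have hsM : hs_norm ((toC s)%:M : 'M[C]_m) = s.
  by rewrite -[_%:M]scalemx1 hsZ hs1 // mulr1 normc_real gtr0_norm.
have h1 : hs_norm (Y - X) = s by rewrite /Y addrC addKr hsM.
have h2 : hs_norm (1%:M - Y^t* *m Y) <= hs_norm (1%:M - X^t* *m X) + s * (2 * x + 1).
  have -> : 1%:M - Y^t* *m Y =
      (1%:M - X^t* *m X) - (toC s *: X + toC s *: X^t* + (toC s * toC s)%:M).
    rewrite /Y tcD mulmxDl !mulmxDr -[(_%:M)^t*]/(_^t*) tr_scalar_mx map_scalar_mx /= conjC_toC.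
    rewrite mul_scalar_mx mul_mx_scalar -scalar_mxM -!addrA; congr (_ + _).
    have gen (x1 x2 x3 x4 : 'M[C]_m) :
        - (x1 + (x2 + (x3 + x4))) = - x1 - (x3 + (x2 + x4)).
      by apply/matrixP => i j; rewrite !mxE; ring.
    exact: gen.
  apply: le_trans (hs_triangle _ _) _; rewrite lerD2l hsN.
  apply: le_trans (hs_triangle _ _) _; rewrite -toCM.
  have -> : hs_norm ((toC (s * s))%:M : 'M[C]_m) = s * s.
    by rewrite -[_%:M]scalemx1 hsZ hs1 // mulr1 normc_real ger0_norm // mulr_ge0 // ltW.
  apply: le_trans (lerD (hs_triangle _ _) (lexx _)) _.
  rewrite !hsZ hs_adj normc_real gtr0_norm // -/x.
  apply: arith1 => //; exact: ltW.
apply: le_trans (hs_trans Y _ _) _; rewrite h1.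
exact: arith2 (le_trans VX h2) se.
Qed.

End Polar.

(** * Compression to coordinate subspaces and to the region below a graph *)

Section Selection.
Context {R : realType} {D : nat} (I : {set 'I_D}).
Local Notation C := R[i].

Definition sel : 'M[C]_(D, #|I|) := \matrix_(a, b) (a == enum_val b)%:R.

Lemma mul_selE p (Z : 'M[C]_(p, D)) i b : (Z *m sel) i b = Z i (enum_val b).
Proof.
rewrite mxE (bigD1 (enum_val b)) //= big1 => [|a /negPf ab]; rewrite mxE.
  by rewrite eqxx mulr1 addr0.
by rewrite ab mulr0.
Qed.

Lemma fro_mul_sel p (Z : 'M[C]_(p, D)) :
  fro (Z *m sel) = \sum_i \sum_(y in I) normc (Z i y) ^+ 2.
Proof.
apply: eq_bigr => i _; rewrite [RHS]big_enum_val; apply: eq_bigr => b _.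
by rewrite mul_selE.
Qed.

Lemma fro_mul_sel_le p (Z : 'M[C]_(p, D)) : fro (Z *m sel) <= fro Z.
Proof.
rewrite fro_mul_sel; apply: ler_sum => i _.
by rewrite [leRHS](bigID (mem I)) /= lerDl sumr_ge0 // => y _; rewrite sqr_ge0.
Qed.

Lemma fro_adj_sel_le p (Z : 'M[C]_(D, p)) : fro (sel^t* *m Z) <= fro Z.
Proof.
by rewrite -fro_adj tcM trmxCK -[leRHS]fro_adj; exact: fro_mul_sel_le.
Qed.

Lemma sel_isometry : sel^t* *m sel = 1%:M.
Proof.
apply/matrixP => a b; rewrite mul_selE !mxE (inj_eq enum_val_inj) eq_sym.
by case: (a == b); rewrite ?conjC1 ?conjC0.
Qed.

Lemma fro_mul_adj_sel p (X : 'M[C]_(p, #|I|)) : fro (X *m sel^t*) = fro X.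
Proof.
apply: toC_inj; rewrite -fro_adj -(fro_adj X) -!tr_fro !trmxCK tcM !trmxCK.
by rewrite -mulmxA [sel^t* *m _]mulmxA sel_isometry mul1mx.
Qed.

Lemma sel_proj p (Z : 'M[C]_(D, p)) x b :
  (sel *m sel^t* *m Z) x b = Z x b *+ (x \in I).
Proof.
case: (boolP (x \in I)) => xI.
  rewrite -mulmxA mxE (bigD1 (enum_rank_in xI x)) //= big1 => [|k kx].
    rewrite mxE enum_rankK_in // eqxx mul1r addr0 mulr1n.
    rewrite mxE (bigD1 x) //= big1 => [|y /negPf yx]; rewrite !mxE enum_rankK_in //.
      by rewrite eqxx conjC1 mul1r addr0.
    by rewrite yx conjC0 mul0r.
  rewrite mxE; case: eqP => [xk|_]; last by rewrite mul0r.
  by case/eqP: kx; apply: enum_val_inj; rewrite enum_rankK_in //.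
rewrite -mulmxA mxE big1 ?mulr0n // => k _; rewrite mxE.
case: eqP => [xk|_]; last by rewrite mul0r.
by move: xI; rewrite xk enum_valP.
Qed.

Definition compress (Z : 'M[C]_D) : 'M[C]_#|I| := sel^t* *m Z *m sel.

Lemma compress1 : compress 1%:M = 1%:M.
Proof. by rewrite /compress mulmx1 sel_isometry. Qed.

Lemma compressB Z W : compress (Z - W) = compress Z - compress W.
Proof. by rewrite /compress mulmxBr mulmxBl. Qed.

Lemma compressZ (a : C) Z : compress (a *: Z) = a *: compress Z.
Proof. by rewrite /compress -scalemxAr -scalemxAl. Qed.

Lemma compress_adj Z : (compress Z)^t* = compress (Z^t*).
Proof. by rewrite /compress !tcM trmxCK mulmxA. Qed.

Lemma trace_compress Z : \tr (compress Z) = \sum_(x in I) Z x x.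
Proof.
rewrite [RHS]big_enum_val; apply: eq_bigr => b _; rewrite mul_selE mxE.
rewrite (bigD1 (enum_val b)) //= big1 => [|a /negPf ab]; rewrite !mxE.
  by rewrite eqxx conjC1 mul1r addr0.
by rewrite ab conjC0 mul0r.
Qed.

Lemma fro_compress_le Z :
  fro (compress Z) <= \sum_x \sum_(y in I) normc (Z x y) ^+ 2.
Proof.
by rewrite /compress -mulmxA -fro_mul_sel; exact: fro_adj_sel_le.
Qed.

Lemma fro_mul_compress p (X : 'M[C]_(p, #|I|)) U : U \is unitarymx ->
  fro (X *m compress U) <= fro X.
Proof.
move=> Uu; rewrite /compress !mulmxA; apply: le_trans (fro_mul_sel_le _) _.
by rewrite (fro_unitaryr _ Uu) fro_mul_adj_sel.
Qed.

(** With [p] the coordinate projection, the defect is the compression of [U (1 - p) Z p]; only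
    entries of [Z] leading out of [I] are lost. *)
Lemma compress_defect U Z : U \is unitarymx ->
  fro (compress U *m compress Z - compress (U *m Z)) <=
  \sum_(x | x \notin I) \sum_(y in I) normc (Z x y) ^+ 2.
Proof.
move=> Uu; pose W := Z *m sel - sel *m sel^t* *m (Z *m sel).
have -> : compress U *m compress Z - compress (U *m Z) = - (sel^t* *m (U *m W)).
  by rewrite /W !mulmxBr opprB /compress !mulmxA.
rewrite -scaleN1r (_ : fro _ = fro (sel^t* *m (U *m W))); last first.
  by do 2!(apply: eq_bigr => ? _); rewrite !mxE mulN1r normcN.
apply: le_trans (fro_adj_sel_le _) _; rewrite (fro_unitaryl _ Uu).
rewrite big_mkcond /=; apply: ler_sum => x _; rewrite [X in if _ then X else _]big_enum_val.
have WE b : W x b = Z x (enum_val b) *+ (x \notin I).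
  rewrite mxE [X in _ + X]mxE sel_proj mul_selE; case: (x \in I) => /=.
    by rewrite mulr1n subrr.
  by rewrite mulr0n subr0.
case: (boolP (x \in I)) WE => xI WE.
  by rewrite big1 // => b _; rewrite WE mulr0n normc0 expr0n.
by apply: ler_sum => b _; rewrite WE mulr1n.
Qed.

End Selection.

Section SpectralStaircase.
Context {R : realType}.
Local Notation C := R[i].
Local Notation toC := (real_complex R).

Lemma sum_normc_mul_le d (X Y : 'M[C]_d) : (0 < d)%N ->
  \sum_j \sum_k normc (X j k) * normc (Y j k) <= d%:R * (hs_norm X * hs_norm Y).
Proof.
move=> d0; pose a (Z : 'M[C]_d) := \matrix_(j, k) toC (normc (Z j k)).
have ha Z : hs_norm (a Z) = hs_norm Z.
  rewrite !hs_normE /hs2; congr (Num.sqrt (_ / _)).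
  by do 2!(apply: eq_bigr => ? _); rewrite mxE normc_real ger0_norm ?normc_ge0.
have dR : (0 : R) < d%:R by rewrite ltr0n.
have := ntrace_CauchySchwarz (a X) (a Y); rewrite !ha ntraceE tr_adj_mul.
rewrite normcM normc_real ger0_norm ?invr_ge0 ?ler0n // ler_pdivrMl //.
apply: le_trans; apply: le_trans (Re_le_normc _).
rewrite raddf_sum; apply: ler_sum => j _; rewrite raddf_sum; apply: ler_sum => k _.
by rewrite !mxE conjC_toC -toCM.
Qed.

Lemma sum_interval (V : nmodType) (x : V) (L p q : nat) : (q <= L)%N ->
  \sum_(l < L | (p <= l)%N && (l < q)%N) x = x *+ (q - p).
Proof.
move=> qL; rewrite -[RHS]sumr_const_nat (big_nat_widenl _ _ _ _ _ (leq0n p)).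
by rewrite (big_nat_widen _ _ _ _ _ qL) big_mkord.
Qed.

Section Staircase.
Variables (d : nat) (t : 'I_d -> R) (M : nat).
Hypothesis t_ge0 : forall j, 0 <= t j.

Definition step (j : 'I_d) : nat := Num.truncn (M%:R * t j).

Definition height : nat := \sum_j step j.

(* The region below the graph of [M * t]: compressing [X *t 1] to it
   approximates the compression of [X] to a fractional eigenspace of the matrix
   [diag t] by an honest corner of a matrix algebra. *)
Definition stairs : {set 'I_(d * height)} :=
  [set x | ((mxtens_unindex x).2 < step (mxtens_unindex x).1)%N].

Lemma step_height j : (step j <= height)%N.
Proof. by rewrite /height (bigD1 j) //= leq_addr. Qed.

Lemma step_le j : (step j)%:R <= M%:R * t j.
Proof. by have /andP[] := truncn_itv (mulr_ge0 (ler0n R M) (t_ge0 j)). Qed.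

Lemma step_gt j : M%:R * t j < (step j)%:R + 1.
Proof.
by have /andP[_] := truncn_itv (mulr_ge0 (ler0n R M) (t_ge0 j)); rewrite -addn1 natrD.
Qed.

Lemma step_sub_le j k : (step k - step j)%:R <= M%:R * `|t j - t k| + 1.
Proof.
have [kj|jk] := leqP (step k) (step j).
  by rewrite (eqP kj : (_ - _)%N = 0%N) addr_ge0 // mulr_ge0.
rewrite natrB ?(ltnW jk) //; have := step_le k; have := step_gt j.
have : M%:R * (t k - t j) <= M%:R * `|t j - t k| by rewrite ler_wpM2l // distrC ler_norm.
by rewrite mulrBr; lra.
Qed.

Lemma sum_stairs (V : nmodType) (P : pred bool) (F : 'I_d -> 'I_height -> V) :
  \sum_(x | P (x \in stairs)) F (mxtens_unindex x).1 (mxtens_unindex x).2 =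
  \sum_j \sum_(l < height | P (l < step j)%N) F j l.
Proof.
rewrite big_mkcond sum_tens; apply: eq_bigr => j _; rewrite [RHS]big_mkcond.
by apply: eq_bigr => l _; rewrite inE mxtens_indexK.
Qed.

Definition stair (X : 'M[C]_d) : 'M[C]_#|stairs| :=
  compress stairs (X *t (1%:M : 'M[C]_height)).

Lemma stairE (X : 'M[C]_d) (x y : 'I_(d * height)) :
  (X *t (1%:M : 'M[C]_height)) x y =
  X (mxtens_unindex x).1 (mxtens_unindex y).1
    *+ ((mxtens_unindex x).2 == (mxtens_unindex y).2).
Proof.
case: (mxtens_indexP x) => i j; case: (mxtens_indexP y) => k l.
by rewrite tensmxE !mxtens_indexK mxE; case: eqP => _; rewrite ?mulr1 ?mulr0.
Qed.

Lemma card_stairs : #|stairs| = height.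
Proof.
rewrite -sum1_card (sum_stairs id (fun=> fun=> 1%N)) /height.
apply: eq_bigr => j _; rewrite (sum_interval 1%N 0 (step_height j)) subn0.
exact: natn.
Qed.

Lemma trace_stair X : \tr (stair X) = \sum_j X j j *+ step j.
Proof.
rewrite trace_compress; under eq_bigr do rewrite stairE eqxx mulr1n.
rewrite (sum_stairs id (fun j _ => X j j)); apply: eq_bigr => j _.
by rewrite -[step j in RHS]subn0 -(sum_interval _ _ (step_height j)).
Qed.

Lemma sum_stairs_normc (X : 'M[C]_d) (P : pred bool) :
  \sum_(x | P (x \in stairs)) \sum_(y in stairs)
     normc ((X *t (1%:M : 'M[C]_height)) x y) ^+ 2 =
  \sum_j \sum_k \sum_(l < height | P (l < step j)%N && (l < step k)%N)
     normc (X j k) ^+ 2.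
Proof.
under eq_bigr => x _.
  under eq_bigr do rewrite stairE.
  have := sum_stairs id (fun k l => normc (X (mxtens_unindex x).1 k
    *+ ((mxtens_unindex x).2 == l)) ^+ 2).
  move=> ->; over.
rewrite (sum_stairs P (fun j l => \sum_k \sum_(l' < height | (l' < step k)%N)
  normc (X j k *+ (l == l')) ^+ 2)).
apply: eq_bigr => j _; rewrite exchange_big; apply: eq_bigr => k _ /=.
rewrite [RHS]big_mkcondr; apply: eq_bigr => l _; rewrite big_mkcond (bigD1 l) //=.
rewrite eqxx mulr1n big1 ?addr0 // => l' /negPf l'l; rewrite eq_sym l'l mulr0n.
by rewrite normc0 expr0n; case: ifP.
Qed.

Lemma fro_stair_le X :
  fro (stair X) <= \sum_j \sum_k M%:R * t k * normc (X j k) ^+ 2.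
Proof.
apply: le_trans (fro_compress_le _ _) _.
rewrite (sum_stairs_normc X predT); apply: ler_sum => j _; apply: ler_sum => k _.
rewrite (sum_interval _ 0 (step_height k)) subn0 -[leLHS]mulr_natl.
by rewrite ler_wpM2r ?sqr_ge0 ?step_le.
Qed.

(** The entry [X j k] leaves the region exactly on the levels from [step j] up to [step k]; the
    truncated subtraction counts them, and the [+ 1] is the rounding of the heights. *)
Lemma stair_defect U X : U \is unitarymx ->
  fro (stair U *m stair X - stair (U *m X)) <=
  \sum_j \sum_k (M%:R * `|t j - t k| + 1) * normc (X j k) ^+ 2.
Proof.
move=> Uu; rewrite /stair -[U *m X]/(U *m X) -[X in _ - compress _ (_ *t X)](mulmx1 1%:M).
rewrite -tensmx_mul; apply: le_trans (compress_defect _ _ _) _.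
  by apply: tens_unitary => //; apply/unitarymxP; rewrite tc1 mulmx1.
rewrite (sum_stairs_normc X negb); apply: ler_sum => j _; apply: ler_sum => k _.
under eq_bigl do rewrite -leqNgt.
rewrite (sum_interval _ _ (step_height k)) -[leLHS]mulr_natl.
by rewrite ler_wpM2r ?sqr_ge0 ?step_sub_le.
Qed.

End Staircase.

End SpectralStaircase.

Section Corner.
Context {R : realType}.
Local Notation C := R[i].
Local Notation toC := (real_complex R).
Local Notation Re := (@complex.Re R).

Lemma unitary_entry_le d (U : 'M[C]_d) j k : U \is unitarymx -> normc (U j k) <= 1.
Proof.
move=> Uu; rewrite -(@expr_le1 _ 2) ?normc_ge0 //.
have -> : (1 : R) = \sum_l normc (U j l) ^+ 2.
  apply: toC_inj; have /(congr1 (fun X : 'M[C]_d => X j j)) := unitaryK Uu.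
  rewrite !mxE eqxx mulr1n => h; rewrite (rmorph1 toC) -h rmorph_sum; apply: eq_bigr => l _.
  by rewrite !mxE -toC_normc_sqr.
by rewrite (bigD1 k) //= lerDl sumr_ge0 // => l _; rewrite sqr_ge0.
Qed.

Lemma fro_unitary d (U : 'M[C]_d) : U \is unitarymx -> fro U = d%:R.
Proof.
by move=> Uu; apply: toC_inj; rewrite -tr_fro unitary_adjK // mxtrace1 rmorph_nat.
Qed.

Section Rotation.
Variables (d : nat) (P : 'M[C]_d).
Hypothesis Pu : P \is unitarymx.

Definition rotate (X : 'M[C]_d) := P *m X *m P^t*.

Lemma rotateM X Y : rotate (X *m Y) = rotate X *m rotate Y.
Proof.
rewrite /rotate -(mulmxA (P *m X) (P^t*) (P *m Y *m P^t*)).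
rewrite (mulmxA (P^t*) (P *m Y) (P^t*)) (mulmxA (P^t*) P Y).
by rewrite (unitary_adjK Pu) mul1mx !mulmxA.
Qed.

Lemma rotateK X : rotate (P^t* *m X *m P) = X.
Proof.
rewrite /rotate (mulmxA P (P^t* *m X) P) (mulmxA P (P^t*) X) (unitaryK Pu) mul1mx.
by rewrite -mulmxA (unitaryK Pu) mulmx1.
Qed.

Lemma rotateB X Y : rotate (X - Y) = rotate X - rotate Y.
Proof. by rewrite /rotate mulmxBr mulmxBl. Qed.

Lemma rotate_adj X : rotate (X^t*) = (rotate X)^t*.
Proof. by rewrite /rotate !tcM trmxCK mulmxA. Qed.

Lemma rotate_unitary X : X \is unitarymx -> rotate X \is unitarymx.
Proof.
move=> Xu; apply: mul_unitarymx; first exact: mul_unitarymx Pu Xu.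
exact: etrans (trmxC_unitary P) Pu.
Qed.

Lemma tr_rotate X : \tr (rotate X) = \tr X.
Proof. by rewrite /rotate mxtrace_mulC mulmxA (unitary_adjK Pu) mul1mx. Qed.

Lemma hs_rotate X : hs_norm (rotate X) = hs_norm X.
Proof.

have Pa : P^t* \is unitarymx := etrans (trmxC_unitary P) Pu.
by rewrite /rotate (hs_unitaryr _ Pa) (hs_unitaryl _ Pu).
Qed.

End Rotation.

(** Computed in an eigenbasis of [z] with eigenvalues [t]: the numbers [|t j - t k| * |X j k|] are
    the moduli of the entries of the commutator of [z] and [X], and Cauchy-Schwarz against the
    remaining factor [|X j k|] gives an error linear in its norm. The summands without [M] come from
    rounding and become negligible as [M] grows. *)
Lemma corner d (z : 'M[C]_d) (M : nat) : (0 < d)%N -> z^t* = z ->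
  (forall u : 'rV[C]_d, 0 <= (u *m z *m u^t*) 0 0) ->
  exists (m : nat) (c : 'M[C]_d -> 'M[C]_m),
  [/\ c 1%:M = 1%:M, forall X Y, c (X - Y) = c X - c Y,
      forall a X, c (a *: X) = a *: c X & forall X, (c X)^t* = c (X^t*)] /\
  [/\ M%:R * Re (\tr z) - d%:R <= m%:R,
      forall U X, U \is unitarymx -> X \is unitarymx ->
        fro (c U *m c X - c (U *m X)) <=
        d%:R * (M%:R * hs_norm (z *m X - X *m z) + 1),
      forall (X : 'M[C]_m) U, U \is unitarymx -> fro (X *m c U) <= fro X,
      forall X, fro (c X) <= M%:R * Re (\tr (X *m z *m X^t*)) &
      forall U, U \is unitarymx -> normc (\tr (c U) - M%:R * \tr (z *m U)) <= d%:R].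
Proof.
move=> d0 zh zpos; have [P [t [Pu t0 zE]]] := psd_spectral zh zpos.

set T := diag_mx _ in zE.
have rotz : rotate P z = T by rewrite zE rotateK.
have rotM := rotateM Pu; have rotU X := @rotate_unitary _ _ Pu X.
have TX (X : 'M[C]_d) j k : (T *m X) j k = toC (t j) * X j k.
  by rewrite mul_diag_mx !mxE.
have XT (X : 'M[C]_d) j k : (X *m T) j k = X j k * toC (t k).
  by rewrite mul_mx_diag !mxE.
have dE : d%:R = \sum_(j < d) 1 :> R by rewrite sumr_const card_ord.
pose c X := stair t M (rotate P X).
exists #|stairs t M|, c; split; split.
- rewrite /c /stair (_ : rotate P _ = 1%:M) ?tens11 ?compress1 //.
  by rewrite /rotate mulmx1 unitaryK.
- move=> X Y; rewrite /c rotateB /stair -compressB; congr (compress _ _).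
  by apply/matrixP => a b; rewrite !mxE mulrBl.
- move=> a X; rewrite /c /stair -compressZ; congr (compress _ _).
  by rewrite /rotate -scalemxAr -scalemxAl; apply/matrixP => k l; rewrite !mxE mulrA.
- by move=> X; rewrite /c /stair compress_adj tc_tens tc1 rotate_adj.
- rewrite card_stairs /height natr_sum -(tr_rotate Pu) rotz mxtrace_diag raddf_sum mulr_sumr.
  rewrite dE -sumrB; apply: ler_sum => j _.
  by rewrite mxE /=; have := step_gt M t0 j; lra.
- move=> U X Uu Xu; rewrite /c rotM.
  apply: le_trans (stair_defect _ t0 _ (rotU _ Uu)) _.
  have Xu' := rotU _ Xu.
  have hs_comm : hs_norm (z *m X - X *m z) =
      hs_norm (T *m rotate P X - rotate P X *m T).
    by rewrite -[LHS](hs_rotate Pu) rotateB !rotM rotz.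
  set X' := rotate P X in Xu' hs_comm *.
  have := sum_normc_mul_le (T *m X' - X' *m T) X' d0.
  rewrite (hs_unitary d0 Xu') mulr1 -hs_comm => h.
  apply: le_trans (_ : M%:R * (\sum_j \sum_k
    normc ((T *m X' - X' *m T) j k) * normc (X' j k)) + fro X' <= _); last first.
    rewrite (fro_unitary Xu') mulrDr mulr1 lerD2r mulrCA.
    exact: ler_wpM2l.
  rewrite /fro mulr_sumr -big_split; apply: ler_sum => j _ /=.
  rewrite mulr_sumr -big_split; apply: ler_sum => k _ /=.
  have -> : (T *m X' - X' *m T) j k = toC (t j - t k) * X' j k.
    rewrite mxE [X in _ + X]mxE TX XT toCB.
    by rewrite mulrBl [toC (t k) * _]mulrC.
  by rewrite normcM normc_real mulrDl mul1r -!mulrA -expr2.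
- move=> X U Uu; rewrite /c /stair; apply: fro_mul_compress.
  apply: tens_unitary (rotU _ Uu) _; apply/unitarymxP.
  by rewrite tc1 mulmx1.
- move=> X; apply: le_trans (fro_stair_le _ t0 _) _.
  rewrite -(tr_rotate Pu) rotM rotM rotz rotate_adj.
  move: (rotate P X) => Y; rewrite /mxtrace raddf_sum mulr_sumr.
  apply: ler_sum => j _; rewrite mxE raddf_sum mulr_sumr; apply: ler_sum => k _ /=.
  rewrite XT [(_ ^ _) _ _]mxE [(_^T) _ _]mxE [X in complex.Re X]mulrAC -toC_normc_sqr -toCM /=.
  by rewrite -mulrA [t k * _]mulrC.
- move=> U Uu; rewrite trace_stair -[\tr (z *m U)](tr_rotate Pu) rotM rotz.
  rewrite /mxtrace mulr_sumr -sumrB; apply: le_trans (ler_normc_sum _ _ _) _.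
  rewrite dE; apply: ler_sum => j _.
  have -> : rotate P U j j *+ step t M j - M%:R * (T *m rotate P U) j j =
      toC ((step t M j)%:R - M%:R * t j) * rotate P U j j.
    rewrite TX toCB toCM !rmorph_nat mulrBl mulrA; congr (_ - _).
    by rewrite mulr_natl.
  rewrite normcM normc_real -[leRHS]mulr1; apply: ler_pM; rewrite ?normc_ge0 //.
    by rewrite ler_norml; have := step_le M t0 j; have := step_gt M t0 j; lra.
  exact: unitary_entry_le (rotU _ Uu).
Qed.

End Corner.

(** * Averages of almost orthogonal unitaries *)

Section UnitaryCombinations.
Context {R : realType} {d : nat} {B : eqType}.
Local Notation C := R[i].
Local Notation toC := (real_complex R).
Variables (u : B -> 'M[C]_d) (c : B -> C).
Hypothesis uU : forall b, u b \is unitarymx.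
Hypothesis c1 : forall b, normc (c b) = 1.

Definition combination (D : seq B) : 'M[C]_d := \sum_(b <- D) c b *: u b.

Lemma hs_combination_mul_le D X k :
  (forall b, b \in D -> hs_norm (u b *m X) <= k) ->
  hs_norm (combination D *m X) <= (size D)%:R * k.
Proof.
move=> h; rewrite /combination mulmx_suml; apply: le_trans (hs_sum _ _) _.
rewrite -sum1_size natr_sum mulr_suml !big_seq; apply: ler_sum => b bD.
by rewrite -scalemxAl hsZ c1 !mul1r; exact: h.
Qed.

Lemma hs_combination_mul D X : hs_norm (combination D *m X) <= (size D)%:R * hs_norm X.
Proof. by apply: hs_combination_mul_le => b _; rewrite (hs_unitaryl _ (uU b)). Qed.

Lemma hs_mul_combination D X : hs_norm (X *m combination D) <= (size D)%:R * hs_norm X.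
Proof.
rewrite /combination mulmx_sumr; apply: le_trans (hs_sum _ _) _.
rewrite -sum1_size natr_sum mulr_suml; apply: ler_sum => b _.
by rewrite -scalemxAr hsZ c1 !mul1r (hs_unitaryr _ (uU b)).
Qed.

Lemma hs_combination_commutator D X k :
  (forall b, b \in D -> hs_norm (u b *m X - X *m u b) <= k) ->
  hs_norm (combination D *m X - X *m combination D) <= (size D)%:R * k.
Proof.
move=> h; rewrite /combination mulmx_suml mulmx_sumr -sumrB.
apply: le_trans (hs_sum _ _) _; rewrite -sum1_size natr_sum mulr_suml !big_seq.
apply: ler_sum => b bD; rewrite -scalemxAl -scalemxAr -scalerBr hsZ c1 !mul1r.
exact: h.
Qed.

(** Distinct unitaries are almost orthogonal for the normalized trace, so the squared norm is that
    of an orthonormal sum up to the off-diagonal terms. *)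
Lemma hs2_combination D k : (0 < d)%N -> uniq D ->
  {in D &, forall a b, a != b -> normc (ntrace ((u a)^t* *m u b)) <= k} -> 0 <= k ->
  `|hs2 (combination D) - (size D)%:R| <= (size D)%:R ^+ 2 * k.
Proof.
move=> d0 uD h k0.
have -> : `|hs2 (combination D) - (size D)%:R| =
    normc (ntrace ((combination D)^t* *m combination D) - (size D)%:R).
  by rewrite ntrace_adj_mul -(rmorph_nat toC) -toCB normc_real.
have -> : (size D)%:R = \sum_(a <- D) \sum_(b <- D) (a == b)%:R :> C.
  rewrite -sum1_size natr_sum !big_seq; apply: eq_bigr => a aD.
  rewrite (bigD1_seq a) //= eqxx big1 ?addr0 // => b /negPf ba.
  by rewrite eq_sym ba.
rewrite /combination tc_sum mulmx_suml ntrace_sum -sumrB.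
apply: le_trans (ler_normc_sum _ _ _) _.
have -> : (size D)%:R ^+ 2 * k = \sum_(a <- D) \sum_(b <- D) k.
  by rewrite !big_const_seq !count_predT !iter_addr_0 -mulrnA -[RHS]mulr_natl natrM expr2.
rewrite big_seq [leRHS]big_seq; apply: ler_sum => a aD; rewrite mulmx_sumr ntrace_sum -sumrB.
apply: le_trans (ler_normc_sum _ _ _) _; rewrite !big_seq; apply: ler_sum => b bD.
rewrite tcZ -scalemxAl -scalemxAr !ntraceZ.
have [<-|ab] := eqVneq a b.
  rewrite unitary_adjK // ntrace1 // mulr1 mulrC -toC_normc_sqr c1 expr1n.
  by rewrite rmorph1 subrr normc0.
by rewrite subr0 2!normcM normc_J !c1 !mul1r; exact: h.
Qed.

(* When [u] is an approximate representation of an abelian group, [c] a conjugate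
   character and [D] a Foelner set, [average D] is nearly central and its range
   is the approximate isotypic subspace of [c^*]. *)
Definition average (D : seq B) : 'M[C]_d :=
  toC ((size D)%:R ^- 2) *: (combination D *m (combination D)^t*).

Lemma average_adj D : (average D)^t* = average D.
Proof. by rewrite /average tcZ conjC_toC tcM trmxCK. Qed.

Lemma average_psd D (v : 'rV[C]_d) : 0 <= (v *m average D *m v^t*) 0 0.
Proof.
pose w := v *m combination D.
have -> : v *m average D *m v^t* = toC ((size D)%:R ^- 2) *: (w *m w^t*).
  by rewrite /average -scalemxAr -scalemxAl tcM !mulmxA.
rewrite mxE mulr_ge0 ?ler0c ?invr_ge0 ?sqr_ge0 //.
rewrite mxE; apply: sumr_ge0 => k _; rewrite [(_ ^ _) _ _]mxE [(_^T) _ _]mxE.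
by rewrite -toC_normc_sqr ler0c sqr_ge0.
Qed.

Lemma tr_average D X : (0 < d)%N -> complex.Re (\tr (X *m average D *m X^t*)) =
  d%:R * (size D)%:R ^- 2 * hs2 (X *m combination D).
Proof.
move=> d0; have -> : X *m average D *m X^t* =
    toC ((size D)%:R ^- 2) *: (X *m combination D *m (X *m combination D)^t*).
  by rewrite /average -scalemxAr -scalemxAl tcM !mulmxA.
rewrite linearZ /= mxtrace_mulC tr_fro -toCM /= /hs2.
set f := fro _; have dn : d%:R != 0 :> R by rewrite pnatr_eq0 -lt0n.
by rewrite [d%:R * _]mulrC -mulrA [d%:R * _]mulrCA divff // mulr1.
Qed.

Lemma average_commutator D X k : D != [::] -> X \is unitarymx ->
  (forall b, b \in D -> hs_norm (u b *m X - X *m u b) <= k) ->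
  hs_norm (average D *m X - X *m average D) <= 2 * k.
Proof.
move=> D0 Xu h; set y := combination D; set N : R := (size D)%:R.
have N0 : 0 < N by rewrite ltr0n lt0n size_eq0.
have yX : hs_norm (y *m X - X *m y) <= N * k := hs_combination_commutator h.
(* Taking the adjoint and multiplying by [X] on both sides turns one commutator into the other, up
   to sign. *)
have yXa : hs_norm (y^t* *m X - X *m y^t*) = hs_norm (y *m X - X *m y).
  rewrite -[LHS]hs_adj tcB !tcM !trmxCK -[LHS](hs_unitaryl _ Xu) -[LHS](hs_unitaryr _ Xu).
  congr hs_norm; rewrite mulmxBr mulmxBl -(mulmxA X (y *m X^t*) X).
  by rewrite -(mulmxA y) (unitary_adjK Xu) mulmx1 mulmxA (unitaryK Xu) mul1mx.
have -> : average D *m X - X *m average D = toC (N ^- 2) *: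
    (y *m (y^t* *m X - X *m y^t*) + (y *m X - X *m y) *m y^t*).
  rewrite /average -scalemxAl -scalemxAr -scalerBr; congr (_ *: _).
  by rewrite mulmxBr mulmxBl !mulmxA subrKA.
have N2 : 0 < N ^+ 2 by rewrite exprn_gt0.
have N2V : 0 <= N ^- 2 by rewrite invr_ge0 ltW.
rewrite hsZ normc_real (ger0_norm N2V) (ler_pdivrMl _ _ N2).
apply: le_trans (hs_triangle _ _) _.
have h1 := hs_combination_mul D (y^t* *m X - X *m y^t*).
have h2 : hs_norm ((y *m X - X *m y) *m y^t*) <= N * hs_norm (y *m X - X *m y).
  rewrite -[leLHS]hs_adj tcM trmxCK -(hs_adj (y *m X - X *m y)).
  exact: hs_combination_mul.
rewrite -/N -/y yXa in h1; apply: le_trans (lerD h1 h2) _.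
have h3 : N * hs_norm (y *m X - X *m y) <= N * (N * k) by rewrite ler_wpM2l // ltW.
apply: le_trans (lerD h3 h3) _.
suff -> : N * (N * k) + N * (N * k) = N ^+ 2 * (2 * k) by [].
by ring.
Qed.

Lemma tr_average_mul D X k : (0 < d)%N -> D != [::] ->
  {in D &, forall a b, normc (ntrace ((u a)^t* *m (X *m u b))) <= k} ->
  normc (\tr (average D *m X)) <= d%:R * k.
Proof.
move=> d0 D0 h; set N : R := (size D)%:R; set y := combination D.
have N0 : 0 < N by rewrite ltr0n lt0n size_eq0.
have -> : \tr (average D *m X) = toC (N ^- 2) * \tr (y^t* *m (X *m y)).
  rewrite /average -scalemxAl linearZ /=; congr (_ * _).
  by rewrite -mulmxA mxtrace_mulC mulmxA.
rewrite normcM normc_real ger0_norm ?invr_ge0 ?sqr_ge0 // ler_pdivrMl ?exprn_gt0 //.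
have -> : \tr (y^t* *m (X *m y)) = toC d%:R * ntrace (y^t* *m (X *m y)).
  by rewrite ntraceE mulrA -toCM divff ?mul1r // pnatr_eq0 -lt0n.
rewrite normcM normc_real ger0_norm ?ler0n // mulrCA ler_pM2l ?ltr0n //.
rewrite /y /combination tc_sum mulmx_suml ntrace_sum.
apply: le_trans (ler_normc_sum _ _ _) _.
have -> : N ^+ 2 * k = \sum_(a <- D) \sum_(b <- D) k.
  by rewrite !big_const_seq !count_predT !iter_addr_0 -mulrnA -[RHS]mulr_natl natrM expr2.
rewrite big_seq [leRHS]big_seq; apply: ler_sum => a aD; rewrite !mulmx_sumr ntrace_sum.
apply: le_trans (ler_normc_sum _ _ _) _; rewrite !big_seq; apply: ler_sum => b bD.
rewrite tcZ -scalemxAl -!scalemxAr !ntraceZ 2!normcM normc_J !c1 !mul1r.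
exact: h.
Qed.

End UnitaryCombinations.

Section CornerUnitary.
Context {R : realType}.
Local Notation C := R[i].
Local Notation toC := (real_complex R).
Local Notation Re := (@complex.Re R).

Lemma hs_trans4 m (X0 X1 X2 X3 X4 X5 : 'M[C]_m) (a b : R) :
  hs_norm (X0 - X1) <= a -> hs_norm (X1 - X2) <= a -> hs_norm (X2 - X3) <= b ->
  hs_norm (X3 - X4) <= b -> hs_norm (X4 - X5) <= a -> hs_norm (X0 - X5) <= 3 * a + 2 * b.
Proof.
move=> h1 h2 h3 h4 h5.
have k2 := le_trans (hs_trans X1 X0 X2) (lerD h1 h2).
have k3 := le_trans (hs_trans X2 X0 X3) (lerD k2 h3).
have k4 := le_trans (hs_trans X3 X0 X4) (lerD k3 h4).
have k5 := le_trans (hs_trans X4 X0 X5) (lerD k4 h5).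
apply: le_trans k5 _; suff -> : a + a + b + b + a = 3 * a + 2 * b by [].
ring.
Qed.

(** Each compressed matrix is replaced by a nearby unitary; almost commuting with [z] is what makes
    the compression almost unitary. The constant [K] bounds the inverse normalized trace of [z] with
    room for rounding, and converts weighted estimates of total size [d] into normalized ones of
    size [m]. In [8 * dl], three unitary replacements cost [2 * dl] each, the compression defect and
    the given defect [dl] each. *)
Lemma corner_unitary d (z : 'M[C]_d) (M : nat) (K k dl : R) :
  (0 < d)%N -> z^t* = z -> (forall u : 'rV[C]_d, 0 <= (u *m z *m u^t*) 0 0) ->
  (0 < M)%N -> 0 < K -> d%:R * (M%:R / K + 1) <= M%:R * Re (\tr z) ->
  0 <= k -> 0 < dl -> K * (k + M%:R^-1) <= dl ^+ 2 ->
  exists (m : nat) (psi : 'M[C]_d -> 'M[C]_m),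
  let near_central X := X \is unitarymx /\ hs_norm (z *m X - X *m z) <= k in
  [/\ (0 < m)%N, forall X, psi X \is unitarymx,
      forall X Y W, near_central X -> near_central Y -> near_central W ->
        K * Re (\tr ((X *m Y - W) *m z *m (X *m Y - W)^t*)) <= d%:R * dl ^+ 2 ->
        hs_norm (psi X *m psi Y - psi W) <= 8 * dl,
      forall X a s, near_central X -> 0 <= s ->
        K * Re (\tr ((X - a%:M) *m z *m (X - a%:M)^t*)) <= d%:R * s ^+ 2 ->
        hs_norm (psi X - a%:M) <= 2 * dl + s &
      forall X s, near_central X -> 0 <= s ->
        K * (d%:R + M%:R * normc (\tr (z *m X))) <= d%:R * M%:R * s ->
        normc (ntrace (psi X)) <= 2 * dl + s].
Proof.
move=> d0 zh zpos M0 K0 trz k0 dl0 Kk.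
have [m [c [[c1 cB cZ cJ] [m_ge c_defect c_contr c_fro c_tr]]]] := corner M d0 zh zpos.
have dR : (0 : R) < d%:R by rewrite ltr0n.
have MR : (0 : R) < M%:R by rewrite ltr0n.
(* The corner keeps at least the fraction [1 / K] of [d * M] dimensions. *)
have dMK : d%:R * M%:R <= K * m%:R.
  rewrite -ler_pdivrMl //; apply: le_trans m_ge; rewrite lerBrDr.
  by apply: le_trans trz; rewrite mulrDr mulr1 mulrC -mulrA.
have m0 : (0 < m)%N.
  rewrite -(ltr0n R) -(pmulr_rgt0 _ K0); apply: lt_le_trans dMK.
  by rewrite mulr_gt0.
have mR : (0 : R) < m%:R by rewrite ltr0n.
have small (W : 'M[C]_m) x s : 0 <= x -> 0 <= s -> fro W <= M%:R * x -> K * x <= d%:R * s ^+ 2 ->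
    hs_norm W <= s.
  move=> x0 s0 h1 h2; rewrite -ler_sqr ?nnegrE ?hs_ge0 // hs_sqr /hs2 ler_pdivrMr //.
  apply: le_trans h1 _; rewrite -(ler_pM2l dR) mulrCA.
  have h3 : d%:R * M%:R * x <= K * m%:R * x by rewrite ler_wpM2r.
  rewrite [M%:R * _]mulrA [M%:R * _]mulrC; apply: le_trans h3 _.
  have -> : K * m%:R * x = m%:R * (K * x) by ring.
  apply: le_trans (ler_wpM2l (ltW mR) h2) _.
  suff -> : m%:R * (d%:R * s ^+ 2) = d%:R * (s ^+ 2 * m%:R) by [].
  by ring.
have /choice[psi psiP] : forall X : 'M[C]_d, exists V : 'M[C]_m, V \is unitarymx /\
    hs_norm (V - c X) <= hs_norm (1%:M - (c X)^t* *m c X) + dl.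
  by move=> X; have [V Vu VX] := near_unitary (c X) m0 dl0; exists V.
have psiU X : psi X \is unitarymx by have [] := psiP X.
have defect X Y : X \is unitarymx -> Y \is unitarymx -> hs_norm (z *m Y - Y *m z) <= k ->
    hs_norm (c X *m c Y - c (X *m Y)) <= dl.
  move=> Xu Yu Yk; apply: (small _ (d%:R * (k + M%:R^-1))).
  - by rewrite mulr_ge0 ?addr_ge0 // ?ltW // invr_gt0.
  - exact: ltW.
  - apply: le_trans (c_defect _ _ Xu Yu) _; rewrite mulrCA ler_pM2l //.
    rewrite mulrDr divff ?gt_eqF // lerD2r ler_pM2l //.
  - by rewrite mulrCA ler_pM2l.
have psi_c X : X \is unitarymx -> hs_norm (z *m X - X *m z) <= k ->
    hs_norm (psi X - c X) <= 2 * dl.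
  move=> Xu Xk; have [_ h] := psiP X; apply: le_trans h _.
  have Xa : X^t* \is unitarymx by rewrite trmxC_unitary.
  have := defect _ _ Xa Xu Xk; rewrite (unitary_adjK Xu) c1 hsB cJ => h.
  by rewrite [2 * dl]mulr_natl mulr2n lerD2r.
have Tr_ge0 (Y : 'M[C]_d) : 0 <= Re (\tr (Y *m z *m Y^t*)).
  by have := le_trans (fro_ge0 _) (c_fro Y); rewrite pmulr_rge0.
exists m, psi; split=> //.
- move=> X Y W [Xu Xk] [Yu Yk] [Wu Wk] h.
  have e1 : hs_norm (psi X *m psi Y - psi X *m c Y) <= 2 * dl.
    by rewrite -mulmxBr (hs_unitaryl _ (psiU X)); exact: psi_c.
  have e2 : hs_norm (psi X *m c Y - c X *m c Y) <= 2 * dl.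
    rewrite -mulmxBl; apply: le_trans (psi_c _ Xu Xk).
    rewrite !hs_normE; apply: ler_wsqrtr; apply: ler_wpM2r; first by rewrite invr_ge0.
    exact: c_contr.
  have e3 := defect _ _ Xu Yu Yk.
  have e4 : hs_norm (c (X *m Y) - c W) <= dl.
    by rewrite -cB; apply: (small _ _ _ (Tr_ge0 _) (ltW dl0) (c_fro _) h).
  have e5 : hs_norm (c W - psi W) <= 2 * dl by rewrite hsB; exact: psi_c.
  apply: le_trans (hs_trans4 e1 e2 e3 e4 e5) _.
  suff -> : 3 * (2 * dl) + 2 * dl = 8 * dl by [].
  ring.
- move=> X a s [Xu Xk] s0 h; apply: le_trans (hs_trans (c X) _ _) _.
  apply: lerD; first exact: psi_c.
  have -> : a%:M = c a%:M by rewrite -[in RHS]scalemx1 cZ c1 scalemx1.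
  by rewrite -cB; apply: (small _ _ _ (Tr_ge0 _) s0 (c_fro _) h).
- move=> X s [Xu Xk] s0 h; have -> : psi X = (psi X - c X) + c X by rewrite subrK.
  rewrite ntraceD; apply: le_trans (le_normcD _ _) _; apply: lerD.
    by apply: le_trans (ntrace_le _ m0) _; exact: psi_c.
  rewrite ntraceE normcM normc_real ger0_norm ?invr_ge0 // ler_pdivrMl //.
  have h1 := c_tr X Xu; set w := normc (\tr (z *m X)) in h.
  have h2 : normc (\tr (c X)) <= d%:R + M%:R * w.
    have -> : \tr (c X) = (\tr (c X) - M%:R * \tr (z *m X)) + M%:R * \tr (z *m X).
      by rewrite subrK.
    apply: le_trans (le_normcD _ _) _; apply: lerD => //.
    by rewrite normcM -(rmorph_nat toC) normc_real ger0_norm.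
  rewrite -(ler_pM2l K0); apply: le_trans (ler_wpM2l (ltW K0) h2) _.
  by apply: le_trans h _; rewrite mulrA; exact: ler_wpM2r.
Qed.

End CornerUnitary.

(** * Construction of the twisted approximations *)

Section HyperlinearTwisted.
Context {R : realType} {A : zmodType} {G Gamma : groupType} (i : A -> G) (q : G -> Gamma).
Local Notation C := R[i].
Local Notation Re := (@complex.Re R).
Hypothesis ext : central_extension i q.

Lemma sum_shift (V : zmodType) (f : A -> V) (B : seq A) (s : A) : uniq B ->
  \sum_(b <- B) f (s + b) - \sum_(b <- B) f b =
  \sum_(b <- [seq s + b | b <- B & s + b \notin B]) f b -
  \sum_(b <- [seq b <- B | - s + b \notin B]) f b.
Proof.
move=> uB; rewrite (bigID (fun b => s + b \in B)) [X in _ - X](bigID (fun b => - s + b \in B)) /=.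
have -> : \sum_(b <- B | s + b \in B) f (s + b) = \sum_(b <- B | - s + b \in B) f b.
  rewrite -!(big_filter B) -(big_map (+%R s) predT f); apply: perm_big; apply: uniq_perm.
  - by rewrite (map_inj_uniq (@addrI _ s)) filter_uniq.
  - by rewrite filter_uniq.
  move=> b; rewrite mem_filter; apply/mapP/andP => [[a]|[sb bB]].
    by rewrite mem_filter => /andP[sa aB] ->; rewrite addKr.
  by exists (- s + b); rewrite ?mem_filter addNKr ?bB.
by rewrite big_map !big_filter opprD addrACA subrr add0r.
Qed.

(** Multiplication by [phi (i s)] shifts the sum by [s], and the conjugate weights turn the shift
    into the scalar [chi s], up to the two boundary sets on which [B] and its shift differ. *)
Lemma hs_twisted_average d (phi : G -> 'M[C]_d) (chi : A -> C) (B : seq A) (s : A) (e r : R) :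
  let u b := phi (i b) in let c b := (chi b)^* in
  unitary_char chi -> uniq B ->
  (forall b, b \in B -> hs_norm (phi (i s) *m phi (i b) - phi (i (s + b))) <= e) ->
  hs_norm (combination u c [seq s + b | b <- B & s + b \notin B]) <= r ->
  hs_norm (combination u c [seq b <- B | - s + b \notin B]) <= r ->
  hs_norm ((phi (i s) - (chi s)%:M) *m combination u c B) <= (size B)%:R * e + 2 * r.
Proof.
move=> u c [chiM chi1] uB he r1 r2.
pose X := \sum_(b <- B) c b *: phi (i (s + b)).
have XE : X = chi s *: \sum_(b <- B) c (s + b) *: u (s + b).
  rewrite scaler_sumr; apply: eq_bigr => b _; rewrite scalerA; congr (_ *: _).
  by rewrite /c chiM conjCM mulrA -toC_normc_sqr chi1 expr1n mul1r.
rewrite mulmxBl mul_scalar_mx; apply: le_trans (hs_trans X _ _) _; apply: lerD.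
  rewrite /combination mulmx_sumr -sumrB; apply: le_trans (hs_sum _ _) _.
  rewrite -sum1_size natr_sum mulr_suml big_seq [leRHS]big_seq; apply: ler_sum => b bB.
  by rewrite -scalemxAr -scalerBr hsZ normc_J chi1 !mul1r; exact: he.
rewrite XE -scalerBr hsZ chi1 mul1r /combination (sum_shift (fun b => c b *: u b) s uB).
apply: le_trans (hs_triangle _ _) _; rewrite hsN [2 * r]mulr_natl mulr2n.
exact: (lerD r1 r2).
Qed.

Lemma hs_adj_mul d (phi : G -> 'M[C]_d) (E : seq G) (e : R) a b :
  (forall g, phi g \is unitarymx) ->
  {in E &, forall g h, hs_norm (phi g *m phi h - phi (g * h)%g) <= e} ->
  a \in E -> (a^-1 * b)%g \in E ->
  hs_norm ((phi a)^t* *m phi b - phi (a^-1 * b)%g) <= e.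
Proof.
move=> phiU phiM aE abE; rewrite -(hs_unitaryl _ (phiU a)) mulmxBr mulmxA.
by rewrite (unitaryK (phiU a)) mul1mx hsB -[in phi b](mulVKg a b); exact: phiM.
Qed.

Lemma products_sub (X : seq G) : 1%g \in X -> {subset X <= [seq (g * h)%g | g <- X, h <- X]}.
Proof. by move=> X1 g gX; rewrite -[g]mulg1 (allpairs_f (fun g h => (g * h)%g)). Qed.

(** This and the next three inequalities supply the numerical hypotheses of [corner_unitary] for an
    average over [N] elements with [K = 2 * N]. *)
Lemma corner_trace_bound (N M h t : R) : 0 < N -> 0 < M -> t <= 1 -> 4 * N <= M * t ->
  `|h - N| <= N * t / 32 -> M / (2 * N) + 1 <= M * (N ^- 2 * h).
Proof.
move=> N0 M0 t1 MN /ler_normlP[+ _]; rewrite opprB => hN.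
have w4 : 4 <= M / N.
  by rewrite ler_pdivlMr //; apply: le_trans MN _; rewrite ler_piMr // ltW.
have hN' : (31 / 32) / N <= N ^- 2 * h.
  rewrite ler_pdivlMl ?exprn_gt0 // (_ : N ^+ 2 * (31 / 32 / N) = 31 / 32 * N).
    have : N * t <= N by rewrite ler_piMr // ltW.
    lra.
  by field; rewrite gt_eqF.
have := ler_wpM2l (ltW M0) hN'.
have -> : M * (31 / 32 / N) = 31 / 32 * (M / N) by ring.
have -> : M / (2 * N) = (M / N) / 2 by field; rewrite gt_eqF.
lra.
Qed.

Lemma corner_scale (D N h s : R) : 0 <= D -> 0 < N -> 2 * h ^+ 2 <= N * s ^+ 2 ->
  2 * N * (D * N ^- 2 * h ^+ 2) <= D * s ^+ 2.
Proof.
move=> D0 N0 hs; have -> : 2 * N * (D * N ^- 2 * h ^+ 2) = D * ((2 * h ^+ 2) / N).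
  by field; rewrite gt_eqF.
by rewrite ler_wpM2l // ler_pdivrMr // [_ * N]mulrC.
Qed.

Lemma corner_mult_bound (N dl : R) : 1 <= N -> 0 <= dl -> dl <= 1 ->
  2 * (dl ^+ 2 / 64) ^+ 2 <= N * dl ^+ 2.
Proof.
move=> N1 dl0 dl1; have t0 : 0 <= dl ^+ 2 := sqr_ge0 dl.
have t1 : dl ^+ 2 <= 1 by rewrite expr_le1.
have tN : 1 * dl ^+ 2 <= N * dl ^+ 2 by rewrite ler_wpM2r.
have : dl ^+ 2 * dl ^+ 2 <= 1 * dl ^+ 2 by rewrite ler_wpM2r.
have -> : (dl ^+ 2 / 64) ^+ 2 = dl ^+ 2 * dl ^+ 2 / 4096 by field.
move: t0 t1 tN; set t := dl ^+ 2; lra.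
Qed.

Lemma corner_scalar_bound (N h e dl : R) : 1 <= N -> 0 <= dl -> dl <= 1 -> 0 <= h ->
  N * e = dl ^+ 2 / 64 -> h <= N * e + 2 * (2 * dl * Num.sqrt N) ->
  2 * h ^+ 2 <= N * (6 * dl) ^+ 2.
Proof.
move=> N1 dl0 dl1 h0 -> hb; have N0 : 0 <= N by apply: le_trans N1.
have r2 : Num.sqrt N ^+ 2 = N by rewrite sqr_sqrtr.
have r1 : 1 <= Num.sqrt N by rewrite -sqrtr1 ler_wsqrtr.
move: r2 r1 hb; set r := Num.sqrt N => r2 r1 hb.
have d2 : dl ^+ 2 <= dl * r.
  by rewrite expr2 ler_wpM2l // (le_trans dl1).
have h2 : h <= 33 / 8 * (dl * r) by lra.
have : h ^+ 2 <= (33 / 8 * (dl * r)) ^+ 2.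
  by rewrite lerXn2r // nnegrE (le_trans h0).
have t0 : 0 <= N * dl ^+ 2 by rewrite mulr_ge0 ?sqr_ge0.
have -> : (33 / 8 * (dl * r)) ^+ 2 = 1089 / 64 * (r ^+ 2 * dl ^+ 2) by field.
have -> : N * (6 * dl) ^+ 2 = 36 * (N * dl ^+ 2) by ring.
rewrite r2; lra.
Qed.

Lemma hyperlinear_twisted (chi : A -> C) : hyperlinear R G -> unitary_char chi ->
  twisted_approx (i := i) (q := q) chi.
Proof.
move=> hyp uchi F FA e0 e00; have [chiM chi1] := uchi.
pose dl := Num.min (e0 / 8) 1.
have dl0 : 0 < dl by rewrite lt_min ltr01 divr_gt0.
have dl1 : dl <= 1 by rewrite ge_min lexx orbT.
have dle : 8 * dl <= e0 by rewrite mulrC -ler_pdivlMr // ge_min lexx.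
have dl20 : 0 < dl ^+ 2 by rewrite exprn_gt0.
have dl2 : dl ^+ 2 <= dl by rewrite expr2 ler_piMr // ltW.
have [B [uB B0 Bfol]] := foelner (FA ++ [seq - a | a <- FA]) dl20.
set N : R := (size B)%:R.
have N0 : 0 < N by rewrite ltr0n lt0n size_eq0.
have N1 : 1 <= N by rewrite ler1n lt0n size_eq0.
(* Chosen after the Foelner set, since errors add up over its [N] elements: [N * e] controls the
   defects, [N ^+ 2 * (2 * e)] the failure of orthogonality in the norm of the average. *)
pose e := dl ^+ 2 / (64 * N).
have Ne : N * e = dl ^+ 2 / 64 by rewrite /e; field; rewrite gt_eqF.
have NNe : N ^+ 2 * (2 * e) = N * dl ^+ 2 / 32.
  by rewrite /e; field; rewrite gt_eqF.
have e_gt0 : 0 < e by rewrite divr_gt0 // mulr_gt0.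
(* Large enough for the rounding error [N / M] of the corner to be at most [dl ^+ 2 / 4]. *)
have [M [Mpos MN]] : exists M : nat, (0 < M)%N /\ 4 * N / dl ^+ 2 <= M%:R.
  by exists (Num.truncn (4 * N / dl ^+ 2)).+1; split=> //; apply/ltW; exact: truncnS_gt.
have M0 : (0 : R) < M%:R by rewrite ltr0n.
have MN' : 4 * N <= M%:R * dl ^+ 2 by rewrite -ler_pdivrMr.
have NM : N / M%:R <= dl ^+ 2 / 4.
  by rewrite ler_pdivrMr // mulrAC ler_pdivlMr // mulrC [_ * M%:R]mulrC.
(* The approximation has to be controlled on words such as [(i a)^-1 * (g * i b)] with [a], [b] in
   [B]; each [P2] allows one more multiplication, and containing 1 makes the sets increase. *)
pose X0 := (1%g : G) :: F ++ [seq i a | a <- FA ++ [seq - a | a <- FA] ++ B ++ [seq - b | b <- B]].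
pose P2 (X : seq G) := [seq (g * h)%g | g <- X, h <- X].
pose X1 := P2 X0; pose X2 := P2 X1; pose X3 := P2 X2.
have P2M (X : seq G) g h : g \in X -> h \in X -> (g * h)%g \in P2 X.
  by move=> gX hX; exact: (allpairs_f (fun g h => (g * h)%g)).
have id0 : 1%g \in X0 by rewrite in_cons eqxx.
have s01 : {subset X0 <= X1} := products_sub id0.
have s12 : {subset X1 <= X2} := products_sub (s01 _ id0).
have s23 : {subset X2 <= X3} := products_sub (s12 _ (s01 _ id0)).
have [d [phi [d0 phiU phiM phiT]]] := hyperlinear_trace hyp X3 e_gt0.
pose u b := phi (i b); pose c b := (chi b)^*.
have uU b : u b \is unitarymx by exact: phiU.
have c1 b : normc (c b) = 1 by rewrite normc_J.
pose y := combination u c B; pose z := average u c B.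
have iM := ext_inclM ext.
have iN a : (i a)^-1%g = i (- a) by rewrite (ext_iN ext).
have inX0 a : a \in FA ++ [seq - a | a <- FA] ++ B ++ [seq - b | b <- B] -> i a \in X0.
  by move=> h; rewrite in_cons mem_cat map_f ?orbT.
have FX g : g \in F -> g \in X0 by move=> gF; rewrite in_cons mem_cat gF orbT.
have aX a : a \in FA -> i a \in X0 by move=> aF; apply: inX0; rewrite mem_cat aF.
have naX a : a \in FA -> i (- a) \in X0.
  by move=> aF; apply: inX0; rewrite !mem_cat map_f ?orbT.
have bX b : b \in B -> i b \in X0 by move=> bB; apply: inX0; rewrite !mem_cat bB !orbT.
have nbX b : b \in B -> i (- b) \in X0.
  by move=> bB; apply: inX0; rewrite !mem_cat (map_f _ bB) !orbT.
have X03 g : g \in X0 -> g \in X3 by move=> /s01 /s12 /s23.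
have X13 g : g \in X1 -> g \in X3 by move=> /s12 /s23.
have orth (D : seq A) : {in D, forall b, i b \in X1} -> {in D, forall b, i (- b) \in X1} ->
    {in D &, forall a b, a != b -> normc (ntrace ((u a)^t* *m u b)) <= 2 * e}.
  move=> D1 D2 a b aD bD ab.
  have abE : ((i a)^-1 * i b)%g \in X2.
    by rewrite iN; apply: P2M; [exact: D2|exact: D1].
  have h1 : hs_norm ((u a)^t* *m u b - phi ((i a)^-1 * i b)%g) <= e.
    by apply: (hs_adj_mul phiU phiM); [apply: X13; exact: D1|exact: s23].
  have h2 : normc (ntrace (phi ((i a)^-1 * i b)%g)) <= e.
    apply: phiT; first exact: s23.
    rewrite iN -iM; apply: contra ab => /eqP h.
    rewrite -subr_eq0 -oppr_eq0 opprB addrC; apply/eqP; apply: (ext_incl_inj ext).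
    by rewrite h (ext_i0 ext).
  rewrite -[_ *m _](subrK (phi ((i a)^-1 * i b)%g)) ntraceD [2 * e]mulr_natl mulr2n.
  apply: le_trans (le_normcD _ _) _; apply: lerD => //.
  exact: le_trans (ntrace_le _ d0) h1.
have e20 : 0 <= 2 * e by rewrite mulr_ge0 // ltW.
have b1 b : b \in B -> i b \in X1 by move=> /bX /s01.
have nb1 b : b \in B -> i (- b) \in X1 by move=> /nbX /s01.
have hs2y : `|hs2 y - N| <= N ^+ 2 * (2 * e) by apply: hs2_combination => //; exact: orth.
have hsD (D : seq A) : uniq D -> (size D)%:R <= dl ^+ 2 * N ->
    {in D, forall b, i b \in X1} -> {in D, forall b, i (- b) \in X1} ->
    hs_norm (combination u c D) <= 2 * dl * Num.sqrt N.
  move=> uD Dsz D1 D2; have := hs2_combination uU c1 d0 uD (orth D D1 D2) e20.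
  have := Dsz; set n : R := (size D)%:R; set h := hs2 _ => nN /ler_normlP[_ hn].
  have n0 : 0 <= n := ler0n _ _.
  have nN1 : n <= N by apply: le_trans nN _; rewrite ler_piMl ?(ltW N0) // (le_trans dl2).
  have nN2 : n ^+ 2 * (2 * e) <= N * dl ^+ 2 / 32.
    rewrite -NNe; by rewrite ler_wpM2r // lerXn2r // nnegrE ltW.
  rewrite -ler_sqr ?nnegrE ?hs_ge0 ?mulr_ge0 ?sqrtr_ge0 ?(ltW dl0) // hs_sqr -/h.
  have dN : 0 <= dl ^+ 2 * N by rewrite mulr_ge0 // ltW.
  rewrite !exprMn sqr_sqrtr ?(ltW N0) //.
  move: hn nN nN2 dN; rewrite [N * _]mulrC; set p := n ^+ 2 * _; set t := dl ^+ 2 * N.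
  have -> : 2 ^+ 2 * dl ^+ 2 * N = 4 * t by rewrite /t; ring.
  lra.
pose k := 4 * e; pose K := 2 * N.
have K0 : 0 < K by rewrite mulr_gt0.
have zh : z^t* = z := average_adj _ _ _.
have zpos (v : 'rV[C]_d) : 0 <= (v *m z *m v^t*) 0 0 := average_psd _ _ _ _.
have Kk : K * (k + M%:R^-1) <= dl ^+ 2.
  have -> : K * (k + M%:R^-1) = 8 * (N * e) + 2 * (N / M%:R) by rewrite /K /k; ring.
  by rewrite Ne; lra.
have trE (X : 'M[C]_d) : Re (\tr (X *m z *m X^t*)) = d%:R * N ^- 2 * hs2 (X *m y).
  exact: tr_average.
have trz : d%:R * (M%:R / K + 1) <= M%:R * Re (\tr z).
  have := trE 1%:M; rewrite tc1 mulmx1 !mul1mx => ->.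
  have -> : M%:R * (d%:R / N ^+ 2 * hs2 y) = d%:R * (M%:R * (N ^- 2 * hs2 y)) by ring.
  rewrite ler_pM2l ?ltr0n //.
  rewrite NNe in hs2y.
  exact: corner_trace_bound (le_trans dl2 dl1) MN' hs2y.
have dl_ge0 := ltW dl0.
have [m [psi0 [m0 psiU psiM psiA psiT]]] :=
  corner_unitary d0 zh zpos Mpos K0 trz (ltW (mulr_gt0 (ltr0Sn R 3) e_gt0)) dl0 Kk.
have central g : g \in X1 -> phi g \is unitarymx /\ hs_norm (z *m phi g - phi g *m z) <= k.
  move=> gX; split; first exact: phiU.
  have -> : k = 2 * (2 * e) by rewrite /k; ring.
  apply: average_commutator => // b bB.
  rewrite [2 * e]mulr_natl mulr2n; apply: le_trans (hs_trans (phi (i b * g)%g) _ _) _.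
  apply: lerD; first by apply: phiM; apply: X13; [exact: b1|].
  rewrite hsB (ext_central ext b g); apply: phiM; apply: X13; [|exact: b1].
  by [].
exists m, (psi0 \o phi); split=> //.
- move=> g; exact: psiU.
- move=> g h gF hF; apply: le_trans dle; rewrite /=.
  have gX := FX g gF; have hX := FX h hF.
  apply: psiM; [exact/central/s01|exact/central/s01|by apply: central; apply: P2M|].
  rewrite trE; have := hs_mul_combination uU c1 B (phi g *m phi h - phi (g * h)%g).
  rewrite -/y -/N -hs_sqr => hm; apply: corner_scale => //.
  have h2 : hs_norm (phi g *m phi h - phi (g * h)%g) <= e by apply: phiM; exact: X03.
  have h3 := le_trans hm (ler_wpM2l (ltW N0) h2).
  have h4 : hs_norm ((phi g *m phi h - phi (g * h)%g) *m y) ^+ 2 <= (N * e) ^+ 2.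
    by rewrite lerXn2r // nnegrE ?hs_ge0 // mulr_ge0 // ltW.
  apply: le_trans (ler_wpM2l (ler0n R 2) h4) _; rewrite Ne.
  exact: corner_mult_bound.
- move=> a aF; apply: le_trans dle; rewrite /=.
  have -> : 8 * dl = 2 * dl + 6 * dl by ring.
  have aX1 : i a \in X1 := s01 _ (aX a aF).
  apply: psiA; [exact: central|by rewrite mulr_ge0|].
  rewrite trE -hs_sqr; apply: corner_scale => //.
  apply: corner_scalar_bound Ne _ => //; first exact: hs_ge0.
  apply: hs_twisted_average => //.
  + move=> b bB; rewrite iM; apply: phiM; apply: X03; [exact: aX|exact: bX].
  + apply: hsD.
    * by rewrite (map_inj_uniq (@addrI _ a)) filter_uniq.
    * by rewrite size_map; apply: Bfol; rewrite mem_cat aF.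
    * move=> _ /mapP[b + ->]; rewrite mem_filter => /andP[_ bB].
      by rewrite iM; apply: P2M; [exact: aX|exact: bX].
    * move=> _ /mapP[b + ->]; rewrite mem_filter => /andP[_ bB].
      by rewrite opprD iM; apply: P2M; [exact: naX|exact: nbX].
  + apply: hsD.
    * by rewrite filter_uniq.
    * by apply: Bfol; rewrite mem_cat map_f ?orbT.
    * by move=> b; rewrite mem_filter => /andP[_ /b1].
    * by move=> b; rewrite mem_filter => /andP[_ /nb1].
- move=> g gF qg; apply: le_trans (_ : 2 * dl + dl <= _); last first.
    by apply: le_trans dle; lra.
  have gX := FX g gF.
  apply: psiT => //; first exact/central/s01.
  have h1 : normc (\tr (z *m phi g)) <= d%:R * (3 * e).
    apply: tr_average_mul => // a b aB bB.
    have gb1 : (g * i b)%g \in X1 by apply: P2M; [|exact: bX].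
    have w2 : ((i a)^-1 * (g * i b))%g \in X2.
      by apply: P2M gb1; rewrite iN; exact: nb1.
    have e1 : hs_norm ((u a)^t* *m (phi g *m u b) - (u a)^t* *m phi (g * i b)%g) <= e.
      have ua : (u a)^t* \is unitarymx by rewrite trmxC_unitary; exact: uU.
      rewrite -mulmxBr (hs_unitaryl _ ua); apply: phiM; apply: X03 => //.
      exact: bX.
    have e2 : hs_norm ((u a)^t* *m phi (g * i b)%g - phi ((i a)^-1 * (g * i b))%g) <= e.
      by apply: (hs_adj_mul phiU phiM); [apply: X13; exact: b1|exact: s23].
    have e3 : normc (ntrace (phi ((i a)^-1 * (g * i b))%g)) <= e.
      apply: phiT; first exact: s23.
      apply: contra qg => /eqP /(congr1 q).
      by rewrite !(ext_quotM ext) (ext_qV ext) !(ext_qi ext) (ext_q1 ext) invg1 mul1g mulg1 => ->.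
    rewrite -[_ *m (_ *m _)](subrK (phi ((i a)^-1 * (g * i b))%g)) ntraceD.
    have -> : 3 * e = e + e + e by ring.
    apply: le_trans (le_normcD _ _) _; apply: lerD e3.
    apply: le_trans (ntrace_le _ d0) _.
    exact: le_trans (hs_trans _ _ _) (lerD e1 e2).
  have h2 : M%:R * normc (\tr (z *m phi g)) <= M%:R * (d%:R * (3 * e)) by rewrite ler_wpM2l.
  apply: le_trans (_ : K * (d%:R + M%:R * (d%:R * (3 * e))) <= _).
    by rewrite ler_wpM2l ?(ltW K0) // lerD2l.
  have -> : K * (d%:R + M%:R * (d%:R * (3 * e))) =
      d%:R * M%:R * (2 * (N / M%:R) + 6 * (N * e)).
    by rewrite /K; field; rewrite gt_eqF.
  rewrite ler_wpM2l ?mulr_ge0 // Ne; lra.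
Qed.

End HyperlinearTwisted.

(** * Characters of G extending small characters of A *)

Section AdditiveExtension.
Context {R : realType} {A : zmodType}.

(** Graphs of additive maps on subgroups of [A] that send [a0] to 1; functionality is the last
    clause, by closure under differences. *)
Definition partial_additive (a0 : A) (X : set (A * R)) : Prop :=
  [/\ X (a0, 1), forall p r, X p -> X r -> X (p - r) & forall r, X (0, r) -> r = 0].

(** Zorn's lemma on such graphs, with the divisibility of [R] for the extension by one element.
    Torsion-freeness makes the multiples of [a0] a first graph. *)
Lemma additive_extension (a0 : A) : torsion_free A -> a0 != 0 ->
  exists f : A -> R, (forall a b, f (a + b) = f a + f b) /\ f a0 = 1.
Proof.
move=> Atf a0_neq0.
have tf_int (a : A) (k : int) : a *~ k = 0 -> k != 0 -> a = 0.
  case: k => [[|n]|n] //; first by move=> h _; exact: Atf h.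
  by rewrite NegzE mulrNz => /eqP; rewrite oppr_eq0 => /eqP h _; exact: Atf h.
pose X0 : set (A * R) := range (fun k : int => (a0 *~ k, k%:~R)).
have X0P : partial_additive a0 X0.
  split; first by exists 1.
  - by move=> _ _ [k _ <-] [l _ <-]; exists (k - l) => //; rewrite mulrzBr rmorphB.
  - move=> r [k _ [ka <-]]; have [->|k0] := eqVneq k 0; first by [].
    by have := tf_int _ _ ka k0; move/eqP; rewrite (negPf a0_neq0).
have [M [MP Mmax]] : exists M, (M = set0 \/ partial_additive a0 M) /\
    forall X, M `<` X -> ~ (X = set0 \/ partial_additive a0 X).
  apply: (@Zorn_bigcup _ (fun X => X = set0 \/ partial_additive a0 X)) => F FP Ftot.
  have [allE|/existsNP[Y /not_implyP[FY Y0]]] := pselect (forall Y, F Y -> Y = set0).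
    by left; apply/seteqP; split=> // p [Y FY]; rewrite (allE Y FY).
  right; have PY Z p : F Z -> Z p -> partial_additive a0 Z.
    by move=> FZ Zp; have [Z0|//] := FP Z FZ; move: Zp; rewrite Z0.
  have [//|[Ya _ _]] := FP Y FY.
  split; first by exists Y.
  - move=> p r [Z FZ Zp] [W FW Wr]; have [ZW|WZ] := Ftot Z W FZ FW.
      have [_ WB _] := PY W r FW Wr; exists W => //; apply: WB => //; exact: ZW.
    have [_ ZB _] := PY Z p FZ Zp; exists Z => //; apply: ZB => //; exact: WZ.
  - by move=> r [Z FZ Zr]; have [_ _] := PY Z _ FZ Zr; exact.
have {}MP : partial_additive a0 M.
  case: MP => // M0; exfalso; apply: (Mmax X0); last by right.
  by rewrite M0; split=> // /(_ (a0, 1)); apply; have [] := X0P.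
have [Ma MB M0] := MP.
have M00 : M (0, 0) by have := MB _ _ Ma Ma; rewrite subrr.
have MN p : M p -> M (- p) by move=> Mp; rewrite -[- p]add0r; exact: MB.
have MD p r : M p -> M r -> M (p + r).
  by move=> Mp Mr; rewrite -[r]opprK; apply: MB => //; exact: MN.
have pairn (a : A) (r : R) n : (a, r) *+ n = (a *+ n, r *+ n).
  by elim: n => [|n IH]; rewrite ?mulr0n // !mulrS IH.
have Mn a r n : M (a, r) -> M (a *+ n, r *+ n).
  by move=> Mar; rewrite -pairn; elim: n => [|n IH]; rewrite ?mulr0n // mulrS; exact: MD.
have Mfun a r r' : M (a, r) -> M (a, r') -> r = r'.
  move=> h h'; apply/eqP; rewrite -subr_eq0; apply/eqP/M0.
  by have := MB _ _ h h'; rewrite -[(a, r) - (a, r')]/(a - a, r - r') subrr.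
have total b : exists r, M (b, r).
  apply: contrapT => nob.
  (* If some positive multiple of [b] is in the domain, the value at [b] is forced by division;
     otherwise it is free and 0 is taken. *)
  have [rho rhoP] : exists rho : R, forall (n : nat) r, M (b *+ n.+1, r) -> r = rho *+ n.+1.
    have [[n [r Mr]]|no] := pselect (exists (n : nat) r, M (b *+ n.+1, r)); last first.
      by exists 0 => n r Mr; case: no; exists n, r.
    exists (r / n.+1%:R) => n' r' Mr'; apply: (mulIf (_ : n.+1%:R != 0 :> R)).
      by rewrite pnatr_eq0.
    rewrite -mulrnAl mulrVK ?unitfE ?pnatr_eq0 // mulr_natr.
    apply: (Mfun (b *+ n.+1 *+ n'.+1)); last exact: (Mn _ _ n'.+1 Mr).
    by rewrite mulrnAC; exact: (Mn _ _ n.+1 Mr').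
  have rhoZ (l : int) r : M (b *~ l, r) -> r = rho *~ l.
    case: l => [[|n]|n]; first by move=> /M0.
      exact: rhoP.
    rewrite NegzE !mulrNz => /MN; rewrite -[- (_, _)]/(- - _, - r) opprK => /rhoP.
    by rewrite -pmulrn => <-; rewrite opprK.
  pose X (p : A * R) := exists (m : A * R) (k : int), M m /\ p = m + (b, rho) *~ k.
  have pairz (k : int) : (b, rho) *~ k = (b *~ k, rho *~ k).
    by case: k => n; rewrite ?NegzE ?mulrNz -?pmulrn pairn.
  apply: (Mmax X); last first.
    right; split.
    - by exists (a0, 1), 0; rewrite mulr0z addr0.
    - move=> _ _ [m [k [Mm ->]]] [m' [k' [Mm' ->]]]; exists (m - m'), (k - k').
      by rewrite mulrzBr opprD addrACA; split=> //; exact: MB.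
    - move=> r [[a s] [k [Mas]]]; rewrite pairz => -[a_eq ->].
      have sE : s = rho *~ (- k).
        apply: rhoZ; rewrite mulrNz; congr (M (_, s)) : Mas; apply/eqP.
        by rewrite -addr_eq0 -a_eq.
      by rewrite sE mulrNz addNr.
  split=> [m Mm|/(_ (b, rho)) h]; first by exists m, 0; rewrite mulr0z addr0.
  by apply: nob; exists rho; apply: h; exists 0, 1; rewrite add0r.
have [f fM] := choice total; exists f; split=> [a b|]; last exact: (Mfun a0).
by apply: (Mfun (a + b)) => //; exact: (MD _ _ (fM a) (fM b)).
Qed.

End AdditiveExtension.

(** * The circle and sequences of circle-valued maps *)

Section Circle.
Context {R : realType}.
Local Notation C := R[i].
Local Notation Im := (@complex.Im R).

Local Existing Instance omega_proper.

Definition circle (x : R) : C := Complex (cos x) (sin x).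

Lemma circleD x y : circle (x + y) = circle x * circle y.
Proof. by apply: complex_eq; rewrite ?ReM ?ImM /= ?cosD ?sinD // addrC; ring. Qed.

Lemma normc_circle x : normc (circle x) = 1.
Proof. by rewrite /= cos2Dsin2 sqrtr1. Qed.

Lemma circle_neq1 x : 0 < x -> x < 2 -> circle x != 1.
Proof.
move=> x0 x2; apply/eqP => /(congr1 Im) /= sx.
by have := @sin_gt0_pi R x; rewrite x0 (lt_le_trans x2 (pi_ge2 R)) sx ltxx => /(_ isT).
Qed.

Lemma circle_near1 (dl : R) : 0 < dl ->
  exists2 e, 0 < e & forall x, `|x| <= e -> normc (circle x - 1) <= dl.
Proof.
move=> dl0; have dl20 : 0 < dl / 2 by rewrite divr_gt0.
have /cvgrPdist_le /(_ _ dl20) cc := @continuous_cos R 0.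
have /cvgrPdist_le /(_ _ dl20) ss := @continuous_sin R 0.
have [e /= e0 he] := (nbhs_ballP (0 : R) _).1 (filterI cc ss).
exists (e / 2); first by rewrite divr_gt0.
move=> x xe; have [] : ball (0 : R) e x.
  by rewrite /ball /= sub0r normrN (le_lt_trans xe) // ltr_pdivrMr // ltr_pMr // ltr1n.
move=> /he [] /=; rewrite cos0 sin0 sub0r normrN => c1 s0.
have := lerD c1 s0; rewrite -splitr; apply: le_trans.
apply: le_trans (normc_le_ReIm (circle x - 1)) _; apply: lerD.
  by rewrite ReD ReN /= distrC.
by rewrite ImD ImN /= subr0.
Qed.

Lemma culim_near (u : nat -> C) (d : R) : ubounded u -> 0 < d ->
  \forall n \near omega, normc (u n - culim u) <= d.
Proof.
move=> ub d0; have d20 : 0 < d / 2 by rewrite divr_gt0.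
have /cvgrPdist_le /(_ _ d20) := ubounded_Re ub.
have /cvgrPdist_le /(_ _ d20) := ubounded_Im ub.
apply: filterS2 => n hi hr; rewrite normcB; apply: le_trans (normc_le_ReIm _) _.
by rewrite [d]splitr; apply: lerD; rewrite ?ReD ?ReN ?ImD ?ImN.
Qed.

(** The pointwise ultralimit is approached on the finite set [Q] by ultrafilter-many indices; two of
    them are close to each other. *)
Lemma near_repetition (X : eqType) (b : nat -> X -> C) (Q : seq X) (d : R) :
  (forall n x, normc (b n x) = 1) -> 0 < d ->
  exists n m, (n < m)%N /\ {in Q, forall x, normc (b n x - b m x) <= d}.
Proof.
move=> b1 d0; have d20 : 0 < d / 2 by rewrite divr_gt0.
pose l x := culim (b^~ x).
have ub x : ubounded (b^~ x) by exists 1 => n; rewrite b1.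
have near_l : \forall n \near omega, {in Q, forall x, normc (b n x - l x) <= d / 2}.
  elim: Q => [|x Q IH]; first by near=> n.
  have := culim_near (ub x) d20; move: IH; apply: filterS2 => n hQ hx y.
  by rewrite in_cons => /orP[/eqP ->|/hQ].
have [n hn] := filter_ex near_l.
have [m [nm hm]] : exists m, (n < m)%N /\ {in Q, forall x, normc (b m x - l x) <= d / 2}.
  have : \forall m \near omega, (n < m)%N by apply: omega_oo; exists n.+1.
  by move=> h; have [m [h1 h2]] := filter_ex (filterI h near_l); exists m.
exists n, m; split=> // x xQ; rewrite -[b n x](subrK (l x)) -addrA [d]splitr.
apply: le_trans (le_normcD _ _) _; apply: lerD; first exact: hn.
by rewrite normcB; exact: hm.
Unshelve. all: by end_near. Qed.

End Circle.

(** * Isolation of the trivial character under property (T) *)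

Section CharacterRigidity.
Context {R : realType} {G : groupType}.
Local Notation C := R[i].
Local Notation toC := (real_complex R).
Local Notation Re := (@complex.Re R).
Local Notation Im := (@complex.Im R).

Definition group_char (b : G -> C) : Prop :=
  (forall g h, b (g * h)%g = b g * b h) /\ (forall g, normc (b g) = 1).

Lemma group_char1 b : group_char b -> b 1%g = 1.
Proof.
move=> [bM b1]; have c0 : b 1%g != 0 by rewrite -normc_eq0 b1 oner_neq0.
by apply: (mulfI c0); rewrite -bM mulr1 mulg1.
Qed.

Lemma group_charV b g : group_char b -> b g^-1%g = (b g)^*.
Proof.
move=> cb; have [bM b1] := cb.
have c0 : b g != 0 by rewrite -normc_eq0 b1 oner_neq0.
by apply: (mulfI c0); rewrite -bM mulgV (group_char1 cb) -toC_normc_sqr b1 expr1n.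
Qed.

Lemma group_char_posdef b : group_char b -> posdef b.
Proof.
move=> cb s; rewrite kform_sum; have [bM _] := cb.
pose z := \sum_(p <- s) p.1 * b p.2.
have -> : \sum_(p <- s) \sum_(r <- s) p.1 * r.1^* * b (r.2^-1 * p.2)%g = z * z^*.
  rewrite /z rmorph_sum big_distrl; apply: eq_bigr => p _ /=.
  rewrite big_distrr; apply: eq_bigr => r _ /=.
  by rewrite bM (group_charV _ cb) conjCM; ring.
by rewrite -toC_normc_sqr ler0c sqr_ge0.
Qed.

Lemma posdef_normc_le (f : G -> C) g : posdef f -> normc (f g) <= Re (f 1%g).
Proof.
move=> fp; have := kform_CauchySchwarz fp [:: (1, g)] [:: (1, 1%g)].
have f1 : 0 <= Re (f 1%g).
  have := Re_ge0 (fp [:: (1, 1%g)]).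
  by rewrite kform_sum !big_seq1 /= conjC1 !mul1r mulg1 invg1.
rewrite /ksqr !kform_sum !big_seq1 /= conjC1 !mul1r invg1 mul1g mulVg mulg1 -expr2.
by rewrite ler_sqr ?nnegrE ?normc_ge0.
Qed.

(* [b - c] is positive definite for some [0 < c <= 1], hence [|b g - c| <= 1 - c],
   and [1] is the only point of the unit circle in this disc. *)
Lemma character_rigidity : property_T R G -> exists (Q : seq G) (k : R), 0 < k /\
  forall b, group_char b -> {in Q, forall g, 1 - Re (b g) <= k} -> forall g, b g = 1.
Proof.
move=> GT; have [Q [eps [eps0 QP]]] := property_T_posdef GT.
have e20 : 0 < eps ^+ 2 by rewrite exprn_gt0.
exists Q, (eps ^+ 2 / 4); split=> [|b cb bQ g]; first by rewrite divr_gt0.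
have [bM b1] := cb.
have [||c /andP[c_ge c_le] cpd] := QP b (eps ^+ 2 / 4) (group_char_posdef cb) (group_char1 cb).
- by rewrite divr_ge0 // ltW.
- exact: bQ.
have c2 : 1 / 2 <= c.
  apply: le_trans c_ge; rewrite (_ : 2 * (eps ^+ 2 / 4) / eps ^+ 2 = 1 / 2); first lra.
  by field; rewrite gt_eqF.
have := posdef_normc_le g cpd; rewrite (group_char1 cb) ReD ReN /= => h.
have : normc (b g - toC c) ^+ 2 <= (1 - c) ^+ 2.
  by rewrite lerXn2r // nnegrE ?normc_ge0 // subr_ge0.
rewrite normc_sqr ReD ImD ReN ImN /= subr0; have := normc_sqr (b g); rewrite b1 expr1n.
set x := Re (b g); set y := Im (b g) => xy1 le1.
(* Expanding [|b g - c|^2 <= (1 - c)^2] with [|b g| = 1] leaves this inequality. *)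
have : c * (1 - x) <= 0 by move: le1 xy1; rewrite !sqrrD; lra.
rewrite pmulr_rle0; last lra.
rewrite subr_le0 => x1; have x2 : x ^+ 2 >= 1 by rewrite -[1](expr1n _ 2) lerXn2r // nnegrE; lra.
have y0 : y ^+ 2 = 0 by apply/eqP; rewrite eq_le sqr_ge0 andbT; lra.
have y00 : y = 0 by apply/eqP; rewrite -sqrf_eq0 y0.
have x11 : x = 1.
  have := xy1; rewrite y0 addr0 => /esym/eqP; rewrite sqrf_eq1 => /orP[/eqP //|/eqP xN].
  by move: x1; rewrite xN; lra.
by apply: complex_eq.
Qed.

End CharacterRigidity.

(** * Characters of a central extension *)

Section CentralExtensionCharacters.
Context {R : realType} {Gamma G : groupType} {A : zmodType} {i : A -> G} {q : G -> Gamma}.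
Hypothesis ext : central_extension i q.
Local Notation C := R[i].

Lemma ext_countable : countable [set: A] -> countable [set: Gamma] -> countable [set: G].
Proof.
move=> Ac Gc; have [s sK] := ext_section ext.
apply: sub_countable (countableX Ac Gc).
apply: card_le_trans (card_image_le (fun p => (i p.1 * s p.2)%g) _).
apply: subset_card_le => g _; have [a gE] := ext_fiber ext (esym (sK (q g))).
by exists (a, q g).
Qed.

Lemma circle_characters (a0 : A) : torsion_free A -> a0 != 0 ->
  countable [set: A] -> countable [set: Gamma] ->
  property_T R Gamma -> weakly_ucp_stable R Gamma -> hyperlinear R G ->
  exists (f : A -> R) (t0 : R), [/\ f a0 = 1, 0 < t0, t0 <= 1 &
  forall t, 0 < t -> t <= t0 ->
    exists2 b : G -> C, group_char b & forall a, b (i a) = (circle (t * f a))^*].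
Proof.
move=> Atf a0_neq0 Ac Gc GT stable hyp.
have [f [fD f1]] := additive_extension (R := R) Atf a0_neq0.
have [SA [dl [dl0 tw]]] := twisted_character ext (ext_countable Ac Gc) Gc GT stable.
have [e e0 ce] := circle_near1 dl0.
pose N := 1 + \sum_(a <- SA) `|f a|.
have N0 : 0 < N by rewrite ltr_pwDl // sumr_ge0.
(* The second bound gives [|t * f a| <= e] on [SA]; the first keeps [t * f a0 = t] in a range where
   [circle] avoids 1. *)
exists f, (Num.min 1 (e / N)); split=> //.
- by rewrite lt_min ltr01 divr_gt0.
- by rewrite ge_min lexx.
move=> t t_gt0; rewrite le_min => /andP[_ te].
have uchi : unitary_char (fun a => circle (t * f a)).
  by split=> [a b|a]; rewrite ?fD ?mulrDr ?circleD // normc_circle.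
have [|b [bM b1 ba]] := tw _ uchi (hyperlinear_twisted ext hyp uchi).
  move=> a aS; apply: ce; rewrite normrM gtr0_norm //.
  have faN : `|f a| <= N.
    by rewrite /N (big_rem a) //= addrCA lerDl addr_ge0 // sumr_ge0.
  rewrite ler_pdivlMr // in te; apply: le_trans te.
  by rewrite ler_wpM2l // ltW.
by exists b.
Qed.

(* If the commutator subgroup of [G] met the image of [A] trivially, it would be
   the image of a section of [q]. *)
Lemma perfect_commutator_kernel : perfect Gamma -> ~ split_extension q ->
  exists2 a0 : A, a0 != 0 & forall b : G -> C, group_char b -> b (i a0) = 1.
Proof.
move=> Gperf nonsplit.
(* The commutator subgroup of [G], as the intersection of all subgroups containing the
   commutators. *)
pose D (g : G) := forall K : {pred G}, group_closed K ->
  (forall x y, [~ x, y]%g \in K) -> g \in K.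
have D1 : D 1%g by move=> K [].
have Ddiv g h : D g -> D h -> D (g / h)%g.
  by move=> gD hD K Kg Kc; apply: Kg.2; [exact: gD|exact: hD].
have DM g h : D g -> D h -> D (g * h)%g.
  by move=> gD hD K Kg Kc; apply: group_closedM => //; [exact: gD|exact: hD].
(* The image of [D] is a subgroup of [Gamma] containing all commutators, so lifts can be chosen
   inside [D]. *)
have Dq x : exists g, D g /\ q g = x.
  pose S : {pred Gamma} := [pred x | `[< exists g, D g /\ q g = x >]].
  have SP y : (y \in S) <-> exists g, D g /\ q g = y.
    have -> : (y \in S) = `[< exists g, D g /\ q g = y >] by [].
    by split=> [/asboolP|?] //; apply/asboolP.
  apply/SP/Gperf.
  - split; first by apply/SP; exists 1%g; split; rewrite ?(ext_q1 ext).
    move=> y z /SP[g [gD <-]] /SP[h [hD <-]]; apply/SP; exists (g / h)%g.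
    by split; [exact: Ddiv|rewrite (ext_quotM ext) (ext_qV ext)].
  - move=> y z; have [s sK] := ext_section ext; apply/SP.
    exists [~ s y, s z]%g; split; first by move=> K _; apply.
    by rewrite /commg /conjg !(ext_quotM ext) !(ext_qV ext) !sK.
have [s sP] := choice Dq.
apply: contrapT => no; apply: nonsplit; exists s; last by move=> x; have [] := sP x.
move=> x y; have [xD qx] := sP x; have [yD qy] := sP y; have [xyD qxy] := sP (x * y)%g.
have gD : D (s (x * y) / (s x * s y))%g by apply: Ddiv => //; exact: DM.
have [a aE] : exists a, (s (x * y) / (s x * s y))%g = i a.
  by apply: (ext_ker ext); rewrite (ext_quotM ext) (ext_qV ext) (ext_quotM ext) qx qy qxy mulgV.
suff a0 : a = 0.
  by rewrite -[LHS](mulgVK (s x * s y)%g) aE a0 (ext_i0 ext) mul1g.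
apply/eqP; apply: contrapT => /negP a_neq0; apply: no; exists a => // b [bM b1].
(* The kernel of a character is one of the subgroups intersected in [D], so it contains the
   multiplicativity defect [i a] of the lifts. *)
pose K : {pred G} := [pred g | b g == 1].
have cb : group_char b by [].
apply/eqP; rewrite -aE; apply: (gD K).
- split; first by rewrite inE (group_char1 cb).
  move=> g h; rewrite !inE => /eqP g1 /eqP h1.
  by rewrite bM (group_charV _ cb) g1 h1 conjC1 mulr1.
- move=> g h; rewrite inE /commg /conjg !bM !(group_charV _ cb).
  have bb k : (b k)^* * b k = 1 by rewrite mulrC -toC_normc_sqr b1 expr1n.
  apply/eqP; transitivity (((b g)^* * b g) * ((b h)^* * b h)); first by ring.
  by rewrite (bb g) (bb h) mulr1.
Qed.

End CentralExtensionCharacters.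

Theorem theorem1p6 (R : realType) (Gamma G : groupType) (A : zmodType)
    (i : A -> G) (q : G -> Gamma)
    (Gamma_countable : countable [set: Gamma])
    (Gamma_T : property_T R Gamma)
    (A_countable : countable [set: A])
    (A_torsion_free : torsion_free A)
    (ext : central_extension i q)
    (ext_nonsplit : ~ split_extension q)
    (Gamma_perfect_or_G_T : perfect Gamma \/
       (property_T R G /\ exists f : {additive int -> A}, bijective f))
    (Gamma_stable : weakly_ucp_stable R Gamma) :
  ~ hyperlinear R G.
Proof.
move=> hyp; case: Gamma_perfect_or_G_T => [Gperf|[GT [phi phi_bij]]].
  have [a0 a0_neq0 ba0] := perfect_commutator_kernel (R := R) ext Gperf ext_nonsplit.
  have [f [t0 [f1 t00 t01 char]]] := circle_characters ext A_torsion_free a0_neq0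
    A_countable Gamma_countable Gamma_T Gamma_stable hyp.
  have [b cb bi] := char t0 t00 (lexx _).
  have := ba0 b cb; rewrite bi f1 mulr1 => /(congr1 (@conjC _)); rewrite conjCK conjC1.
  apply/eqP; apply: circle_neq1 => //; apply: le_lt_trans t01 _.
  by rewrite ltr1n.
pose a0 := phi 1.
have a0_neq0 : a0 != 0.
  by rewrite -(raddf0 phi) (inj_eq (bij_inj phi_bij)).
have [f [t0 [f1 t00 t01 char]]] := circle_characters ext A_torsion_free a0_neq0
  A_countable Gamma_countable Gamma_T Gamma_stable hyp.
have [Q [k [k0 rigid]]] := character_rigidity GT.
(* Strictly decreasing parameters in []0, t0]]; their differences stay below 2, where [circle]
   cannot return to 1. *)
pose t n : R := t0 * harmonic n.
have t_gt0 n : 0 < t n by rewrite mulr_gt0 ?harmonic_gt0.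
have t_le n : t n <= t0 by rewrite ler_piMr ?(ltW t00) // invf_le1 ?ler1n.
have /choice[b bP] n : exists b : G -> R[i], group_char b /\
    forall a, b (i a) = (circle (t n * f a))^*.
  by have [b cb bi] := char (t n) (t_gt0 n) (t_le n); exists b.
have [n [m [nm close]]] := near_repetition Q (fun n => (bP n).1.2) k0.
have [[bnM bn1] bni] := bP n; have [[bmM bm1] bmi] := bP m.
pose h g := b n g * (b m g)^*.
have ch : group_char h.
  split=> [x y|x]; first by rewrite /h bnM bmM conjCM; ring.
  by rewrite /h normcM normc_J bn1 bm1 mulr1.
have h1 : h (i a0) = 1.
  apply: rigid => // g gQ.
  have -> : 1 - complex.Re (h g) = - complex.Re ((b n g - b m g) * (b m g)^*).
    rewrite mulrBl -toC_normc_sqr bm1 expr1n /h; set z := _ * _.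
    by rewrite ReD ReN opprD opprK addrC.
  rewrite -ReN; apply: le_trans (Re_le_normc _) _.
  by rewrite normcN normcM normc_J bm1 mulr1; exact: close.
have tmn : t m < t n.
  rewrite ltr_pM2l // ltf_pV2 ?posrE ?ltr0n //.
  by rewrite ltr_nat ltnS.
have := h1; rewrite /h bni bmi f1 !mulr1 => /(congr1 (@conjC _)).
rewrite conjCM !conjCK conjC1 => cc.
have : circle (t n - t m) != 1.
  apply: circle_neq1; first by rewrite subr_gt0.
  have := t_le n; have := t_gt0 m; lra.
case/eqP; rewrite circleD -cc; congr (_ * _).
by apply: complex_eq; rewrite ?ReJ ?ImJ /= ?cosN ?sinN.
Qed.
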